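(* Let $\ell$ be a commutative unital ring, let $E$ and $F$ be directed graphs such that $E^0$ and $F^0$ are finite, let $j:\mathrm{Alg}_\ell\to kk$ be the universal excisive, homotopy invariant, $E\sqcup F$-stable homology theory, and let $\theta\in kk(L(E),L(F))$, where $L(E)$, $L(F)$ are the Leavitt path algebras over $\ell$. Assume that $KH_i(\theta):KH_i(L(E))\to KH_i(L(F))$ is an isomorphism for $i=0,1$. Then $\theta$ is an isomorphism in $kk$. In particular $KH_n(\theta)$ is an isomorphism for all $n\in\mathbb{Z}$.
   Context: Graphs and Leavitt path algebras. A directed graph $E=(E^0,E^1,r,s)$ has vertex set $E^0$, edge set $E^1$ and range and source maps $r,s:E^1\to E^0$ ($E^1$ may be infinite). A vertex $v$ is regular if $s^{-1}(v)$ is finite and nonempty; $\operatorname{reg}(E)$ is the set of regular vertices. The Leavitt path algebra $L(E)$ over $\ell$ is the quotient of the free associative $\ell$-algebra on $E^0\cup E^1\cup\{e^*:e\in E^1\}$ by the relations $vw=\delta_{v,w}v$ $(v,w\in E^0)$; $s(e)e=e=e\,r(e)$ and $r(e)e^*=e^*=e^*s(e)$ $(e\in E^1)$; $e^*f=\delta_{e,f}r(e)$ $(e,f\in E^1)$; $v=\sum_{s(e)=v}ee^*$ $(v\in\operatorname{reg}(E))$. Homology theories and $kk$. $\mathrm{Alg}_\ell$ is the category of associative, not necessarily unital $\ell$-algebras. A homology theory is a functor $X:\mathrm{Alg}_\ell\to\mathcal T$ to a triangulated category $\mathcal T$ with inverse suspension $\Omega$. An extension is a short exact sequence of algebras $0\to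 A\to B\to C\to 0$ which splits $\ell$-linearly. $X$ is excisive if it comes equipped with maps $\partial:\Omega X(C)\to X(A)$, one for each extension, natural with respect to morphisms of extensions, such that $\Omega X(C)\to X(A)\to X(B)\to X(C)$ is a distinguished triangle. $X$ is homotopy invariant if it maps each inclusion $A\subset A[t]$ to an isomorphism. For a set $S$, $M_SA$ is the algebra of finitely supported $S\times S$-matrices with entries in $A$; $X$ is $M_S$-stable if for every $A$ and $s\in S$ it maps $A\to M_SA$, $a\mapsto \epsilon_{s,s}\otimes a$ to an isomorphism ($\epsilon_{s,t}$ are the matrix units). For a graph $G$, $X$ is $G$-stable if it is $M_S$-stable for $S=G^0\sqcup G^1\sqcup\mathbb{N}$; here $G=E\sqcup F$ is the disjoint union. For each infinite set $S$ there is a universal excisive, homotopy invariant, $M_S$-stable homology theory $j:\mathrm{Alg}_\ell\to kk$, i.e. an initial one, where morphisms $X\to Y$ are triangulated functors $H$ with $HX=Y$ compatible with the maps $\partial$. Put $kk_n(A,B)=\hom_{kk}(j(A),\Omega^nj(B))$ and $kk(A,B)=kk_0(A,B)$. There is a natural isomorphism $kk_n(\ell,B)\cong KH_n(B)$, where $KH$ is Weibel's homotopy algebraic $K$-theory; for $\theta\in kk(A,B)$, $KH_n(\theta):KH_n(A)\to KH_n(B)$ is composition with $\theta$ under this identification. *)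

(* Defs.v *)
From HB Require Import structures.
From mathcomp Require Import all_boot all_order all_algebra.
From mathcomp Require Import generic_quotient ring_quotient.
From mathcomp Require Import finmap.
From mathcomp Require Import boolp classical_sets functions cardinality fsbigop.

Set Implicit Arguments.
Unset Strict Implicit.
Unset Printing Implicit Defensive.

Import GRing.Theory.

Local Open Scope classical_set_scope.
Local Open Scope quotient_scope.
Local Open Scope ring_scope.

Declare Scope alg_scope.
Delimit Scope alg_scope with alg.
Local Open Scope alg_scope.

HB.mixin Record isAssocAlgebra (R : pzRingType) A of GRing.Lmodule R A := {
  amul : A -> A -> A;
  amulA : associative amul;
  amulDl : left_distributive amul +%R;
  amulDr : right_distributive amul +%R;
  amulZl : forall (a : R) (x y : A), amul (a *: x) y = a *: amul x y;
  amulZr : forall (a : R) (x y : A), amul x (a *: y) = a *: amul x y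
}.

#[short(type="assocAlgType")]
HB.structure Definition AssocAlgebra (R : pzRingType) :=
  {A of GRing.Lmodule R A & isAssocAlgebra R A}.

Notation "x ** y" := (amul x y) (at level 40, left associativity) : alg_scope.

Lemma amul0l (R : pzRingType) (A : assocAlgType R) (x : A) : 0 ** x = 0.
Proof. by apply: (addIr (0 ** x)); rewrite -amulDl !add0r. Qed.

Lemma amul0r (R : pzRingType) (A : assocAlgType R) (x : A) : x ** 0 = 0.
Proof. by apply: (addIr (x ** 0)); rewrite -amulDr !add0r. Qed.

Lemma amul_suml (R : pzRingType) (A : assocAlgType R) (I : Type) (r : seq I)
    (F : I -> A) (x : A) :
  (\sum_(i <- r) F i) ** x = \sum_(i <- r) F i ** x.
Proof.
by apply: (big_morph (fun y => y ** x) (fun y z => amulDl y z x) (amul0l x)).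
Qed.

Lemma amul_sumr (R : pzRingType) (A : assocAlgType R) (I : Type) (r : seq I)
    (F : I -> A) (x : A) :
  x ** (\sum_(i <- r) F i) = \sum_(i <- r) x ** F i.
Proof. by apply: (big_morph (amul x) (amulDr x) (amul0r x)). Qed.

Lemma amulNl (R : pzRingType) (A : assocAlgType R) (x y : A) :
  (- x) ** y = - (x ** y).
Proof. by rewrite -scaleN1r amulZl scaleN1r. Qed.

Lemma amulNr (R : pzRingType) (A : assocAlgType R) (x y : A) :
  x ** (- y) = - (x ** y).
Proof. by rewrite -scaleN1r amulZr scaleN1r. Qed.

Record alg_hom (R : pzRingType) (A B : assocAlgType R) := AlgHom {
  alg_fun :> A -> B;
  alg_homL : linear alg_fun;
  alg_homM : {morph alg_fun : x y / x ** y}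
}.

HB.instance Definition _ (R : pzRingType) (A B : assocAlgType R)
  (f : alg_hom A B) := GRing.isLinear.Build R A B _ (alg_fun f) (alg_homL f).

Lemma alg_hom_eq (R : pzRingType) (A B : assocAlgType R) (f g : alg_hom A B) :
  f =1 g -> f = g.
Proof.
case: f g => [f fL fM] [g gL gM] /= /funext fg; rewrite {}fg in fL fM *.
by rewrite (Prop_irrelevance fL gL) (Prop_irrelevance fM gM).
Qed.

Lemma id_linear (R : pzRingType) (A : assocAlgType R) : linear (@id A).
Proof. by []. Qed.

Definition alg_id (R : pzRingType) (A : assocAlgType R) : alg_hom A A :=
  AlgHom (@id_linear R A) (fun _ _ => erefl).

Lemma alg_comp_linear (R : pzRingType) (A B C : assocAlgType R)
  (g : alg_hom B C) (f : alg_hom A B) : linear (g \o f).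
Proof. by move=> a x y; rewrite /= !linearP. Qed.

Lemma alg_comp_mul (R : pzRingType) (A B C : assocAlgType R)
  (g : alg_hom B C) (f : alg_hom A B) : {morph g \o f : x y / x ** y}.
Proof. by move=> x y; rewrite /= !alg_homM. Qed.

Definition alg_comp (R : pzRingType) (A B C : assocAlgType R)
    (g : alg_hom B C) (f : alg_hom A B) : alg_hom A C :=
  AlgHom (alg_comp_linear g f) (alg_comp_mul g f).

HB.instance Definition _ (R : comPzRingType) :=
  isAssocAlgebra.Build R R^o (@mulrA R) (@mulrDl R) (@mulrDr R)
    (fun a x y => esym (mulrA a x y))
    (fun a x y => mulrCA x a y).

Definition ground (R : comPzRingType) : assocAlgType R := R^o.

(** A [psemigroup] is a semigroup with zero, the zero being left out: [None]
    stands for the product zero. *)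
Record psemigroup := PSemigroup {
  psg_sort :> choiceType;
  psg_mul : psg_sort -> psg_sort -> option psg_sort;
  psg_mulA : forall x y z,
    obind (fun u => psg_mul u z) (psg_mul x y) =
    obind (fun u => psg_mul x u) (psg_mul y z)
}.

Definition fin_supp (G : choiceType) (V : zmodType) : {pred G -> V} :=
  fun f => `[< finite_set [set x | f x != 0] >].

Lemma fin_supp_submod (R : pzRingType) (G : choiceType) (V : lmodType R) :
  submod_closed (@fin_supp G V).
Proof.
split.
  apply/asboolP; rewrite (_ : [set _ | _] = set0) //.
  by apply/seteqP; split => x //=; rewrite eqxx.
move=> a f g /asboolP ff /asboolP fg; apply/asboolP.
have := finite_setU [set x | f x != 0] [set x | g x != 0].
move=> H; have {}H : finite_set ([set x | f x != 0] `|` [set x | g x != 0]).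
  by rewrite H.
apply: sub_finite_set H => x /= nz; have [fx0|] := eqVneq (f x) 0; last by left.
right; apply: contra nz => /eqP gx0; apply/eqP.
by change (a *: f x + g x = 0); rewrite fx0 gx0 scaler0 addr0.
Qed.

HB.instance Definition _ (R : pzRingType) (G : choiceType) (V : lmodType R) :=
  GRing.isSubmodClosed.Build R (G -> V) (@fin_supp G V)
    (@fin_supp_submod R G V).

(** [convAlg G A]: the finitely supported functions [G -> A], with
    [(f ** g) x = \sum_(y z = x) f y ** g z]. *)
Record convAlg (R : pzRingType) (G : psemigroup) (A : assocAlgType R) :=
  ConvAlg { conv_val :> G -> A; conv_valP : conv_val \in @fin_supp G A }.

HB.instance Definition _ (R : pzRingType) (G : psemigroup) (A : assocAlgType R) :=
  [isSub for @conv_val R G A].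
HB.instance Definition _ (R : pzRingType) (G : psemigroup) (A : assocAlgType R) :=
  [Choice of convAlg G A by <:].
HB.instance Definition _ (R : pzRingType) (G : psemigroup) (A : assocAlgType R) :=
  [SubChoice_isSubLmodule of convAlg G A by <:].

Definition conv_fun (R : pzRingType) (G : psemigroup) (A : assocAlgType R)
    (f g : G -> A) (x : G) : A :=
  \sum_(p \in [set p : G * G | psg_mul p.1 p.2 = Some x]) f p.1 ** g p.2.

Lemma conv_funE (R : pzRingType) (G : psemigroup) (A : assocAlgType R)
    (s t : seq G) (f g : G -> A) (x : G) :
  uniq s -> uniq t ->
  (forall y, y \notin s -> f y = 0) -> (forall y, y \notin t -> g y = 0) ->
  conv_fun f g x =
  \sum_(y <- s) \sum_(z <- t)
    (if psg_mul y z == Some x then f y ** g z else 0).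
Proof.
move=> us ut fs gt; rewrite /conv_fun fsbig_mkcond.
have up : uniq (allpairs pair s t).
  by apply: allpairs_uniq => // -[? ?] [? ?].
rewrite (fsbigE _ _ up) //; last first.
  move=> [y z] _ nyz; rewrite /patch; case: ifP => // _ /=.
  have [ys|/fs ->] := boolP (y \in s); last by rewrite amul0l.
  have [zt|/gt ->] := boolP (z \in t); last by rewrite amul0r.
  by rewrite allpairs_f in nyz.
rewrite (eq_bigl xpredT); last by move=> p; rewrite in_setT.
rewrite big_allpairs; apply: eq_bigr => y _; apply: eq_bigr => z _.
rewrite /patch /=; case: eqP => [e|e]; case: ifPn => //.
  by rewrite notin_setE.
by rewrite in_setE.
Qed.

Lemma fin_supp_seq (G : choiceType) (V : zmodType) (f : G -> V) :
  f \in @fin_supp G V ->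
  exists2 s : seq G, uniq s & forall y, y \notin s -> f y = 0.
Proof.
move=> /asboolP ff; exists (fset_set [set x | f x != 0]) => // y.
by rewrite in_fset_set // notin_setE /= => /negP; rewrite negbK => /eqP.
Qed.

Lemma conv_supp (R : pzRingType) (G : psemigroup) (A : assocAlgType R)
    (s t : seq G) (f g : G -> A) (x : G) :
  (forall y, y \notin s -> f y = 0) -> (forall y, y \notin t -> g y = 0) ->
  x \notin pmap id [seq psg_mul y z | y <- s, z <- t] -> conv_fun f g x = 0.
Proof.
move=> fs gt nx; apply: fsbig1 => -[y z] /= yz.
have [ys|/fs ->] := boolP (y \in s); last by rewrite amul0l.
have [zt|/gt ->] := boolP (z \in t); last by rewrite amul0r.
case/negP: nx; rewrite mem_pmap map_id.
by rewrite -yz allpairs_f.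
Qed.

Lemma conv_fin_supp (R : pzRingType) (G : psemigroup) (A : assocAlgType R)
  (f g : convAlg G A) : conv_fun f g \in @fin_supp G A.
Proof.
have [s _ fs] := fin_supp_seq (conv_valP f).
have [t _ gt] := fin_supp_seq (conv_valP g).
apply/asboolP.
apply: (@sub_finite_set _ _
          [set` pmap id [seq psg_mul y z | y <- s, z <- t]]) => //.
by move=> x /=; apply: contraNT => /(conv_supp fs gt) ->.
Qed.

Definition conv_mul (R : pzRingType) (G : psemigroup) (A : assocAlgType R)
    (f g : convAlg G A) : convAlg G A := ConvAlg (conv_fin_supp f g).

Lemma conv_eq (R : pzRingType) (G : psemigroup) (A : assocAlgType R)
  (f g : convAlg G A) : (forall x, f x = g x) -> f = g.
Proof. by move=> fg; apply/val_inj/funext. Qed.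

Lemma sum_option (T : eqType) (V : zmodType) (r : seq T) (o : option T)
    (F : T -> V) :
  uniq r -> (forall v, o = Some v -> v \in r) ->
  \sum_(v <- r) (if o == Some v then F v else 0) = oapp F 0 o.
Proof.
case: o => [w|] ur wr /=; last by rewrite big1.
rewrite (bigD1_seq w) //=; last exact: wr.
rewrite eqxx [X in _ + X]big1 ?addr0 // => v nvw; case: eqP => // -[wv].
by rewrite wv eqxx in nvw.
Qed.

Lemma conv_mulA (R : pzRingType) (G : psemigroup) (A : assocAlgType R) :
  associative (@conv_mul R G A).
Proof.
move=> f g h; apply: conv_eq => x /=.
have [s us fs] := fin_supp_seq (conv_valP f).
have [t ut gt] := fin_supp_seq (conv_valP g).
have [u uu hu] := fin_supp_seq (conv_valP h).
pose st := undup (pmap id [seq psg_mul y z | y <- s, z <- t]).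
pose tu := undup (pmap id [seq psg_mul y z | y <- t, z <- u]).
have fgst y : y \notin st -> conv_fun f g y = 0.
  by rewrite mem_undup; apply: conv_supp.
have ghtu y : y \notin tu -> conv_fun g h y = 0.
  by rewrite mem_undup; apply: conv_supp.
rewrite (conv_funE _ us (undup_uniq _) fs ghtu).
rewrite (conv_funE _ (undup_uniq _) uu fgst hu).
transitivity (\sum_(y <- s) \sum_(z <- t) \sum_(w <- u)
  (if obind (fun v => psg_mul y v) (psg_mul z w) == Some x
   then f y ** (g z ** h w) else 0)).
  apply: eq_bigr => y _.
  transitivity (\sum_(v <- tu) \sum_(z <- t) \sum_(w <- u)
    (if psg_mul z w == Some v then
       if psg_mul y v == Some x then f y ** (g z ** h w) else 0 else 0)).
    apply: eq_bigr => v _; rewrite (conv_funE _ ut uu gt hu) amul_sumr.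
    case: ifP => _; last first.
      by rewrite big1 // => z _; rewrite big1 // => w _; case: ifP.
    apply: eq_bigr => z _; rewrite amul_sumr; apply: eq_bigr => w _.
    by case: ifP; rewrite ?amul0r.
  rewrite exchange_big; apply: eq_big_seq => z zt.
  rewrite exchange_big; apply: eq_big_seq => w wu.
  rewrite sum_option ?undup_uniq //; first by case: (psg_mul z w).
  move=> v e; rewrite mem_undup mem_pmap map_id -e; exact: allpairs_f.
transitivity (\sum_(w <- u) \sum_(y <- s) \sum_(z <- t)
  (if obind (fun v => psg_mul v w) (psg_mul y z) == Some x
   then (f y ** g z) ** h w else 0)).
  rewrite [RHS]exchange_big; apply: eq_bigr => y _.
  rewrite [RHS]exchange_big; apply: eq_bigr => z _; apply: eq_bigr => w _.
  by rewrite psg_mulA amulA.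
rewrite [RHS]exchange_big; apply: eq_bigr => w _.
transitivity (\sum_(v <- st) \sum_(y <- s) \sum_(z <- t)
    (if psg_mul y z == Some v then
       if psg_mul v w == Some x then (f y ** g z) ** h w else 0 else 0)).
  rewrite [RHS]exchange_big; apply: eq_big_seq => y ys.
  rewrite [RHS]exchange_big; apply: eq_big_seq => z zt.
  rewrite sum_option ?undup_uniq //; first by case: (psg_mul y z).
  move=> v e; rewrite mem_undup mem_pmap map_id -e; exact: allpairs_f.
apply: eq_bigr => v _; rewrite (conv_funE _ us ut fs gt) amul_suml.
case: ifP => _; last first.
  by rewrite big1 // => z _; rewrite big1 // => y _; case: ifP.
apply: eq_bigr => y _; rewrite amul_suml; apply: eq_bigr => z _.
by case: ifP; rewrite ?amul0l.
Qed.

Lemma conv_mulDl (R : pzRingType) (G : psemigroup) (A : assocAlgType R) :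
  left_distributive (@conv_mul R G A) +%R.
Proof.
move=> f g h; apply: conv_eq => x.
have [s _ fs] := fin_supp_seq (conv_valP f).
have [t _ gt] := fin_supp_seq (conv_valP g).
have [u uu hu] := fin_supp_seq (conv_valP h).
have {}fs y : y \notin undup (s ++ t) -> f y = 0.
  by rewrite mem_undup mem_cat negb_or => /andP[/fs].
have {}gt y : y \notin undup (s ++ t) -> g y = 0.
  by rewrite mem_undup mem_cat negb_or => /andP[_ /gt].
change (conv_fun (fun y => f y + g y) h x = conv_fun f h x + conv_fun g h x).
rewrite !(conv_funE x (undup_uniq (s ++ t)) uu _ hu) //; last first.
  by move=> y yst; rewrite fs // gt // addr0.
rewrite -big_split; apply: eq_bigr => y _ /=.
rewrite -big_split; apply: eq_bigr => z _ /=.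
by case: ifP; rewrite ?amulDl ?addr0.
Qed.

Lemma conv_mulDr (R : pzRingType) (G : psemigroup) (A : assocAlgType R) :
  right_distributive (@conv_mul R G A) +%R.
Proof.
move=> h f g; apply: conv_eq => x.
have [s _ fs] := fin_supp_seq (conv_valP f).
have [t _ gt] := fin_supp_seq (conv_valP g).
have [u uu hu] := fin_supp_seq (conv_valP h).
have {}fs y : y \notin undup (s ++ t) -> f y = 0.
  by rewrite mem_undup mem_cat negb_or => /andP[/fs].
have {}gt y : y \notin undup (s ++ t) -> g y = 0.
  by rewrite mem_undup mem_cat negb_or => /andP[_ /gt].
change (conv_fun h (fun y => f y + g y) x = conv_fun h f x + conv_fun h g x).
rewrite !(conv_funE x uu (undup_uniq (s ++ t)) hu) //; last first.
  by move=> y yst; rewrite fs // gt // addr0.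
rewrite -big_split; apply: eq_bigr => y _ /=.
rewrite -big_split; apply: eq_bigr => z _ /=.
by case: ifP; rewrite ?amulDr ?addr0.
Qed.

Lemma conv_mulZl (R : pzRingType) (G : psemigroup) (A : assocAlgType R)
  (a : R) (f g : convAlg G A) : conv_mul (a *: f) g = a *: conv_mul f g.
Proof.
apply: conv_eq => x.
have [s us fs] := fin_supp_seq (conv_valP f).
have [t ut gt] := fin_supp_seq (conv_valP g).
change (conv_fun (fun y => a *: f y) g x = a *: conv_fun f g x).
rewrite !(conv_funE x us ut _ gt) //; last by move=> y /fs ->; rewrite scaler0.
rewrite scaler_sumr; apply: eq_bigr => y _.
rewrite scaler_sumr; apply: eq_bigr => z _.
by case: ifP; rewrite ?amulZl ?scaler0.
Qed.

Lemma conv_mulZr (R : pzRingType) (G : psemigroup) (A : assocAlgType R)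
  (a : R) (f g : convAlg G A) : conv_mul f (a *: g) = a *: conv_mul f g.
Proof.
apply: conv_eq => x.
have [s us fs] := fin_supp_seq (conv_valP f).
have [t ut gt] := fin_supp_seq (conv_valP g).
change (conv_fun f (fun y => a *: g y) x = a *: conv_fun f g x).
rewrite !(conv_funE x us ut fs) //; last by move=> y /gt ->; rewrite scaler0.
rewrite scaler_sumr; apply: eq_bigr => y _.
rewrite scaler_sumr; apply: eq_bigr => z _.
by case: ifP; rewrite ?amulZr ?scaler0.
Qed.

HB.instance Definition _ (R : pzRingType) (G : psemigroup) (A : assocAlgType R) :=
  isAssocAlgebra.Build R (convAlg G A) (@conv_mulA R G A) (@conv_mulDl R G A)
    (@conv_mulDr R G A) (@conv_mulZl R G A) (@conv_mulZr R G A).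

Definition single_fun (G : choiceType) (V : zmodType) (x : G) (a : V) : G -> V :=
  fun y => if y == x then a else 0.

Lemma single_fin_supp (G : choiceType) (V : zmodType) (x : G) (a : V) :
  single_fun x a \in @fin_supp G V.
Proof.
apply/asboolP/(@sub_finite_set _ _ [set x]) => // y /=.
by rewrite /single_fun; case: (y =P x) => //; rewrite eqxx.
Qed.

Definition single (R : pzRingType) (G : psemigroup) (A : assocAlgType R)
    (x : G) (a : A) : convAlg G A := ConvAlg (single_fin_supp x a).

Lemma single_linear (R : pzRingType) (G : psemigroup) (A : assocAlgType R)
  (x : G) : linear (@single R G A x).
Proof.
move=> a u v; apply: conv_eq => y.
change (single_fun x (a *: u + v) y = a *: single_fun x u y + single_fun x v y).
by rewrite /single_fun; case: eqP; rewrite ?scaler0 ?addr0.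
Qed.

Lemma single_mul (R : pzRingType) (G : psemigroup) (A : assocAlgType R)
  (x y : G) (a b : A) :
  single x a ** single y b = oapp (fun z => single z (a ** b)) 0 (psg_mul x y).
Proof.
apply: conv_eq => z; change (conv_fun (single_fun x a) (single_fun y b) z =
  (oapp (fun z => single z (a ** b)) 0 (psg_mul x y) : convAlg G A) z).
have out (x' : G) (c : A) w : w \notin [:: x'] -> single_fun x' c w = 0.
  by rewrite inE /single_fun => /negPf ->.
rewrite (@conv_funE _ _ _ [:: x] [:: y]) //; try exact: out.
rewrite !big_seq1 /single_fun !eqxx.
by case: (psg_mul x y) => [w|] //=; rewrite /single_fun /= eq_sym.
Qed.

Lemma single_idem_mul (R : pzRingType) (G : psemigroup) (A : assocAlgType R)
  (e : G) (ee : psg_mul e e = Some e) :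
  {morph @single R G A e : a b / a ** b}.
Proof. by move=> a b; rewrite single_mul ee. Qed.

Lemma nat_psgA (x y z : nat) :
  obind (fun u => Some (u + z)%N) (Some (x + y)%N) =
  obind (fun u => Some (x + u)%N) (Some (y + z)%N).
Proof. by rewrite /= addnA. Qed.

Definition nat_psg : psemigroup := PSemigroup nat_psgA.

Definition polyAlg (R : pzRingType) (A : assocAlgType R) : assocAlgType R :=
  convAlg nat_psg A.

Lemma polyAlg_mulE (R : pzRingType) (A : assocAlgType R) (f g : polyAlg A)
  (n : nat) : (f ** g) n = \sum_(i < n.+1) f i ** g (n - i)%N.
Proof.
change (conv_fun f g n = \sum_(i < n.+1) f i ** g (n - i)%N).
pose r : seq (nat_psg * nat_psg) := [seq (i, n - i)%N | i <- iota 0 n.+1].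
have ur : uniq r by rewrite map_inj_uniq ?iota_uniq // => i j [].
have mr (p : nat_psg * nat_psg) : (p \in r) = (p.1 + p.2 == n)%N.
  apply/mapP/eqP => [[i + ->]|].
    by rewrite mem_iota add0n ltnS /= => /subnKC.
  move=> <-; exists p.1; last by rewrite addKn; case: p.
  by rewrite mem_iota add0n ltnS leq_addr.
rewrite /conv_fun (@fsbig_fwiden _ _ _ _ r) //.
- by rewrite big_map -(big_mkord xpredT (fun i => f i ** g (n - i)%N)).
- by move=> p /= [e]; rewrite mr e.
- by move=> p /= [+ np]; rewrite mr => /eqP e; case: np; rewrite /= e.
Qed.

Definition poly_incl (R : pzRingType) (A : assocAlgType R) :
    alg_hom A (polyAlg A) :=
  AlgHom (@single_linear R nat_psg A 0%N)
    (@single_idem_mul R nat_psg A 0%N erefl).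

Definition mx_op (S : choiceType) (p q : S * S) : option (S * S) :=
  if p.2 == q.1 then Some (p.1, q.2) else None.

Lemma mx_opA (S : choiceType) (p q r : S * S) :
  obind (fun u => mx_op u r) (mx_op p q) = obind (fun u => mx_op p u) (mx_op q r).
Proof.
by rewrite /mx_op; case: ifP; case: ifP => //= e1 e2; rewrite ?e1 ?e2.
Qed.

Definition mx_psg (S : choiceType) : psemigroup := PSemigroup (@mx_opA S).

Definition mxAlg (R : pzRingType) (S : choiceType) (A : assocAlgType R) :
  assocAlgType R := convAlg (mx_psg S) A.

Lemma mxAlg_mulE (R : pzRingType) (S : choiceType) (A : assocAlgType R)
  (f g : mxAlg S A) (s u : S) :
  (f ** g) (s, u) = \sum_(t \in [set: S]) f (s, t) ** g (t, u).
Proof.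
change (conv_fun f g (s, u) = \sum_(t \in [set: S]) f (s, t) ** g (t, u)).
rewrite /conv_fun (@reindex_fsbig _ _ _ S ((S * S) * (S * S))%type
  (fun t => ((s, t), (t, u))) [set: S]) //.
split=> [t _ /=|t t' _ _ [] //|[[a b] [c d]] /=].
  by rewrite /mx_op eqxx.
by rewrite /mx_op /=; case: eqP => // -> [-> ->]; exists c.
Qed.

Lemma mx_unit_idem (S : choiceType) (s : S) :
  @psg_mul (mx_psg S) (s, s) (s, s) = Some (s, s).
Proof. by rewrite /= /mx_op eqxx. Qed.

(** [a |-> e_{s,s} a] *)
Definition mx_incl (R : pzRingType) (S : choiceType) (A : assocAlgType R)
    (s : S) : alg_hom A (mxAlg S A) :=
  AlgHom (@single_linear R (mx_psg S) A (s, s))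
    (@single_idem_mul R (mx_psg S) A (s, s) (mx_unit_idem s)).

(** The pair [(x, s)] stands for the nonempty word [x :: s]; only nonempty words
    occur because the free algebra is taken in non-unital algebras. *)
Definition word_op (X : choiceType) (u v : X * seq X) : option (X * seq X) :=
  Some (u.1, u.2 ++ v.1 :: v.2).

Lemma word_opA (X : choiceType) (u v w : X * seq X) :
  obind (fun y => word_op y w) (word_op u v) =
  obind (fun y => word_op u y) (word_op v w).
Proof. by rewrite /word_op /= -catA. Qed.

Definition word_psg (X : choiceType) : psemigroup := PSemigroup (@word_opA X).

Definition freeAlg (R : comPzRingType) (X : choiceType) : assocAlgType R :=
  convAlg (word_psg X) (ground R).

Definition free_gen (R : comPzRingType) (X : choiceType) (x : X) : freeAlg R X :=
  @single R (word_psg X) (ground R) (x, [::]) 1.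

Definition two_sided_ideal (R : pzRingType) (A : assocAlgType R) (I : set A) :=
  [/\ I 0, (forall (a : R) (x y : A), I x -> I y -> I (a *: x + y)),
      (forall x y : A, I y -> I (x ** y)) & (forall x y : A, I x -> I (x ** y))].

Definition ideal_gen (R : pzRingType) (A : assocAlgType R) (D : set A) : set A :=
  [set x | forall I : set A, two_sided_ideal I -> D `<=` I -> I x].

Lemma ideal_gen_ideal (R : pzRingType) (A : assocAlgType R) (D : set A) :
  two_sided_ideal (ideal_gen D).
Proof.
split=> [I|a x y Dx Dy I|x y Dy I|x y Dx I] iI DI; case: (iI) => I0 IL Il Ir //.
- by apply: IL; [apply: Dx|apply: Dy].
- by apply: Il; apply: Dy.
- by apply: Ir; apply: Dx.
Qed.

Definition ideal_pred (R : pzRingType) (A : assocAlgType R) (D : set A) :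
  {pred A} := fun x => `[< ideal_gen D x >].

Lemma ideal_pred_zmod (R : pzRingType) (A : assocAlgType R) (D : set A) :
  zmod_closed (@ideal_pred R A D).
Proof.
have [I0 IL _ _] := ideal_gen_ideal D.
split=> [|x y /asboolP Ix /asboolP Iy]; apply/asboolP => //.
by rewrite addrC -scaleN1r; apply: IL.
Qed.

HB.instance Definition _ (R : pzRingType) (A : assocAlgType R) (D : set A) :=
  GRing.isZmodClosed.Build A (@ideal_pred R A D) (@ideal_pred_zmod R A D).

Definition quotAlg (R : pzRingType) (A : assocAlgType R) (D : set A) :=
  Quotient.quot (@ideal_pred R A D).

HB.instance Definition _ (R : pzRingType) (A : assocAlgType R) (D : set A) :=
  GRing.Zmodule.on (quotAlg D).

Definition quot_pi (R : pzRingType) (A : assocAlgType R) (D : set A) (x : A) :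
  quotAlg D := \pi_(Quotient.quot (@ideal_pred R A D)) x.

Definition quot_repr (R : pzRingType) (A : assocAlgType R) (D : set A)
  (x : quotAlg D) : A := @repr A (Quotient.quot (@ideal_pred R A D)) x.

Lemma quot_piK (R : pzRingType) (A : assocAlgType R) (D : set A) :
  cancel (@quot_repr R A D) (@quot_pi R A D).
Proof. exact: reprK. Qed.

Lemma quot_piP (R : pzRingType) (A : assocAlgType R) (D : set A) (x y : A) :
  quot_pi D x = quot_pi D y <-> ideal_gen D (x - y).
Proof.
split=> [e|h].
  by apply/asboolP; rewrite -[ `[< _ >] ]/(x - y \in ideal_pred D)
    Quotient.idealrBE; apply/eqP.
by apply/eqP; rewrite -Quotient.idealrBE; apply/asboolP.
Qed.

Lemma quot_piD (R : pzRingType) (A : assocAlgType R) (D : set A) :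
  {morph @quot_pi R A D : x y / x + y}.
Proof. by move=> x y; rewrite /quot_pi; exact: pi_addr. Qed.

Definition quot_scale (R : pzRingType) (A : assocAlgType R) (D : set A)
  (a : R) (x : quotAlg D) : quotAlg D := quot_pi D (a *: quot_repr x).

Definition quot_mul (R : pzRingType) (A : assocAlgType R) (D : set A)
  (x y : quotAlg D) : quotAlg D := quot_pi D (quot_repr x ** quot_repr y).

Lemma quot_piZ (R : pzRingType) (A : assocAlgType R) (D : set A) (a : R)
  (x : A) : quot_pi D (a *: x) = quot_scale a (quot_pi D x).
Proof.
have [I0 IL _ _] := ideal_gen_ideal D.
apply/quot_piP; rewrite -scalerBr -[_ *: _]addr0; apply: IL => //.
by apply/quot_piP; rewrite quot_piK.
Qed.

Lemma quot_piM (R : pzRingType) (A : assocAlgType R) (D : set A) (x y : A) :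
  quot_pi D (x ** y) = quot_mul (quot_pi D x) (quot_pi D y).
Proof.
have [I0 IL Il Ir] := ideal_gen_ideal D.
apply/quot_piP; set x' := quot_repr _; set y' := quot_repr _.
have -> : x ** y - x' ** y' = 1 *: ((x - x') ** y) + x' ** (y - y').
  by rewrite scale1r amulDl amulDr amulNl amulNr addrA subrK.
by apply: IL; [apply: Ir|apply: Il]; apply/quot_piP; rewrite quot_piK.
Qed.

Lemma quot_scaleA (R : pzRingType) (A : assocAlgType R) (D : set A)
  (a b : R) (x : quotAlg D) :
  quot_scale a (quot_scale b x) = quot_scale (a * b) x.
Proof. by rewrite -(quot_piK x) -!quot_piZ scalerA. Qed.

Lemma quot_scale1 (R : pzRingType) (A : assocAlgType R) (D : set A) :
  left_id 1 (@quot_scale R A D).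
Proof. by move=> x; rewrite -(quot_piK x) -!quot_piZ scale1r. Qed.

Lemma quot_scaleDr (R : pzRingType) (A : assocAlgType R) (D : set A) :
  right_distributive (@quot_scale R A D) +%R.
Proof.
move=> a x y; rewrite -(quot_piK x) -(quot_piK y).
by rewrite -quot_piD -!quot_piZ -quot_piD scalerDr.
Qed.

Lemma quot_scaleDl (R : pzRingType) (A : assocAlgType R) (D : set A)
  (x : quotAlg D) : {morph (@quot_scale R A D)^~ x : a b / a + b}.
Proof.
by move=> a b; rewrite -(quot_piK x) -!quot_piZ -quot_piD scalerDl.
Qed.

HB.instance Definition _ (R : pzRingType) (A : assocAlgType R) (D : set A) :=
  GRing.Zmodule_isLmodule.Build R (quotAlg D) (@quot_scaleA R A D)
    (@quot_scale1 R A D) (@quot_scaleDr R A D) (@quot_scaleDl R A D).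

Lemma quot_mulA (R : pzRingType) (A : assocAlgType R) (D : set A) :
  associative (@quot_mul R A D).
Proof.
move=> x y z; rewrite -(quot_piK x) -(quot_piK y) -(quot_piK z).
by rewrite -!quot_piM amulA.
Qed.

Lemma quot_mulDl (R : pzRingType) (A : assocAlgType R) (D : set A) :
  left_distributive (@quot_mul R A D) +%R.
Proof.
move=> x y z; rewrite -(quot_piK x) -(quot_piK y) -(quot_piK z).
by rewrite -quot_piD -!quot_piM -quot_piD amulDl.
Qed.

Lemma quot_mulDr (R : pzRingType) (A : assocAlgType R) (D : set A) :
  right_distributive (@quot_mul R A D) +%R.
Proof.
move=> x y z; rewrite -(quot_piK x) -(quot_piK y) -(quot_piK z).
by rewrite -quot_piD -!quot_piM -quot_piD amulDr.
Qed.

Lemma quot_mulZl (R : pzRingType) (A : assocAlgType R) (D : set A)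
  (a : R) (x y : quotAlg D) : quot_mul (a *: x) y = a *: quot_mul x y.
Proof.
change (quot_mul (quot_scale a x) y = quot_scale a (quot_mul x y)).
rewrite -(quot_piK x) -(quot_piK y) -quot_piZ -!quot_piM.
by rewrite amulZl quot_piZ.
Qed.

Lemma quot_mulZr (R : pzRingType) (A : assocAlgType R) (D : set A)
  (a : R) (x y : quotAlg D) : quot_mul x (a *: y) = a *: quot_mul x y.
Proof.
change (quot_mul x (quot_scale a y) = quot_scale a (quot_mul x y)).
rewrite -(quot_piK x) -(quot_piK y) -quot_piZ -!quot_piM.
by rewrite amulZr quot_piZ.
Qed.

HB.instance Definition _ (R : pzRingType) (A : assocAlgType R) (D : set A) :=
  isAssocAlgebra.Build R (quotAlg D) (@quot_mulA R A D) (@quot_mulDl R A D)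
    (@quot_mulDr R A D) (@quot_mulZl R A D) (@quot_mulZr R A D).

Record digraph := Digraph {
  vertex : choiceType;
  edge : choiceType;
  src : edge -> vertex;
  rng : edge -> vertex
}.

Definition out_edges (E : digraph) (v : vertex E) : set (edge E) :=
  [set e | src e = v].

Definition regular (E : digraph) (v : vertex E) : Prop :=
  finite_set (out_edges v) /\ out_edges v !=set0.

Definition disjoint_union (E F : digraph) : digraph := {|
  vertex := (vertex E + vertex F)%type;
  edge := (edge E + edge F)%type;
  src := fun e => match e with inl e => inl (src e) | inr f => inr (src f) end;
  rng := fun e => match e with inl e => inl (rng e) | inr f => inr (rng f) end
|}.

(** The generators of [L(E)]: vertices, edges [e], ghost edges [e^*] *)
Definition leavitt_gen (E : digraph) : choiceType :=
  (vertex E + (edge E + edge E))%type.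

Definition gvertex (R : comPzRingType) (E : digraph) (v : vertex E) :=
  @free_gen R (leavitt_gen E) (inl v).
Definition gedge (R : comPzRingType) (E : digraph) (e : edge E) :=
  @free_gen R (leavitt_gen E) (inr (inl e)).
Definition gghost (R : comPzRingType) (E : digraph) (e : edge E) :=
  @free_gen R (leavitt_gen E) (inr (inr e)).

Inductive leavitt_rel (R : comPzRingType) (E : digraph) :
    freeAlg R (leavitt_gen E) -> freeAlg R (leavitt_gen E) -> Prop :=
| lrel_vv (v w : vertex E) : leavitt_rel (gvertex R v ** gvertex R w)
    (if v == w then gvertex R v else 0)
| lrel_se (e : edge E) :
    leavitt_rel (gvertex R (src e) ** gedge R e) (gedge R e)
| lrel_er (e : edge E) :
    leavitt_rel (gedge R e ** gvertex R (rng e)) (gedge R e)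
| lrel_rg (e : edge E) :
    leavitt_rel (gvertex R (rng e) ** gghost R e) (gghost R e)
| lrel_gs (e : edge E) :
    leavitt_rel (gghost R e ** gvertex R (src e)) (gghost R e)
| lrel_ck1 (e f : edge E) : leavitt_rel (gghost R e ** gedge R f)
    (if e == f then gvertex R (rng e) else 0)
| lrel_ck2 (v : vertex E) : regular v -> leavitt_rel (gvertex R v)
    (\sum_(e \in out_edges v) gedge R e ** gghost R e).

Definition leavitt (R : comPzRingType) (E : digraph) : assocAlgType R :=
  quotAlg [set d | exists2 p, leavitt_rel p.1 p.2 & d = p.1 - p.2
                   :> freeAlg R (leavitt_gen E)].

Record category := Category {
  obj :> Type;
  mor : obj -> obj -> Type;
  idm : forall a, mor a a;
  compm : forall a b c, mor b c -> mor a b -> mor a c;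
  compm_idl : forall a b (f : mor a b), compm (idm b) f = f;
  compm_idr : forall a b (f : mor a b), compm f (idm a) = f;
  compmA : forall a b c d (h : mor c d) (g : mor b c) (f : mor a b),
    compm h (compm g f) = compm (compm h g) f
}.
Arguments mor {_} _ _.
Arguments idm {_} _.
Arguments compm {_ _ _ _} _ _.

Declare Scope cat_scope.
Delimit Scope cat_scope with cat.
Local Open Scope cat_scope.
Notation "g ∘ f" := (compm g f) (at level 40, left associativity) : cat_scope.

Definition is_iso (C : category) (a b : C) (f : mor a b) : Prop :=
  exists g : mor b a, g ∘ f = idm a /\ f ∘ g = idm b.

Definition mor_of_eq (C : category) (a b : C) (e : a = b) : mor a b :=
  match e in _ = b' return mor a b' with erefl => idm a end.

Record functor (C D : category) := Functor {
  fobj :> C -> D;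
  fmap : forall a b : C, mor a b -> mor (fobj a) (fobj b);
  fmap_id : forall a : C, fmap (idm a) = idm (fobj a);
  fmap_comp : forall (a b c : C) (g : mor b c) (f : mor a b),
    fmap (g ∘ f) = fmap g ∘ fmap f
}.
Arguments fmap {_ _} _ {_ _} _.

Definition functor_id (C : category) : functor C C :=
  @Functor C C id (fun _ _ f => f) (fun _ => erefl) (fun _ _ _ _ _ => erefl).

Lemma functor_comp_id (B C D : category) (G : functor C D) (F : functor B C)
  (a : B) : fmap G (fmap F (idm a)) = idm (G (F a)).
Proof. by rewrite !fmap_id. Qed.

Lemma functor_comp_comp (B C D : category) (G : functor C D) (F : functor B C)
  (a b c : B) (g : mor b c) (f : mor a b) :
  fmap G (fmap F (g ∘ f)) = fmap G (fmap F g) ∘ fmap G (fmap F f).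
Proof. by rewrite !fmap_comp. Qed.

Definition functor_comp (B C D : category) (G : functor C D) (F : functor B C) :
    functor B D :=
  @Functor B D (fun a => G (F a)) (fun a b f => fmap G (fmap F f))
    (functor_comp_id G F) (functor_comp_comp G F).

Fixpoint functor_iter (C : category) (F : functor C C) (n : nat) : functor C C :=
  if n is n'.+1 then functor_comp F (functor_iter F n') else functor_id C.

Record nat_iso (C D : category) (F G : functor C D) := NatIso {
  ni_map :> forall a : C, mor (F a) (G a);
  ni_natural : forall (a b : C) (f : mor a b),
    ni_map b ∘ fmap F f = fmap G f ∘ ni_map a;
  ni_iso : forall a : C, is_iso (ni_map a)
}.

Lemma alg_comp_idl (R : pzRingType) (A B : assocAlgType R) (f : alg_hom A B) :
  alg_comp (alg_id B) f = f.
Proof. exact: alg_hom_eq. Qed.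

Lemma alg_comp_idr (R : pzRingType) (A B : assocAlgType R) (f : alg_hom A B) :
  alg_comp f (alg_id A) = f.
Proof. exact: alg_hom_eq. Qed.

Lemma alg_compA (R : pzRingType) (A B C D : assocAlgType R)
  (h : alg_hom C D) (g : alg_hom B C) (f : alg_hom A B) :
  alg_comp h (alg_comp g f) = alg_comp (alg_comp h g) f.
Proof. exact: alg_hom_eq. Qed.

Definition Alg (R : comPzRingType) : category :=
  Category (@alg_comp_idl R) (@alg_comp_idr R) (@alg_compA R).

Record preadditive := Preadditive {
  pobj : Type;
  phom : pobj -> pobj -> zmodType;
  pidm : forall a, phom a a;
  pcomp : forall a b c, phom b c -> phom a b -> phom a c;
  pcomp_idl : forall a b (f : phom a b), pcomp (pidm b) f = f;
  pcomp_idr : forall a b (f : phom a b), pcomp f (pidm a) = f;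
  pcompA : forall a b c d (h : phom c d) (g : phom b c) (f : phom a b),
    pcomp h (pcomp g f) = pcomp (pcomp h g) f;
  pcompDl : forall a b c (g g' : phom b c) (f : phom a b),
    pcomp (g + g') f = pcomp g f + pcomp g' f;
  pcompDr : forall a b c (g : phom b c) (f f' : phom a b),
    pcomp g (f + f') = pcomp g f + pcomp g f'
}.

Coercion category_of (T : preadditive) : category :=
  Category (@pcomp_idl T) (@pcomp_idr T) (@pcompA T).

HB.instance Definition _ (T : preadditive) (a b : category_of T) :=
  GRing.Zmodule.copy (@mor (category_of T) a b) (@phom T a b).

Definition additive_functor (T T' : preadditive) (F : functor T T') : Prop :=
  forall a b : T, {morph @fmap T T' F a b : f g / f + g}.

Definition is_zero (T : preadditive) (z : T) : Prop := idm z = 0.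

Definition is_biproduct (T : preadditive) (a b p : T) : Prop :=
  exists (i1 : mor a p) (i2 : mor b p) (p1 : mor p a) (p2 : mor p b),
    [/\ p1 ∘ i1 = idm a, p2 ∘ i2 = idm b, p1 ∘ i2 = 0, p2 ∘ i1 = 0
      & i1 ∘ p1 + i2 ∘ p2 = idm p].

(** Triangulated categories in terms of the inverse suspension [Omega], with
    triangles written [Omega c -d-> a -f-> b -g-> c]. [Sigma] is a chosen
    quasi-inverse of [Omega]. *)
Record triangulated := Triangulated {
  tri_cat :> preadditive;
  tri_zero : exists z : tri_cat, is_zero z;
  tri_biproduct : forall a b : tri_cat, exists p, is_biproduct a b p;
  Omega : functor tri_cat tri_cat;
  Sigma : functor tri_cat tri_cat;
  Omega_additive : additive_functor Omega;
  Omega_Sigma : nat_iso (functor_comp Omega Sigma) (functor_id tri_cat);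
  Sigma_Omega : nat_iso (functor_comp Sigma Omega) (functor_id tri_cat);
  dist : forall a b c : tri_cat,
    mor (Omega c) a -> mor a b -> mor b c -> Prop;
  dist_iso : forall (a b c a' b' c' : tri_cat)
    (d : mor (Omega c) a) (f : mor a b) (g : mor b c)
    (d' : mor (Omega c') a') (f' : mor a' b') (g' : mor b' c')
    (u : mor a a') (v : mor b b') (w : mor c c'),
    is_iso u -> is_iso v -> is_iso w ->
    u ∘ d = d' ∘ fmap Omega w -> v ∘ f = f' ∘ u -> w ∘ g = g' ∘ v ->
    dist d f g -> dist d' f' g';
  dist_id : forall a z : tri_cat, is_zero z ->
    dist (0 : mor (Omega z) a) (idm a) (0 : mor a z);
  dist_fiber : forall (b c : tri_cat) (g : mor b c),
    exists (a : tri_cat) (d : mor (Omega c) a) (f : mor a b), dist d f g;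
  dist_rotate : forall (a b c : tri_cat)
    (d : mor (Omega c) a) (f : mor a b) (g : mor b c),
    dist d f g <-> dist (- fmap Omega g) d f;
  dist_morphism : forall (a b c a' b' c' : tri_cat)
    (d : mor (Omega c) a) (f : mor a b) (g : mor b c)
    (d' : mor (Omega c') a') (f' : mor a' b') (g' : mor b' c')
    (v : mor b b') (w : mor c c'),
    dist d f g -> dist d' f' g' -> w ∘ g = g' ∘ v ->
    exists u : mor a a', v ∘ f = f' ∘ u /\ u ∘ d = d' ∘ fmap Omega w;
  dist_octahedron : forall (b c e x y z : tri_cat) (g : mor b c) (h : mor c e)
    (d1 : mor (Omega c) x) (f1 : mor x b)
    (d2 : mor (Omega e) y) (f2 : mor y c)
    (d3 : mor (Omega e) z) (f3 : mor z b),
    dist d1 f1 g -> dist d2 f2 h -> dist d3 f3 (h ∘ g) ->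
    exists (u : mor x z) (v : mor z y),
      [/\ f3 ∘ u = f1, u ∘ d1 = d3 ∘ fmap Omega h,
          f2 ∘ v = g ∘ f3, v ∘ d3 = d2 & dist (d1 ∘ fmap Omega f2) u v]
}.
Arguments Omega {_}.
Arguments Sigma {_}.
Arguments dist {_ _ _ _} _ _ _.

Definition Omegaz (T : triangulated) (n : int) : functor T T :=
  match n with
  | Posz k => functor_iter Omega k
  | Negz k => functor_iter Sigma k.+1
  end.

Record tri_functor (T T' : triangulated) := TriFunctor {
  tf_functor :> functor T T';
  tf_additive : additive_functor tf_functor;
  tf_Omega : nat_iso (functor_comp Omega tf_functor)
                     (functor_comp tf_functor Omega);
  tf_dist : forall (a b c : T)
    (d : mor (Omega c) a) (f : mor a b) (g : mor b c), dist d f g ->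
    dist (fmap tf_functor d ∘ tf_Omega c) (fmap tf_functor f) (fmap tf_functor g)
}.

Record extension (R : comPzRingType) (A B C : Alg R) := Extension {
  ext_inj : alg_hom A B;
  ext_proj : alg_hom B C;
  ext_injective : injective ext_inj;
  ext_exact : forall y, ext_proj y = 0 <-> exists x, ext_inj x = y;
  ext_split : exists2 s : C -> B, linear s & cancel s ext_proj
}.

Record excision (R : comPzRingType) (T : triangulated) (X : functor (Alg R) T) :=
  Excision {
  bd : forall A B C : Alg R, extension A B C -> mor (Omega (X C)) (X A);
  bd_natural : forall (A B C A' B' C' : Alg R)
    (e : extension A B C) (e' : extension A' B' C')
    (u : alg_hom A A') (v : alg_hom B B') (w : alg_hom C C'),
    (forall x, v (ext_inj e x) = ext_inj e' (u x)) ->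
    (forall y, w (ext_proj e y) = ext_proj e' (v y)) ->
    fmap X u ∘ bd e = bd e' ∘ fmap Omega (fmap X w);
  bd_dist : forall (A B C : Alg R) (e : extension A B C),
    dist (bd e) (fmap X (ext_inj e)) (fmap X (ext_proj e))
}.

Definition homotopy_invariant (R : comPzRingType) (T : triangulated)
    (X : functor (Alg R) T) : Prop :=
  forall A : Alg R, is_iso (fmap X (poly_incl A)).

Definition matrix_stable (R : comPzRingType) (S : choiceType) (T : triangulated)
    (X : functor (Alg R) T) : Prop :=
  forall (A : Alg R) (s : S), is_iso (fmap X (mx_incl A s)).

Definition graph_index (G : digraph) : choiceType :=
  (vertex G + edge G + nat)%type.

(** [H] is a triangulated functor with [H X = Y] as functors, carrying the maps
    [bd] of [X] to those of [Y]; the object equalities [e] enter through the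
    morphisms [mor_of_eq]. *)
Definition theory_morphism (R : comPzRingType) (T T' : triangulated)
    (X : functor (Alg R) T) (dX : excision X)
    (Y : functor (Alg R) T') (dY : excision Y) (H : tri_functor T T') : Prop :=
  exists e : forall A : Alg R, H (X A) = Y A,
    (forall (A B : Alg R) (f : alg_hom A B),
       mor_of_eq (e B) ∘ fmap H (fmap X f) = fmap Y f ∘ mor_of_eq (e A)) /\
    (forall (A B C : Alg R) (x : extension A B C),
       mor_of_eq (e A) ∘ (fmap H (bd dX x) ∘ tf_Omega H (X C)) =
       bd dY x ∘ fmap Omega (mor_of_eq (e C))).

Definition graph_stable_theory (R : comPzRingType) (G : digraph)
    (T : triangulated) (X : functor (Alg R) T) : Prop :=
  homotopy_invariant X /\ matrix_stable (graph_index G) X.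

Definition universal_theory (R : comPzRingType) (G : digraph)
    (T : triangulated) (X : functor (Alg R) T) (dX : excision X) : Prop :=
  graph_stable_theory G X /\
  forall (T' : triangulated) (Y : functor (Alg R) T') (dY : excision Y),
    graph_stable_theory G Y ->
    exists! H : tri_functor T T', theory_morphism dX dY H.

Definition kkz (R : comPzRingType) (T : triangulated) (j : functor (Alg R) T)
    (n : int) (A B : Alg R) : zmodType :=
  phom (j A) (Omegaz T n (j B)).

Definition kk (R : comPzRingType) (T : triangulated) (j : functor (Alg R) T)
    (A B : Alg R) : zmodType := kkz j 0 A B.

Definition kk_comp (R : comPzRingType) (T : triangulated)
    (j : functor (Alg R) T) (A B C : Alg R) (theta : kk j B C) (n : int)
    (x : kkz j n A B) : kkz j n A C :=
  fmap (Omegaz T n) (theta : mor (j B) (j C)) ∘ (x : mor (j A) _).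

Record graded_functor (R : comPzRingType) := GradedFunctor {
  gf_obj :> int -> Alg R -> zmodType;
  gf_map : forall (n : int) (A B : Alg R),
    alg_hom A B -> {additive gf_obj n A -> gf_obj n B};
  gf_map_id : forall (n : int) (A : Alg R), gf_map n (alg_id A) =1 id;
  gf_map_comp : forall (n : int) (A B C : Alg R)
    (g : alg_hom B C) (f : alg_hom A B),
    gf_map n (alg_comp g f) =1 gf_map n g \o gf_map n f
}.

(** A natural isomorphism [kk_n(ground, B) -> KH_n(B)]. Homotopy K-theory enters
    the theory only through such an identification, so [KH] is left as an
    arbitrary graded functor carrying one; it is then determined up to natural
    isomorphism. *)
Record kk_identification (R : comPzRingType) (T : triangulated)
    (j : functor (Alg R) T) (KH : graded_functor R) := KkIdentification {
  kh_iso :> forall (n : int) (B : Alg R), {additive kkz j n (ground R) B -> KH n B};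
  kh_iso_inv : forall (n : int) (B : Alg R), KH n B -> kkz j n (ground R) B;
  kh_isoK : forall (n : int) (B : Alg R), cancel (@kh_iso n B) (@kh_iso_inv n B);
  kh_iso_invK : forall (n : int) (B : Alg R), cancel (@kh_iso_inv n B) (@kh_iso n B);
  kh_iso_natural : forall (n : int) (B C : Alg R) (f : alg_hom B C)
    (x : kkz j n (ground R) B),
    kh_iso n C (kk_comp (fmap j f : kk j B C) x) = gf_map KH n f (kh_iso n B x)
}.

Definition KH_act (R : comPzRingType) (T : triangulated) (j : functor (Alg R) T)
    (KH : graded_functor R) (iota : kk_identification j KH) (A B : Alg R)
    (theta : kk j A B) (n : int) (x : KH n A) : KH n B :=
  iota n B (kk_comp theta (kh_iso_inv iota x)).
Arguments KH_act {R T j KH} iota {A B} theta n x.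

Lemma KH_act_zmod_morphism (R : comPzRingType) (T : triangulated)
    (j : functor (Alg R) T) (KH : graded_functor R)
    (iota : kk_identification j KH) (A B : Alg R) (theta : kk j A B) (n : int) :
  zmod_morphism (KH_act iota theta n).
Proof.
have inv_add : zmod_morphism (@kh_iso_inv _ _ _ _ iota n A).
  by apply: can2_zmod_morphism; [exact: kh_isoK|exact: kh_iso_invK].
have comp_add : zmod_morphism (@kk_comp _ _ j (ground R) _ _ theta n).
  move=> x y; apply/eqP; rewrite eq_sym subr_eq /kk_comp /=.
  by rewrite -pcompDr subrK.
by move=> x y; rewrite /KH_act inv_add comp_add raddfB.
Qed.

HB.instance Definition _ (R : comPzRingType) (T : triangulated)
    (j : functor (Alg R) T) (KH : graded_functor R)
    (iota : kk_identification j KH) (A B : Alg R) (theta : kk j A B) (n : int) :=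
  GRing.isZmodMorphism.Build (KH n A) (KH n B) (KH_act iota theta n)
    (KH_act_zmod_morphism iota theta (n := n)).

(* Main.v *)
(** Being an isomorphism after applying [kk(Y, -)] and [kk(Y, Omega -)] is, for
    the morphism [theta], a property of the object [Y] which holds for [ground]
    by hypothesis and passes to finite direct sums and retracts. By the five
    lemma, a triangle [A -> B -> C] with [A] and [B] having the property gives
    the bijectivity of [kk(C, theta)]. The triangle of the extension
    [ker -> cohn -> leavitt] of the Cohn path algebra thus applies to [L(E)] and
    [L(F)], and bijectivity of [kk(L(F), theta)] and [kk(L(E), theta)] yields an
    inverse of [theta].

    The kernel is a finite direct sum, over the regular vertices, of matrix
    algebras indexed by paths; each is a retract of [ground] in [kk] by
    stability, since there are at most as many paths as elements of the index
    set (Hessenberg's theorem). The Cohn algebra is a retract of a finite direct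
    sum of matrix algebras over [ground]: two homomorphisms from it to a
    Toeplitz-like algebra, differing by an ideal of matrices, define a morphism
    to this sum, and a rotation turns its composite with the map to matrices over
    the Cohn algebra into the corner embedding. *)
Require Import Defs.
From HB Require Import structures.
From mathcomp Require Import all_boot all_order all_algebra.
From mathcomp Require Import finmap.
From mathcomp Require Import boolp classical_sets cardinality fsbigop.

Set Implicit Arguments.
Unset Strict Implicit.
Unset Printing Implicit Defensive.

Import GRing.Theory.

Local Open Scope classical_set_scope.
Local Open Scope ring_scope.
Local Open Scope alg_scope.
Local Open Scope cat_scope.

Local Arguments compm {_ _ _ _} _ _ : simpl never.
Local Arguments idm {_} _ : simpl never.
Local Arguments mor {_} _ _ : simpl never.

(** * Triangulated categories *)

(** Stability is available for the one index set attached to [E] and [F], while edge sets may be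
    infinite. So every matrix algebra that occurs has to be moved into matrices over that set, and a
    spare index is kept to make room for comparing two copies of a block. The Cohn algebra is
    defined on the basis of the monomials [a b^*]. This gives the kernel inclusion an explicit
    linear retraction, and with it the linear splitting that an extension must have. Of the
    equivalence between the Cohn algebra and a sum of copies of the ground ring only one composite
    is computed: a retract suffices for testing bijectivity. The two homomorphisms behind it are the
    representations on all words and on nonempty words. All homotopies have degree one in [t] on
    elements or on generators. In place of a rotation matrix, a column and a row with product 1 are
    moved in turn: the column from (1,0) to (1,1), the row from (1,0) to (0,1), the column on to
    (0,1). *)

Section Preadditive.
Variable T : preadditive.
Implicit Types a b c d : T.

Lemma compDl a b c (g g' : mor b c) (f : mor a b) :
  (g + g') ∘ f = g ∘ f + g' ∘ f.
Proof. exact: pcompDl. Qed.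

Lemma compDr a b c (g : mor b c) (f f' : mor a b) :
  g ∘ (f + f') = g ∘ f + g ∘ f'.
Proof. exact: pcompDr. Qed.

Lemma comp0l a b c (f : mor a b) : (0 : mor b c) ∘ f = 0.
Proof. by apply: (addrI (0 ∘ f)); rewrite -compDl !addr0. Qed.

Lemma comp0r a b c (g : mor b c) : g ∘ (0 : mor a b) = 0.
Proof. by apply: (addrI (g ∘ 0)); rewrite -compDr !addr0. Qed.

Lemma compNl a b c (g : mor b c) (f : mor a b) : (- g) ∘ f = - (g ∘ f).
Proof. by apply: (addrI (g ∘ f)); rewrite -compDl !subrr comp0l. Qed.

Lemma compNr a b c (g : mor b c) (f : mor a b) : g ∘ (- f) = - (g ∘ f).
Proof. by apply: (addrI (g ∘ f)); rewrite -compDr !subrr comp0r. Qed.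

Lemma compBl a b c (g g' : mor b c) (f : mor a b) :
  (g - g') ∘ f = g ∘ f - g' ∘ f.
Proof. by rewrite compDl compNl. Qed.

Lemma compBr a b c (g : mor b c) (f f' : mor a b) :
  g ∘ (f - f') = g ∘ f - g ∘ f'.
Proof. by rewrite compDr compNr. Qed.

Lemma comp_sumr (I : Type) (r : seq I) a b c (g : mor b c) (f : I -> mor a b) :
  g ∘ (\sum_(i <- r) f i) = \sum_(i <- r) g ∘ f i.
Proof. exact: (big_morph (fun h => g ∘ h) (fun x y => compDr g x y) (comp0r _ g)). Qed.

End Preadditive.

Section Isomorphisms.
Variable C : category.
Implicit Types a b c : C.

Lemma is_iso_id a : is_iso (idm a).
Proof. by exists (idm a); rewrite compm_idl. Qed.

Lemma fmap_is_iso (D : category) (H : functor C D) a b (f : mor a b) :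
  is_iso f -> is_iso (fmap H f).
Proof.
by move=> [g [gf fg]]; exists (fmap H g); rewrite -!fmap_comp gf fg !fmap_id.
Qed.

Lemma is_iso_monic a b c (f : mor b c) (g h : mor a b) :
  is_iso f -> f ∘ g = f ∘ h -> g = h.
Proof.
by move=> [f' [f'f _]] e; rewrite -[g]compm_idl -[h]compm_idl -f'f -!compmA e.
Qed.

Lemma is_iso_epic a b c (f : mor a b) (g h : mor b c) :
  is_iso f -> g ∘ f = h ∘ f -> g = h.
Proof.
by move=> [f' [_ ff']] e; rewrite -[g]compm_idr -[h]compm_idr -ff' !compmA e.
Qed.

Lemma is_iso_bijective a b c (f : mor b c) :
  is_iso f -> bijective (fun g : mor a b => f ∘ g).
Proof.
by move=> [f' [f'f ff']]; exists (compm f') => g /=; rewrite compmA ?f'f ?ff' compm_idl.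
Qed.

End Isomorphisms.

Lemma is_isoN (T : preadditive) (a b : T) (f : mor a b) :
  is_iso f -> is_iso (- f).
Proof. by move=> [g [gf fg]]; exists (- g); rewrite !compNl !compNr !opprK. Qed.

Section Triangulated.
Variable T : triangulated.
Implicit Types a b c x : T.

Lemma Sigma_Omega_natural : exists e : forall a, mor (Sigma (Omega a)) a,
  (forall a b (f : mor a b), e b ∘ fmap Sigma (fmap Omega f) = f ∘ e a) /\
  forall a, is_iso (e a).
Proof.
exists (Sigma_Omega T); split; last exact: (ni_iso (Sigma_Omega T)).
exact: (ni_natural (Sigma_Omega T)).
Qed.

Lemma Omega_Sigma_natural : exists e : forall a, mor (Omega (Sigma a)) a,
  (forall a b (f : mor a b), e b ∘ fmap Omega (fmap Sigma f) = f ∘ e a) /\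
  forall a, is_iso (e a).
Proof.
exists (Omega_Sigma T); split; last exact: (ni_iso (Omega_Sigma T)).
exact: (ni_natural (Omega_Sigma T)).
Qed.

Lemma Omega_faithful a b (f g : mor a b) :
  fmap Omega f = fmap Omega g -> f = g.
Proof.
have [e [en ei]] := Sigma_Omega_natural.
by move=> fg; apply: (is_iso_epic (ei a)); rewrite -!en fg.
Qed.

Lemma Sigma_faithful a b (f g : mor a b) :
  fmap Sigma f = fmap Sigma g -> f = g.
Proof.
have [e [en ei]] := Omega_Sigma_natural.
by move=> fg; apply: (is_iso_epic (ei a)); rewrite -!en fg.
Qed.

(** The preimage is [fmap Sigma h] conjugated by the isomorphisms [Sigma (Omega a) -> a]. The two
    natural isomorphisms come without triangle identities, so [Sigma_faithful] is what shows that
    [Omega] sends it back to [h]. *)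
Lemma Omega_full a b (h : mor (Omega a) (Omega b)) :
  exists f : mor a b, fmap Omega f = h.
Proof.
have [e [en ei]] := Sigma_Omega_natural; have [u [ua au]] := ei a.
exists (e b ∘ fmap Sigma h ∘ u).
apply: Sigma_faithful; apply: (is_iso_monic (ei b)).
by rewrite en -compmA ua compm_idr.
Qed.

Lemma Omega0 a b : fmap Omega (0 : mor a b) = 0.
Proof.
by apply: (addrI (fmap Omega (0 : mor a b))); rewrite -Omega_additive !addr0.
Qed.

Section Triangle.
Variables (a b c : T) (d : mor (Omega c) a) (f : mor a b) (g : mor b c).
Hypothesis dfg : dist d f g.

(** The lift is the fill-in of a morphism from the identity triangle of [x], with the other
    components [u] and [0]. *)
Lemma dist_lift x (u : mor x b) : g ∘ u = 0 -> exists v : mor x a, u = f ∘ v.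
Proof.
move=> gu; have [z z0] := tri_zero T.
have [|v [+ _]] := dist_morphism (v := u) (w := 0) (dist_id x z0) dfg.
  by rewrite comp0l gu.
by rewrite compm_idr; exists v.
Qed.

(** Two rotations lead to the identity triangle of [Omega b], up to a sign that the isomorphism
    [- idm] absorbs. *)
Lemma dist_id_right z : is_zero z ->
  dist (0 : mor (Omega b) z) (0 : mor z b) (idm b).
Proof.
move=> z0; apply/dist_rotate/dist_rotate; rewrite Omega0 oppr0 fmap_id.
apply: (dist_iso (u := - idm (Omega b)) (v := idm _) (w := idm _)) (dist_id (Omega b) z0).
- exact/is_isoN/is_iso_id.
- exact: is_iso_id.
- exact: is_iso_id.
- by rewrite comp0r comp0l.
- by rewrite compNl compNr opprK.
- by rewrite comp0r comp0l.
Qed.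

End Triangle.

Lemma dist_comp0 a b c (d : mor (Omega c) a) (f : mor a b) (g : mor b c) :
  dist d f g -> g ∘ f = 0.
Proof.
move=> dfg; have [z z0] := tri_zero T.
have [|u [+ _]] := dist_morphism (v := g) (w := idm c) dfg (dist_id_right c z0).
  by [].
by rewrite comp0l.
Qed.

(* Complete [u] to a morphism to the triangle of the identity of [x]; the third
   component only exists after applying [Omega], which is full and faithful. *)
Lemma dist_extend a b c (d : mor (Omega c) a) (f : mor a b) (g : mor b c) x
    (u : mor b x) :
  dist d f g -> u ∘ f = 0 -> exists v : mor c x, u = v ∘ g.
Proof.
move=> dfg uf; have [z z0] := tri_zero T.
have /dist_rotate dfg' := dfg.
have /dist_rotate did := dist_id_right x z0.
have [|h [_ hg]] := dist_morphism (v := 0) (w := u) dfg' did.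
  by rewrite comp0r uf.
have [v vh] := Omega_full h; exists v; apply: Omega_faithful.
move: hg; rewrite fmap_id -vh compNr compNl compm_idl -fmap_comp.
by move/oppr_inj.
Qed.

End Triangulated.

(** * Five lemma for composition with a fixed morphism *)

Section FiveLemma.
Variables (T : triangulated) (y y' : T) (theta : mor y y').

Definition local_iso (x : T) : Prop :=
  bijective (fun f : mor x y => theta ∘ f) /\
  bijective (fun f : mor x (Omega y) => fmap Omega theta ∘ f).

Lemma mor_bij (x z z' : T) (t : mor z z') :
  bijective (fun f : mor x z => t ∘ f) <->
  ((forall f : mor x z, t ∘ f = 0 -> f = 0) /\
   (forall h : mor x z', exists f, h = t ∘ f)).
Proof.
split=> [[t' tK Kt]|[ti ts]].
  split=> [f tf|h]; last by exists (t' h); rewrite Kt.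
  by apply: (can_inj tK); rewrite /= tf comp0r.
pose t' h := sval (cid (ts h)).
have tt' h : t ∘ t' h = h by rewrite /t'; case: cid.
exists t' => // f; apply/eqP; rewrite -subr_eq0; apply/eqP/ti.
by rewrite compBr tt' subrr.
Qed.

(** Injectivity is tested on each [f ∘ q i]; for surjectivity, lifts of the [h ∘ q i] are
    reassembled with the [p i]. This treats finite sums and retracts at once. *)
Lemma local_iso_retract (x : T) (I : Type) (r : seq I) (xs : I -> T)
    (p : forall i, mor x (xs i)) (q : forall i, mor (xs i) x) :
  (forall i, local_iso (xs i)) -> idm x = \sum_(i <- r) q i ∘ p i -> local_iso x.
Proof.
move=> Pxs idx.
have key (z z' : T) (t : mor z z') :
    (forall i, bijective (fun f : mor (xs i) z => t ∘ f)) ->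
    bijective (fun f : mor x z => t ∘ f).
  move=> ht; apply/mor_bij; split=> [f tf|h].
    rewrite -[f]compm_idr idx comp_sumr big1 // => i _.
    have /mor_bij[ti _] := ht i.
    by rewrite compmA (ti (f ∘ q i)) ?comp0l // compmA tf comp0l.
  pose f i : mor (xs i) z := sval (cid (let: conj _ ts := (mor_bij _ _).1 (ht i) in ts (h ∘ q i))).
  have tf i : t ∘ f i = h ∘ q i by rewrite /f; case: cid.
  exists (\sum_(i <- r) f i ∘ p i); rewrite comp_sumr -{1}[h]compm_idr idx comp_sumr.
  by apply: eq_bigr => i _; rewrite !compmA tf.
by split; apply: key => i; case: (Pxs i).
Qed.

Lemma local_iso_retract1 (x x' : T) (p : mor x x') (q : mor x' x) :
  local_iso x' -> q ∘ p = idm x -> local_iso x.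
Proof.
move=> Px' qp.
apply: (@local_iso_retract x unit [:: tt] (fun=> x') (fun=> p) (fun=> q)) => //.
by rewrite big_seq1.
Qed.

(** The five lemma for the row [Hom(b, Omega y) -> Hom(a, Omega y) -> Hom(c, y) -> Hom(b, y) ->
    Hom(a, y)] and the one for [y'], with [Hom(c, y)] read as [Hom(Omega c, Omega y)]. Two degrees
    on [a] and [b] leave one degree on [c], the one that serves to invert [theta]. *)
Lemma local_iso_cone (a b c : T)
    (d : mor (Omega c) a) (f : mor a b) (g : mor b c) :
  dist d f g -> local_iso a -> local_iso b ->
  bijective (fun h : mor c y => theta ∘ h).
Proof.
move=> dfg [/mor_bij[a0i _] /mor_bij[a1i a1s]] [/mor_bij[b0i b0s] /mor_bij[_ b1s]].
have d1 := (dist_rotate _ _ _).1 dfg; have d2 := (dist_rotate _ _ _).1 d1.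
(* Exactness at [Hom(c, z)]: what vanishes on [b] comes from [a] through [d], after applying
   [Omega]. *)
have lift (z : T) (h : mor c z) : h ∘ g = 0 ->
    exists k : mor a (Omega z), fmap Omega h = k ∘ d.
  move=> hg; apply: dist_extend d2 _.
  by rewrite compNr -fmap_comp hg Omega0 oppr0.
apply/mor_bij; split=> [h th|h].
  have [|k hk] := lift _ h; first by apply: b0i; rewrite compmA th comp0l.
  have [|l kl] := dist_extend (u := fmap Omega theta ∘ k) d1.
    by rewrite -compmA -hk -fmap_comp th Omega0.
  have [l' ll'] := b1s l.
  have kl' : k = l' ∘ f.
    apply/eqP; rewrite -subr_eq0; apply/eqP/a1i.
    by rewrite compBr kl ll' compmA subrr.
  apply: Omega_faithful.
  by rewrite hk kl' -compmA (dist_comp0 d1) comp0r Omega0.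
(* The preimage has two parts: [n] matches [h] after restriction to [b], and [p] matches the
   remaining difference, which comes from [a]. *)
have [m hm] := b0s (h ∘ g).
have [|n mn] := dist_extend (u := m) dfg.
  by apply: a0i; rewrite compmA -hm -compmA (dist_comp0 dfg) comp0r.
have [|k hk] := lift _ (h - theta ∘ n).
  by rewrite compBl hm mn compmA subrr.
have [k' kk'] := a1s k; have [p pk] := Omega_full (k' ∘ d).
exists (n + p); rewrite compDr; apply/eqP; rewrite addrC -subr_eq; apply/eqP.
by apply: Omega_faithful; rewrite hk kk' fmap_comp pk compmA.
Qed.

End FiveLemma.

(** * Convolution algebras *)

Section LinearFunctions.
Variables (R : pzRingType) (U V : lmodType R) (f : U -> V).
Hypothesis fl : linear f.

Lemma lin0 : f 0 = 0.
Proof. by have := fl (-1) 0 0; rewrite scaler0 addr0 scaleN1r addNr. Qed.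

Lemma linD x y : f (x + y) = f x + f y.
Proof. by have := fl 1 x y; rewrite !scale1r. Qed.

Lemma linZ a x : f (a *: x) = a *: f x.
Proof. by have := fl a x 0; rewrite !addr0 lin0 addr0. Qed.

Lemma linN x : f (- x) = - f x.
Proof. by rewrite -!scaleN1r linZ. Qed.

Lemma linB x y : f (x - y) = f x - f y.
Proof. by rewrite linD linN. Qed.

Lemma lin_sum (I : Type) (r : seq I) (x : I -> U) :
  f (\sum_(i <- r) x i) = \sum_(i <- r) f (x i).
Proof. exact: (big_morph f linD lin0). Qed.

End LinearFunctions.

Section ConvolutionAlgebras.
Variables (R : pzRingType) (G : psemigroup) (A : assocAlgType R).

Lemma conv_decomp (s : seq G) (x : convAlg G A) :
  uniq s -> (forall y, y \notin s -> x y = 0) ->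
  x = \sum_(y <- s) single y (x y).
Proof.
move=> us xs; apply: conv_eq => z.
have -> : (\sum_(y <- s) single y (x y)) z = \sum_(y <- s) single_fun y (x y) z.
  by elim: s {us xs} => [|y s IH]; rewrite ?big_nil // !big_cons -IH.
have [zs|nzs] := boolP (z \in s); last first.
  rewrite xs // big1_seq // => y /= ys; rewrite /single_fun; case: eqP => // zy.
  by rewrite zy ys in nzs.
rewrite (bigD1_seq z) //= /single_fun eqxx big1 ?addr0 // => y.
by rewrite eq_sym => /negPf ->.
Qed.

Lemma single0 (g : G) : single g (0 : A) = 0.
Proof. exact: lin0 (single_linear g). Qed.

Lemma singleD (g : G) (a b : A) : single g (a + b) = single g a + single g b.
Proof. exact: linD (single_linear g) a b. Qed.

Lemma conv_ind (P : convAlg G A -> Prop) :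
  P 0 -> (forall x y, P x -> P y -> P (x + y)) ->
  (forall g a, P (single g a)) -> forall x, P x.
Proof.
move=> P0 PD Ps x; have [s us xs] := fin_supp_seq (conv_valP x).
rewrite (conv_decomp us xs); elim: {us xs} s => [|g s IH]; first by rewrite big_nil.
by rewrite big_cons; apply: PD.
Qed.

Section Lift.
Variables (V : lmodType R) (h : G -> A -> V).
Hypothesis hl : forall g, linear (h g).

Definition clift (x : convAlg G A) : V := \sum_(g \in [set: G]) h g (x g).

Let h0 g : h g 0 = 0.
Proof. exact: lin0 (hl g). Qed.

Lemma cliftE (s : seq G) (x : convAlg G A) :
  uniq s -> (forall y, y \notin s -> x y = 0) ->
  clift x = \sum_(g <- s) h g (x g).
Proof.
move=> us xs; rewrite /clift (fsbigE _ _ us) //.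
  by apply: eq_bigl => g; rewrite in_setT.
by move=> g _ gs; rewrite xs.
Qed.

Lemma clift_linear : linear clift.
Proof.
move=> a x y; have [s us xs] := fin_supp_seq (conv_valP x).
have [t ut yt] := fin_supp_seq (conv_valP y).
have xst z : z \notin undup (s ++ t) -> x z = 0.
  by rewrite mem_undup mem_cat negb_or => /andP[/xs].
have yst z : z \notin undup (s ++ t) -> y z = 0.
  by rewrite mem_undup mem_cat negb_or => /andP[_ /yt].
have u := undup_uniq (s ++ t).
rewrite (cliftE u xst) (cliftE u yst) (@cliftE (undup (s ++ t))) //.
  rewrite scaler_sumr -big_split; apply: eq_bigr => g _ /=.
  exact: hl.
move=> z zst; change (a *: x z + y z = 0).
by rewrite xst // yst // scaler0 addr0.
Qed.

Lemma clift_single g a : clift (single g a) = h g a.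
Proof.
rewrite (@cliftE [:: g]) //.
  by rewrite big_seq1; congr (h g _); rewrite /single /= /single_fun eqxx.
by move=> y; rewrite inE => /negPf yg; rewrite /single /= /single_fun yg.
Qed.

End Lift.

Lemma conv_ext (V : lmodType R) (f g : convAlg G A -> V) :
  linear f -> linear g -> (forall x a, f (single x a) = g (single x a)) ->
  f =1 g.
Proof.
move=> fl gl fg.
apply: conv_ind => [|x y ex ey|//]; first by rewrite !lin0.
by rewrite !linD // ex ey.
Qed.

Section LiftHom.
Variables (B : assocAlgType R) (h : G -> A -> B).
Hypothesis hl : forall g, linear (h g).
Hypothesis hM : forall g g' a a',
  h g a ** h g' a' = oapp (fun z => h z (a ** a')) 0 (psg_mul g g').

Lemma clift_mul : {morph clift h : x y / x ** y}.
Proof.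
have cl := clift_linear hl; have c0 := lin0 cl; have cD := linD cl.
move=> x y; elim/conv_ind: x => [|x x' ex ex'|g a].
- by rewrite amul0l c0 amul0l.
- by rewrite amulDl !cD ex ex' amulDl.
elim/conv_ind: y => [|y y' ey ey'|g' a'].
- by rewrite amul0r c0 amul0r.
- by rewrite amulDr !cD ey ey' amulDr.
by rewrite single_mul !clift_single // hM; case: (psg_mul g g') => [z|] //=;
  rewrite ?clift_single.
Qed.

Definition clift_hom : alg_hom (convAlg G A) B := AlgHom (clift_linear hl) clift_mul.

End LiftHom.

End ConvolutionAlgebras.

(** * Homotopy invariant excisive theories *)

Definition zero_hom (R : pzRingType) (A B : assocAlgType R) : alg_hom A B.
Proof.
refine (@AlgHom R A B (fun=> 0) _ _).
- by move=> a x y; rewrite scaler0 addr0.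
- by move=> x y; rewrite amul0l.
Defined.

Section ProductAlgebra.
Variables (R : pzRingType) (A B : assocAlgType R).

Definition pair_amul (x y : A * B) : A * B := (x.1 ** y.1, x.2 ** y.2).

Lemma pair_amulA : associative pair_amul.
Proof. by move=> x y z; rewrite /pair_amul /= !amulA. Qed.

Lemma pair_amulDl : left_distributive pair_amul +%R.
Proof. by move=> x y z; rewrite /pair_amul /= !amulDl. Qed.

Lemma pair_amulDr : right_distributive pair_amul +%R.
Proof. by move=> x y z; rewrite /pair_amul /= !amulDr. Qed.

Lemma pair_amulZl (a : R) x y : pair_amul (a *: x) y = a *: pair_amul x y.
Proof. by rewrite /pair_amul /= !amulZl. Qed.

Lemma pair_amulZr (a : R) x y : pair_amul x (a *: y) = a *: pair_amul x y.
Proof. by rewrite /pair_amul /= !amulZr. Qed.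

HB.instance Definition _ := isAssocAlgebra.Build R (A * B)%type
  pair_amulA pair_amulDl pair_amulDr pair_amulZl pair_amulZr.

Definition prodAlg : assocAlgType R := (A * B)%type.

Definition fst_hom : alg_hom prodAlg A.
Proof. by refine (@AlgHom R prodAlg A fst _ _). Defined.

Definition snd_hom : alg_hom prodAlg B.
Proof. by refine (@AlgHom R prodAlg B snd _ _). Defined.

Definition pair_hom (C : assocAlgType R) (f : alg_hom C A) (g : alg_hom C B) :
  alg_hom C prodAlg.
Proof.
refine (@AlgHom R C prodAlg (fun x => (f x, g x)) _ _).
- by move=> a x y; rewrite !linearP.
- by move=> x y; rewrite !alg_homM.
Defined.

Definition add_hom (C : assocAlgType R) (f : alg_hom A C) (g : alg_hom B C)
  (fg : forall x y, f x ** g y = 0) (gf : forall x y, g x ** f y = 0) :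
  alg_hom prodAlg C.
Proof.
refine (@AlgHom R prodAlg C (fun p => f p.1 + g p.2) _ _).
- by move=> a x y /=; rewrite !linearP scalerDr addrACA.
- by move=> x y /=; rewrite amulDl !amulDr fg gf addr0 add0r !alg_homM.
Defined.

End ProductAlgebra.

Definition prod_extension (R : comPzRingType) (A B : Alg R) :
  @extension R A (prodAlg A B) B.
Proof.
refine (@Extension R A (prodAlg A B) B (pair_hom (alg_id A) (zero_hom A B))
  (snd_hom A B) _ _ _).
- by move=> x y [].
- move=> [x y] /=; split=> [->|[z [_ <-]]] //; by exists x.
- by exists (pair_hom (zero_hom B A) (alg_id B)) => //; apply: alg_homL.
Defined.

Definition ev0_hom (R : pzRingType) (A : assocAlgType R) : alg_hom (polyAlg A) A.
Proof.
refine (@clift_hom R nat_psg A A (fun n a => if n == 0%N then a else 0) _ _).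
- by move=> n a x y; case: ifP => // _; rewrite scaler0 addr0.
- by move=> [|n] [|m] a b //=; rewrite ?amul0l ?amul0r.
Defined.

Definition ev1_hom (R : pzRingType) (A : assocAlgType R) : alg_hom (polyAlg A) A.
Proof. by refine (@clift_hom R nat_psg A A (fun n a => a) _ _). Defined.

Section Theories.
Variables (R : comPzRingType) (T : triangulated) (X : functor (Alg R) T).
Variables (dX : excision X) (hX : homotopy_invariant X).
Local Notation Xm f := (fmap X (f : mor (_ : Alg R) (_ : Alg R))).

Lemma fmap_alg_comp (A B C : Alg R) (g : alg_hom B C) (f : alg_hom A B) :
  Xm (alg_comp g f) = Xm g ∘ Xm f.
Proof. exact: (@fmap_comp _ _ X A B C g f). Qed.

Lemma fmap_alg_id (A : Alg R) : Xm (alg_id A) = idm (X A).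
Proof. exact: (@fmap_id _ _ X A). Qed.

(** The zero endomorphism of [C] is the composite of the two maps in the product extension, and
    consecutive maps of a triangle compose to zero. *)
Lemma fmap_zero (A B : Alg R) : Xm (zero_hom A B) = 0.
Proof.
have zero_endo (C : Alg R) : Xm (zero_hom C C) = 0.
  rewrite -(dist_comp0 (bd_dist dX (prod_extension C C))) -fmap_alg_comp.
  by congr fmap; apply: alg_hom_eq.
have -> : zero_hom A B = alg_comp (zero_hom A B) (zero_hom A A).
  exact: alg_hom_eq.
by rewrite fmap_alg_comp zero_endo comp0r.
Qed.

(** By orthogonality [f] and [g] define a homomorphism on the product algebra, and [h] is its
    composite with the diagonal; so only the diagonal has to be decomposed. *)
Lemma fmap_orthogonal_sum (A B : Alg R) (f g h : alg_hom A B) :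
  (forall x y, f x ** g y = 0) -> (forall x y, g x ** f y = 0) ->
  (forall x, h x = f x + g x) -> Xm h = Xm f + Xm g.
Proof.
move=> fg gf hfg.
pose i1 := pair_hom (alg_id A) (zero_hom A A).
pose i2 := pair_hom (zero_hom A A) (alg_id A).
pose D := pair_hom (alg_id A) (alg_id A).
have p1 (u v : alg_hom A A) : alg_comp (fst_hom A A) (pair_hom u v) = u.
  exact: alg_hom_eq.
have p2 (u v : alg_hom A A) : alg_comp (snd_hom A A) (pair_hom u v) = v.
  exact: alg_hom_eq.
(* The difference is killed by the second projection, so it factors through the first inclusion; the
   first projection then shows the factor to be zero. *)
have XD : Xm D = Xm i1 + Xm i2.
  apply/eqP; rewrite -subr_eq0; apply/eqP; set u := _ - _.
  have [|v uv] := dist_lift (u := u) (bd_dist dX (prod_extension A A)).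
    rewrite /u /= compBr compDr -!fmap_alg_comp !p2 fmap_zero.
    by rewrite add0r subrr.
  have : Xm (fst_hom A A) ∘ u = 0.
    rewrite /u compBr compDr -!fmap_alg_comp !p1 fmap_zero.
    by rewrite addr0 subrr.
  by rewrite uv compmA -fmap_alg_comp p1 fmap_alg_id compm_idl => ->; rewrite comp0r.
have -> : h = alg_comp (add_hom fg gf) D by apply: alg_hom_eq => x; rewrite hfg.
rewrite fmap_alg_comp XD compDr -!fmap_alg_comp.
by congr (_ + _); congr fmap; apply: alg_hom_eq => x /=; rewrite linear0 ?addr0 ?add0r.
Qed.

Section SplitExtension.
Variables (A B C : Alg R) (e : extension A B C) (s : alg_hom C B).
Hypothesis es : forall x, ext_proj e (s x) = x.

(** The section makes [fmap Omega] of the projection split epi, and [bd] composed with it vanishes.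
    Hence [bd] is zero, and [X] of the kernel inclusion is a monomorphism. *)
Lemma split_ext_monic (x : T) (u v : mor x (X A)) :
  Xm (ext_inj e) ∘ u = Xm (ext_inj e) ∘ v -> u = v.
Proof.
move=> uv; apply/eqP; rewrite -subr_eq0; apply/eqP.
have dd := (dist_rotate _ _ _).1 (bd_dist dX e).
have [|w ->] := dist_lift (u := u - v) dd; first by rewrite compBr uv subrr.
suff -> : bd dX e = 0 by rewrite comp0l.
have ps : Xm (ext_proj e) ∘ Xm s = idm (X C).
  by rewrite -fmap_alg_comp -fmap_alg_id; congr fmap; apply: alg_hom_eq.
have := dist_comp0 ((dist_rotate _ _ _).1 dd).
rewrite compNr => /eqP; rewrite oppr_eq0 => /eqP bp.
by rewrite -[bd dX e]compm_idr -fmap_id -ps fmap_comp compmA bp comp0l.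
Qed.

(** The morphism attached to a quasi-homomorphism in the sense of Cuntz: two homomorphisms that
    agree modulo an ideal. *)
Lemma split_ext_difference (s' : alg_hom C B) :
  (forall x, ext_proj e (s' x) = x) ->
  exists k : mor (X C) (X A), Xm (ext_inj e) ∘ k = Xm s' - Xm s.
Proof.
move=> es'; have [|k ->] := dist_lift (u := Xm s' - Xm s) (bd_dist dX e).
  rewrite compBr -!fmap_alg_comp; apply/eqP; rewrite subr_eq0; apply/eqP.
  by congr fmap; apply: alg_hom_eq => x /=; rewrite es es'.
by exists k.
Qed.

End SplitExtension.

(** Both evaluations are left inverses of [poly_incl], which [X] inverts. *)
Lemma fmap_ev (A B : Alg R) (H : alg_hom A (polyAlg B)) :
  Xm (alg_comp (ev0_hom B) H) = Xm (alg_comp (ev1_hom B) H).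
Proof.
rewrite !fmap_alg_comp; congr (_ ∘ _).
apply: (is_iso_epic (hX B)); rewrite -!fmap_alg_comp; congr fmap.
by apply: alg_hom_eq => x /=; rewrite !clift_single //; move=> n a u v;
  case: ifP; rewrite ?scaler0 ?addr0.
Qed.

(* [f + t (g - f)] is then a homomorphism to polynomials. *)
Lemma fmap_linear_homotopy (A B : Alg R) (f g : alg_hom A B) :
  (forall x y, (g x - f x) ** (g y - f y) = 0) -> Xm f = Xm g.
Proof.
move=> sq; have [d dE dl] : exists2 d : A -> B, forall x, d x = g x - f x & linear d.
  exists (fun x => g x - f x) => // a x y.
  by rewrite (alg_homL f) (alg_homL g) opprD addrACA -scalerBr.
have gE z : g z = f z + d z by rewrite dE addrC subrK.
have dd x y : d x ** d y = 0 by rewrite !dE.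
pose h x : polyAlg B := @single R nat_psg B 0%N (f x) + @single R nat_psg B 1%N (d x).
have hl : linear h.
  move=> a x y; rewrite /h dl (alg_homL f) !single_linear.
  by rewrite scalerDr addrACA.
have hM : {morph h : x y / x ** y}.
  move=> x y; rewrite /h amulDl !amulDr !single_mul /= dd single0 addr0.
  rewrite -addrA -singleD !alg_homM; congr (_ + single _ _).
  (* The degree one identity is the multiplicativity of [f + d], from which [dd] removes the
     quadratic term. *)
  have := alg_homM g x y; rewrite !gE amulDl !amulDr dd addr0 alg_homM -addrA.
  by move/addrI => ->.
pose H := AlgHom hl hM.
have e0 : alg_comp (ev0_hom B) H = f.
  apply: alg_hom_eq => x; change (ev0_hom B (h x) = f x).
  rewrite /h (linD (alg_homL (ev0_hom B))) /=.
  rewrite !clift_single ?addr0 //; move=> n a u v;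
  by case: ifP; rewrite ?scaler0 ?addr0.
have e1 : alg_comp (ev1_hom B) H = g.
  apply: alg_hom_eq => x; change (ev1_hom B (h x) = g x).
  rewrite /h (linD (alg_homL (ev1_hom B))) /=.
  by rewrite !clift_single // gE.
by rewrite -e0 fmap_ev e1.
Qed.

(* The system [h] is a homomorphism from the 2x2 matrices over [A]; conjugate by
   the columns (1,0), (1,1), (0,1) with rows (1,0), (1,0), (0,1), moving one
   entry at a time. *)
Lemma fmap_corners (A B : Alg R) (h : bool -> bool -> A -> B) (f g : alg_hom A B) :
  (forall i j, linear (h i j)) ->
  (forall i j k l x y, h i j x ** h k l y = if j == k then h i l (x ** y) else 0) ->
  f =1 h false false -> g =1 h true true -> Xm f = Xm g.
Proof.
move=> hl hM fE gE.
have [a01 a01E] : exists a, forall x, a x = h false false x + h true false x.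
  by exists (fun x => h false false x + h true false x).
have [a11 a11E] : exists a, forall x, a x = h false true x + h true true x.
  by exists (fun x => h false true x + h true true x).
have a01l : linear a01.
  by move=> a x y; rewrite !a01E !hl scalerDr addrACA.
have a11l : linear a11.
  by move=> a x y; rewrite !a11E !hl scalerDr addrACA.
have a01M x y : a01 (x ** y) = a01 x ** a01 y.
  by rewrite !a01E amulDl !amulDr !hM /= !addr0.
have a11M x y : a11 (x ** y) = a11 x ** a11 y.
  by rewrite !a11E amulDl !amulDr !hM /= !add0r.
have a0111 x y : a11 (x ** y) = a01 x ** a11 y.
  by rewrite !a01E !a11E amulDl !amulDr !hM /= !addr0.
have a1101 x y : a01 (x ** y) = a11 x ** a01 y.
  by rewrite !a01E !a11E amulDl !amulDr !hM /= !add0r.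
have -> : Xm f = Xm (AlgHom a01l a01M).
  apply: fmap_linear_homotopy => x y /=.
  by rewrite !a01E !fE ![h false false _ + _]addrC !addrK hM.
have -> : Xm (AlgHom a01l a01M) = Xm (AlgHom a11l a11M).
  apply: fmap_linear_homotopy => x y.
  change ((a11 x - a01 x) ** (a11 y - a01 y) = 0).
  rewrite amulDl !amulDr !amulNl !amulNr -a11M -a0111 -a1101 -a01M opprK.
  by rewrite addrACA subrr addNr addr0.
apply: fmap_linear_homotopy => x y.
change ((g x - a11 x) ** (g y - a11 y) = 0).
have e z : g z - a11 z = - h false true z by rewrite gE a11E opprD addrCA subrr addr0.
by rewrite !e amulNl amulNr opprK hM.
Qed.
End Theories.

(** * Hessenberg's theorem *)

Section Hessenberg.
Variable T : Type.
Implicit Types A B : set T.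

(** A maximal partial matching between [A] and [B] exhausts one side, since two unmatched elements
    could be added as a pair. *)
Lemma comparable_injections A B :
  (exists2 f : T -> T, forall x, A x -> B (f x) & {in A &, injective f}) \/
  (exists2 f : T -> T, forall x, B x -> A (f x) & {in B &, injective f}).
Proof.
pose P (G : set (T * T)) := (forall p, G p -> A p.1 /\ B p.2) /\
  (forall p q, G p -> G q -> (p.1 = q.1 <-> p.2 = q.2)).
have [|G [[GAB GI] Gmax]] := @Zorn_bigcup _ P.
  move=> F FP Ftot; split=> [p [G FG Gp]|p q [G FG Gp] [G' FG' Gq]].
    by have [/(_ p Gp)] := FP _ FG.
  have [GG'|G'G] := Ftot _ _ FG FG'.
    by have [_] := FP _ FG'; apply=> //; apply: GG'.
  by have [_] := FP _ FG; apply=> //; apply: G'G.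
have [domG|ndom] := pselect (forall x, A x -> exists y, G (x, y)).
  left; have cG x : exists y, A x -> G (x, y).
    by have [/domG[y Gxy]|nA] := pselect (A x); [exists y|exists x].
  have [f fG] := choice cG; exists f => [x Ax|x y /set_mem Ax /set_mem Ay fxy].
    by have [] := GAB _ (fG x Ax).
  exact: (GI _ _ (fG x Ax) (fG y Ay)).2.
right; have {ndom}[x0 [Ax0 nx0]] : exists x, A x /\ forall y, ~ G (x, y).
  apply: contrapT => H; apply: ndom => x Ax; apply: contrapT => nG.
  by apply: H; exists x; split=> // y Gxy; apply: nG; exists y.
have ranG y : B y -> exists x, G (x, y).
  move=> By; apply: contrapT => nG.
  apply: (Gmax (G `|` [set (x0, y)])).
    split; first by move=> p; left.
    by move=> /(_ (x0, y)) H; apply: (nx0 y); apply: H; right.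
  split=> [p [/GAB//|->//]|p q [Gp|->] [Gq|->]] //=.
  - exact: GI.
  - split=> e; first by case: (nx0 p.2); rewrite -e -surjective_pairing.
    by case: nG; exists p.1; rewrite -e -surjective_pairing.
  - split=> e; first by case: (nx0 q.2); rewrite e -surjective_pairing.
    by case: nG; exists q.1; rewrite e -surjective_pairing.
have cG y : exists x, B y -> G (x, y).
  by have [/ranG[x Gxy]|nB] := pselect (B y); [exists x|exists y].
have [f fG] := choice cG; exists f => [x Bx|x y /set_mem Bx /set_mem By fxy].
  by have [] := GAB _ (fG x Bx).
exact: (GI _ _ (fG x Bx) (fG y By)).1.
Qed.

(** A squaring [G] is the graph of an injection of pairs in [A] into [A]. Reading [A] off the
    diagonal lets plain inclusion of graphs order the set [A] together with its injection, as Zorn's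
    lemma requires. *)
Definition sq_dom (G : set (T * T * T)) : set T := [set x | exists z, G (x, x, z)].

Definition squaring (G : set (T * T * T)) : Prop :=
  [/\ forall x y z, G (x, y, z) -> [/\ sq_dom G x, sq_dom G y & sq_dom G z],
      forall x y, sq_dom G x -> sq_dom G y -> exists z, G (x, y, z)
    & forall x y z x' y' z', G (x, y, z) -> G (x', y', z') ->
        ((x = x' /\ y = y') <-> z = z')].

Lemma squaring_max (i : nat -> T) : injective i ->
  exists G, [/\ squaring G, forall n, sq_dom G (i n) &
    forall G', G `<` G' -> ~ squaring G'].
Proof.
move=> iinj.
pose G0 : set (T * T * T) := [set p | exists m n,
  p = (i m, i n, i (choice.pickle (m, n)))].
have domG0 n : sq_dom G0 (i n) by exists (i (choice.pickle (n, n))); exists n, n.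
have sqG0 : squaring G0.
  split=> [x y z [m [n [-> -> ->]]] //|x y [z [m [n [-> _ _]]]]|].
    move=> [z' [m' [n' [-> _ _]]]].
    by exists (i (choice.pickle (m, m'))), m, m'.
  move=> x y z x' y' z' [m [n [-> -> ->]]] [m' [n' [-> -> ->]]]; split.
    by move=> [/iinj -> /iinj ->].
  by move=> /iinj /(pcan_inj choice.pickleK) [-> ->].
(* Adjoining [G0], the pairing of natural numbers transported by [i], makes the property hold for
   the union of the empty chain and keeps the image of [i] in the domain. *)
have [|G [sqG Gmax]] := @Zorn_bigcup _ (fun G => squaring (G `|` G0)).
  move=> F FP Ftot; set U := \bigcup_(X in F) X.
  have FU X : F X -> X `|` G0 `<=` U `|` G0.
    by move=> FX p [Xp|G0p]; [left; exists X|right].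
  have domU X x : X `<=` U `|` G0 -> sq_dom X x -> sq_dom (U `|` G0) x.
    by move=> XU [z Xz]; exists z; apply: XU.
  have good p : (U `|` G0) p -> exists X,
      [/\ squaring X, X p, X `<=` U `|` G0 & X = G0 \/ exists2 Y, F Y & X = Y `|` G0].
    move=> [[X FX Xp]|G0p]; last first.
      by exists G0; split=> //; left.
    exists (X `|` G0); split; [exact: FP|by left|exact: FU|by right; exists X].
  have good2 p q : (U `|` G0) p -> (U `|` G0) q -> exists X,
      [/\ squaring X, X p, X q & X `<=` U `|` G0].
    move=> /good[X [sX Xp XU eX]] /good[Y [sY Yq YU eY]].
    case: eX => [X0|[X' FX' eX]].
      exists Y; split=> //; case: eY => [->|[Y' _ ->]]; first by rewrite -X0.
      by right; rewrite -X0.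
    case: eY => [Y0|[Y' FY' eY]]; first by exists X; split=> //; rewrite eX -Y0; right.
    have [XY|YX] := Ftot _ _ FX' FY'.
      exists Y; split=> //; rewrite eY; move: Xp; rewrite eX => -[/XY|]; by [left|right].
    exists X; split=> //; rewrite eX; move: Yq; rewrite eY => -[/YX|]; by [left|right].
  split=> [x y z Uxyz|x y [z Uz] [z' Uz']|x y z x' y' z' Uz Uz'].
  - have [X [[/(_ x y z) Xd _ _] Xp XU _]] := good _ Uxyz.
    by have [? ? ?] := Xd Xp; split; apply: domU XU _.
  - have [X [[_ /(_ x y) Xd _] Xp Xq XU]] := good2 _ _ Uz Uz'.
    have [||w Xw] := Xd; [by exists z|by exists z'|].
    by exists w; apply: XU.
  - have [X [[_ _ XI] Xp Xq XU]] := good2 _ _ Uz Uz'.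
    exact: XI.
exists (G `|` G0); split=> [//|n|G' [GG' nG'] sqG'].
  by have [z ?] := domG0 n; exists z; right.
have G'E : G' = G' `|` G0 by apply/esym/setUidl => p G0p; apply: GG'; right.
apply: (Gmax G').
  split; first by move=> p Gp; apply: GG'; left.
  by move=> G'G; apply: nG' => p /G'G; left.
by rewrite -G'E.
Qed.

(** For a maximal [G], if the complement of its domain [A] injects into [A], then so does [T], and
    the squaring of [A] gives one of [T]. If instead [A] injects into its complement, a copy of [A]
    can be added, against maximality. *)
Lemma square_injection (i : nat -> T) : injective i ->
  exists g : T * T -> T, injective g.
Proof.
move=> iinj; have [G [[Gd Gt GI] Gi Gmax]] := squaring_max iinj.
set A := sq_dom G in Gd Gt Gi.
have cG p : exists z, A p.1 -> A p.2 -> G (p.1, p.2, z).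
  have [A1|nA] := pselect (A p.1); last by exists p.1.
  have [A2|nA] := pselect (A p.2); last by exists p.1.
  by have [z ?] := Gt _ _ A1 A2; exists z.
have [g gG] := choice cG.
have gA x y : A x -> A y -> A (g (x, y)).
  by move=> Ax Ay; have [] := Gd _ _ _ (gG (x, y) Ax Ay).
have gI x y x' y' : A x -> A y -> A x' -> A y' ->
    g (x, y) = g (x', y') -> x = x' /\ y = y'.
  move=> Ax Ay Ax' Ay'; apply: (GI _ _ _ _ _ _ _ _).2; exact: gG (_, _) _ _.
have [[h hA hI]|[h hA hI]] := comparable_injections A (~` A); last first.
  (* The second coordinate, [i 0] or [i 1], separates [A] from its complement. *)
  pose k x := if pselect (A x) then g (x, i 0%N) else g (h x, i 1%N).
  have kA x : A (k x).
    by rewrite /k; case: pselect => Ax; apply: gA => //; apply: hA.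
  have kI : injective k.
    move=> x y; rewrite /k; case: pselect => Ax; case: pselect => Ay.
    - by move=> /gI[].
    - by move=> /(gI _ _ _ _ Ax (Gi _) (hA _ Ay) (Gi _))[_ /iinj].
    - by move=> /(gI _ _ _ _ (hA _ Ax) (Gi _) Ay (Gi _))[_ /iinj].
    - move=> /(gI _ _ _ _ (hA _ Ax) (Gi _) (hA _ Ay) (Gi _))[hxy _].
      by apply: hI => //; apply: mem_set.
  exists (fun p => g (k p.1, k p.2)) => -[x y] [x' y'] /= /gI[//|//|//|//|].
  by move=> /kI -> /kI ->.
exfalso.
have hI' x y : A x -> A y -> h x = h y -> x = y.
  by move=> Ax Ay; apply: hI; apply: mem_set.
(* The enlarged domain is [A] with its copy under [h]. A new pair has a coordinate in the copy; the
   tag [t b c] records which coordinates are, and the value lies in the copy, away from the values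
   of [G]. *)
pose e (b : bool) x := if b then h x else x.
pose t (b c : bool) := i (b + c.*2)%N.
have tI b c b' c' : t b c = t b' c' -> b = b' /\ c = c'.
  by move=> /iinj; case: b b' c c' => [] [] [] [].
have eI b x b' x' : A x -> A x' -> e b x = e b' x' -> b = b' /\ x = x'.
  move=> Ax Ax'; case: b b' => [] [] /= xx' //.
  - by split=> //; apply: hI'.
  - by case: (hA x Ax); rewrite xx'.
  - by case: (hA x' Ax'); rewrite -xx'.
have gtA a a' b c : A a -> A a' -> A (g (g (a, a'), t b c)).
  by move=> Aa Aa'; apply: (gA _ _ (gA _ _ Aa Aa')); apply: Gi.
pose N : set (T * T * T) := [set p | exists b c a a',
  [/\ b || c, A a, A a' & p = (e b a, e c a', h (g (g (a, a'), t b c)))]].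
have domN x : A x -> sq_dom (G `|` N) x /\ sq_dom (G `|` N) (h x).
  move=> Ax; split; first by have [z ?] := Ax; exists z; left.
  by exists (h (g (g (x, x), t true true))); right; exists true, true, x, x.
have NA x : sq_dom (G `|` N) x -> exists b a, A a /\ x = e b a.
  move=> [z [Gz|[b [c [a [a' [_ Aa _ [-> _ _]]]]]]]]; last by exists b, a.
  by exists false, x; split=> //; exists z.
have eN b x : A x -> sq_dom (G `|` N) (e b x).
  by move=> /domN[? ?]; case: b.
apply: (Gmax (G `|` N)).
  split; first by move=> p; left.
  move=> /(_ (h (i 0%N), h (i 0%N), h (g (g (i 0%N, i 0%N), t true true)))) H.
  apply: (hA (i 0%N)) => //; exists (h (g (g (i 0%N, i 0%N), t true true))).
  by apply: H; right; exists true, true, (i 0%N), (i 0%N).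
split=> [x y z [/Gd[Ax Ay Az]|[b [c [a [a' [_ Aa Aa' [-> -> ->]]]]]]]||].
- by split; apply: (domN _ _).1.
- by split; [exact: eN|exact: eN|]; apply: (domN _ _).2; exact: gtA.
- move=> x y /NA[b [a [Aa ->]]] /NA[c [a' [Aa' ->]]].
  have [bc|] := boolP (b || c).
    by exists (h (g (g (a, a'), t b c))); right; exists b, c, a, a'.
  case: b c => [] [] //= _; have [z Gz] := Gt _ _ Aa Aa'.
  by exists z; left.
have cross x y z b c a a' : G (x, y, z) -> b || c -> A a -> A a' ->
    ((x = e b a /\ y = e c a') <-> z = h (g (g (a, a'), t b c))).
  move=> Gz bc Aa Aa'; have [Ax Ay Az] := Gd _ _ _ Gz; split.
    move=> [xe ye]; have := eI false x b a Ax Aa xe.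
    by have := eI false y c a' Ay Aa' ye; move: bc => /orP[] -> [? ?] [? ?].
  move=> ze; case: (hA (g (g (a, a'), t b c))); last by rewrite -ze.
  exact: gtA.
move=> x y z x' y' z' [Gz|[b [c [a [a' [bc Aa Aa' [-> -> ->]]]]]]]
  [Gz'|[b' [c' [d [d' [bc' Ad Ad' [-> -> ->]]]]]]].
- exact: GI.
- exact: cross.
- by split=> [[/esym xe /esym ye]|/esym ze];
    [apply/esym/(cross _ _ _ _ _ _ _ Gz')|have [? ?] := (cross _ _ _ _ _ _ _ Gz' bc Aa Aa').2 ze].
split.
  by move=> [/eI[//|//|<- <-] /eI[//|//|<- <-]].
move=> /(hI' _ _ (gtA _ _ _ _ Aa Aa') (gtA _ _ _ _ Ad Ad')).
move=> /(gI _ _ _ _ (gA _ _ Aa Aa') (Gi _) (gA _ _ Ad Ad') (Gi _))[].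
by move=> /(gI _ _ _ _ Aa Aa' Ad Ad')[-> ->] /tI[-> ->].
Qed.

Lemma seq_injection (i : nat -> T) : injective i ->
  exists g : seq T -> T, injective g.
Proof.
move=> iinj; have [g gI] := square_injection iinj.
(* The outer second coordinate distinguishes the empty sequence, [i 1], from a nonempty one, [i 0],
   so that decoding knows where to stop. *)
pose h s := foldr (fun x y => g (g (x, y), i 0%N)) (g (i 0%N, i 1%N)) s.
exists h; elim=> [|x s IH] [|y t] //= /gI[].
- by move=> _ /iinj.
- by move=> _ /iinj.
- by move=> /gI[-> /IH ->].
Qed.

End Hessenberg.

Local Arguments alg_fun {R A B} _ _ : simpl never.

(** * The graph inverse semigroup *)

Section Basis.
Variables (R : comPzRingType) (G : psemigroup).
Local Notation A := (convAlg G (ground R)).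

Definition basis (g : G) : A := single g (1 : ground R).

Lemma basis_mul (g h : G) : basis g ** basis h = oapp basis 0 (psg_mul g h).
Proof.
rewrite /basis single_mul; have -> // : (1 : ground R) ** (1 : ground R) = 1.
exact: mulr1.
Qed.

Lemma singleE (g : G) (a : ground R) : single g a = (a : R) *: basis g.
Proof.
rewrite -(linZ (single_linear g)); congr single.
by rewrite /= -[LHS]mulr1.
Qed.

Lemma basis_ext (V : lmodType R) (f g : A -> V) :
  linear f -> linear g -> (forall x, f (basis x) = g (basis x)) -> f =1 g.
Proof.
move=> fl gl fg; apply: conv_ext => // x a.
by rewrite singleE (linZ fl) (linZ gl) fg.
Qed.

Section BasisLift.
Variables (V : lmodType R) (v : G -> V).

Definition blift : A -> V := clift (fun g (a : ground R) => (a : R) *: v g).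

Let hl g : linear (fun a : ground R => (a : R) *: v g).
Proof. by move=> a x y; rewrite scalerDl scalerA. Qed.

Lemma blift_linear : linear blift.
Proof. exact: clift_linear. Qed.

Lemma blift_basis g : blift (basis g) = v g.
Proof. by rewrite /blift clift_single // scale1r. Qed.

End BasisLift.

Lemma basis_linear_mul (B : assocAlgType R) (f : A -> B) : linear f ->
  (forall g h, f (basis g) ** f (basis h) = f (basis g ** basis h)) ->
  {morph f : x y / x ** y}.
Proof.
move=> fl fM x y; elim/conv_ind: x => [|x x' ex ex'|g a].
- by rewrite amul0l (lin0 fl) amul0l.
- by rewrite amulDl !(linD fl) ex ex' amulDl.
elim/conv_ind: y => [|y y' ey ey'|h b].
- by rewrite amul0r (lin0 fl) amul0r.
- by rewrite amulDr !(linD fl) ey ey' amulDr.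
by rewrite !singleE amulZl amulZr !(linZ fl) amulZl amulZr fM.
Qed.

Lemma blift_mul (B : assocAlgType R) (v : G -> B) :
  (forall g h, v g ** v h = oapp v 0 (psg_mul g h)) ->
  {morph blift v : x y / x ** y}.
Proof.
move=> vM; apply: (basis_linear_mul (blift_linear v)) => g h.
rewrite basis_mul !blift_basis vM; case: (psg_mul g h) => [k|] /=.
  by rewrite blift_basis.
by rewrite (lin0 (blift_linear v)).
Qed.

Definition blift_hom (B : assocAlgType R) (v : G -> B)
    (vM : forall g h, v g ** v h = oapp v 0 (psg_mul g h)) : alg_hom A B :=
  AlgHom (blift_linear v) (blift_mul vM).

Lemma basis_hom_ext (B : assocAlgType R) (f g : alg_hom A B) :
  (forall x, f (basis x) = g (basis x)) -> f = g.
Proof.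
move=> fg; apply: alg_hom_eq; apply: basis_ext => //; exact: alg_homL.
Qed.

End Basis.

Section SubPsemigroup.
Variables (G : psemigroup) (P : pred G).
Hypothesis PM : forall x y z, P x -> P y -> psg_mul x y = Some z -> P z.

Definition sub_mul (x y : {x : G | P x}) : option {x : G | P x} :=
  obind insub (psg_mul (val x) (val y)).

Lemma sub_mulE x y : omap val (sub_mul x y) = psg_mul (val x) (val y).
Proof.
rewrite /sub_mul; case e : (psg_mul _ _) => [z|] //=.
have Pz : P z by apply: PM e; apply: valP.
by rewrite insubT.
Qed.

Lemma sub_mulA x y z :
  obind (fun u => sub_mul u z) (sub_mul x y) =
  obind (fun u => sub_mul x u) (sub_mul y z).
Proof.
have oinj : injective (omap (val : {x : G | P x} -> G)).
  by move=> [u|] [v|] // [] /val_inj ->.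
have l o : omap val (obind (fun u => sub_mul u z) o) =
    obind (fun u => psg_mul u (val z)) (omap val o).
  by case: o => //= u; rewrite sub_mulE.
have r o : omap val (obind (fun u => sub_mul x u) o) =
    obind (fun u => psg_mul (val x) u) (omap val o).
  by case: o => //= u; rewrite sub_mulE.
by apply: oinj; rewrite l r !sub_mulE psg_mulA.
Qed.

Definition sub_psg : psemigroup := PSemigroup sub_mulA.

End SubPsemigroup.

Section GraphSemigroup.
Variable E : digraph.
Local Notation V := (vertex E).
Local Notation W := (seq (edge E)).
Implicit Types (u m n k : V) (a b c d w y z r s t : W).

(** The start of [w] when its end is [u]; the end is supplied for the sake of the empty word. *)
Definition first_vertex w u : V := if w is e :: _ then src e else u.

Lemma first_vertex_cat w y u :
  first_vertex (w ++ y) u = first_vertex w (first_vertex y u).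
Proof. by case: w. Qed.

(* For words [b] and [c] ending at [m] and [n]: [meet m n b c = Some (y, z, k)]
   when [b y = c z] is the shortest common extension, which then ends at [k]. *)
Fixpoint meet m n b c : option (W * W * V) :=
  match b, c with
  | [::], _ => if first_vertex c n == m then Some (c, [::], n) else None
  | _, [::] => if first_vertex b m == n then Some ([::], b, m) else None
  | e :: b', f :: c' => if e == f then meet m n b' c' else None
  end.

Definition oword (o : option (W * W * V)) u s t : Prop :=
  if o is Some (y, z, k) then
    exists r, [/\ s = y ++ r, t = z ++ r & first_vertex r u = k]
  else False.

(** The universal property of the shortest common extension. Words are arbitrary here, composability
    being imposed later by [walks], so only the vertices at the cuts have to match. *)
Lemma meetP m n b c u s t :
  oword (meet m n b c) u s t <->
  [/\ b ++ s = c ++ t, first_vertex s u = m & first_vertex t u = n].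
Proof.
elim: b c => [|e b IH] [|f c] /=.
- case: eqP => [->|nm] /=; split=> //.
  + by move=> [r [-> -> ->]].
  + by move=> [-> ? ?]; exists t.
  + by move=> [-> sm tn]; case: nm; rewrite -tn -sm.
- case: eqP => [fm|nm] /=; split=> //.
  + by move=> [r [-> -> <-]].
  + by move=> [-> sm tn]; exists t.
  + by move=> [-> sm _]; case: nm.
- case: eqP => [fm|nm] /=; split=> //.
  + by move=> [r [-> -> <-]].
  + by move=> [<- sm tn]; exists s.
  + by move=> [<- _ tn]; case: nm.
- case: eqP => [<-|nef].
    by rewrite IH; split=> [[-> ? ?]|[[->] ? ?]].
  by split=> // -[[]].
Qed.

(** A triple [(a, b, m)] stands for [a b^*] with both words ending at [m]. If [b y = c z] is the
    shortest common extension, then [a b^*] times [c d^*] is [a y] times the ghost of [d z]. *)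
Definition gs_op (x x' : W * W * V) : option (W * W * V) :=
  if meet x.2 x'.2 x.1.2 x'.1.1 is Some (y, z, k)
  then Some (x.1.1 ++ y, x'.1.2 ++ z, k) else None.

(* The partial injection [b y |-> a y] defined on the words [b y] ending at [u]
   with [y] starting at [m]; these determine [(a, b, m)]. *)
Definition gs_rel (o : option (W * W * V)) u w w' : Prop :=
  oword o u w' w.

Lemma gs_rel_op (x x' : W * W * V) u w w'' :
  gs_rel (gs_op x x') u w w'' <->
  exists2 w', gs_rel (Some x') u w w' & gs_rel (Some x) u w' w''.
Proof.
case: x x' => [[a b] m] [[c d] n]; rewrite /gs_op /=.
have H := @meetP m n b c u; split.
  case e : (meet _ _ _ _) => [[[y z] k]|] //= [r [-> -> rk]].
  have [] := (H (y ++ r) (z ++ r)).1; first by rewrite e; exists r.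
  move=> bc ym zn; exists (c ++ z ++ r); first by exists (z ++ r); rewrite -?catA.
  by exists (y ++ r); rewrite -?catA.
move=> [w' [t [-> -> tn]] [s [-> e sm]]].
have := (H s t).2; case: (meet _ _ _ _) => [[[y z] k]|] /= -[] //.
by move=> r [-> -> rk]; exists r; rewrite -!catA.
Qed.

(** A triple is recovered from its partial injection as the shortest pair, [b] sent to [a]: of two
    triples with the same graph, each extends the other. *)
Lemma gs_rel_inj o o' : (forall u w w', gs_rel o u w w' <-> gs_rel o' u w w') -> o = o'.
Proof.
have self a b m : gs_rel (Some (a, b, m)) m b a by exists [::]; rewrite !cats0.
case: o o' => [[[a b] m]|] [[[a' b'] m']|] // H; last 2 first.
- by case: ((H m b a).1 (self a b m)).
- by case: ((H m' b' a').2 (self a' b' m')).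
have [y [ay by' ym]] := (H m b a).1 (self a b m).
have [y' [ay' by'' ym']] := (H m' b' a').2 (self a' b' m').
have y0 : y = [::].
  apply/size0nil/eqP; have := congr1 size ay; rewrite ay' !size_cat.
  by move=> /eqP; rewrite -[X in X == _]addn0 -addnA eqn_add2l eq_sym addn_eq0 => /andP[].
by move: ay by' ym; rewrite y0 !cats0 /= => -> -> ->.
Qed.

(** Triples act faithfully by partial injections, and composition of relations is associative; this
    replaces a case analysis on nested prefixes. *)
Lemma gs_opA (x y z : W * W * V) :
  obind (fun v => gs_op v z) (gs_op x y) = obind (fun v => gs_op x v) (gs_op y z).
Proof.
have comp o o' u w w'' :
    gs_rel (obind (fun v => obind (gs_op v) o') o) u w w'' <->
    exists2 w', gs_rel o' u w w' & gs_rel o u w' w''.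
  case: o => [x'|] /=; last by split=> [|[]].
  case: o' => [y'|] /=; last by split=> [|[]].
  exact: gs_rel_op.
apply: gs_rel_inj => u w w'.
have -> : obind (fun v => gs_op v z) (gs_op x y) =
    obind (fun v => obind (gs_op v) (Some z)) (gs_op x y) by [].
have -> : obind (fun v => gs_op x v) (gs_op y z) =
    obind (fun v => obind (gs_op v) (gs_op y z)) (Some x) by [].
rewrite !comp; split.
  move=> [w1 zw /gs_rel_op[w2 yw xw]]; exists w2 => //.
  by apply/gs_rel_op; exists w1.
move=> [w2 /gs_rel_op[w1 zw yw] xw]; exists w1 => //.
by apply/gs_rel_op; exists w2.
Qed.

Definition gs_psg : psemigroup := @PSemigroup (W * W * V)%type gs_op gs_opA.

Fixpoint walk w u : bool :=
  if w is e :: w' then (rng e == first_vertex w' u) && walk w' u else true.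

Lemma walk_cat w y u : walk (w ++ y) u = walk w (first_vertex y u) && walk y u.
Proof. by elim: w => //= e w ->; rewrite first_vertex_cat andbA. Qed.

Lemma walk_meet m n b c y z k : walk b m -> walk c n ->
  meet m n b c = Some (y, z, k) -> [&& walk y k, walk z k & (first_vertex y k == m) && (first_vertex z k == n)].
Proof.
elim: b c => [|e b IH] [|f c] //=.
- by move=> _ _; case: eqP => // -> [<- <- <-] /=; rewrite !eqxx.
- by move=> _ wc; case: eqP => // <- [<- <- <-]; rewrite /= wc !eqxx.
- by move=> wb _; case: eqP => // <- [<- <- <-]; rewrite /= wb !eqxx.
- by move=> /andP[_ wb] /andP[_ wc]; case: eqP => // _; apply: IH.
Qed.

Definition walks (x : gs_psg) : bool := walk x.1.1 x.2 && walk x.1.2 x.2.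

Lemma walks_mul (x y z : gs_psg) : walks x -> walks y -> psg_mul x y = Some z -> walks z.
Proof.
case: x y => [[a b] m] [[c d] n] /andP[/= wa wb] /andP[/= wc wd].
rewrite /gs_op /=; case e : (meet _ _ _ _) => [[[s t] k]|] // [<-].
have /and3P[ws wt /andP[/eqP sm /eqP tn]] := walk_meet wb wc e.
by rewrite /walks /= !walk_cat sm tn wa wd ws wt.
Qed.

Definition path_psg : psemigroup := sub_psg walks_mul.

End GraphSemigroup.

(** * Cohn path algebras *)

Section SubElements.
Variables (R : comPzRingType) (G : psemigroup) (P : pred G).
Hypothesis PM : forall x y z, P x -> P y -> psg_mul x y = Some z -> P z.

Definition sub_elt (x : G) : convAlg (sub_psg PM) (ground R) :=
  oapp (fun g : {x | P x} => @basis R (sub_psg PM) g) 0 (insub x).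

Lemma sub_elt_basis (g : sub_psg PM) : @basis R (sub_psg PM) g = sub_elt (val g).
Proof. by rewrite /sub_elt valK. Qed.

Lemma sub_elt_mul x y : P x -> P y -> sub_elt x ** sub_elt y = oapp sub_elt 0 (psg_mul x y).
Proof.
move=> Px Py; have eE u (Pu : P u) : sub_elt u = @basis R (sub_psg PM) (exist _ u Pu).
  by rewrite /sub_elt insubT.
rewrite (eE _ Px) (eE _ Py) basis_mul.
rewrite -[psg_mul x y](sub_mulE PM (exist _ x Px) (exist _ y Py)) /=.
by case: (sub_mul _ _) => [z|] //=; rewrite sub_elt_basis.
Qed.

Section SubLift.
Variables (B : assocAlgType R) (v : G -> B).
Hypothesis vM : forall x y, P x -> P y -> v x ** v y = oapp v 0 (psg_mul x y).

Lemma sub_lift_mul (g h : sub_psg PM) :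
  v (val g) ** v (val h) = oapp (fun k : sub_psg PM => v (val k)) 0 (psg_mul g h).
Proof.
rewrite vM ?(valP g) ?(valP h) // -(sub_mulE PM g h) /=.
by case: (sub_mul _ _).
Qed.

Definition sub_lift : alg_hom (convAlg (sub_psg PM) (ground R)) B :=
  blift_hom sub_lift_mul.

Lemma sub_lift_elt x : P x -> sub_lift (sub_elt x) = v x.
Proof. by move=> Px; rewrite /sub_elt insubT /=; apply: blift_basis. Qed.

End SubLift.
End SubElements.

Section CohnFamilies.
Variables (R : comPzRingType) (E : digraph).

Record cohn_family (B : assocAlgType R) (cv : vertex E -> B)
    (ce cs : edge E -> B) : Prop := CohnFamily {
  cohn_vv : forall v w, cv v ** cv w = if v == w then cv v else 0;
  cohn_se : forall e, cv (src e) ** ce e = ce e;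
  cohn_er : forall e, ce e ** cv (rng e) = ce e;
  cohn_rg : forall e, cv (rng e) ** cs e = cs e;
  cohn_gs : forall e, cs e ** cv (src e) = cs e;
  cohn_ck1 : forall e f, cs e ** ce f = if e == f then cv (rng e) else 0
}.

Section Monomials.
Variables (B : assocAlgType R) (cv : vertex E -> B) (ce cs : edge E -> B).
Local Notation W := (seq (edge E)).

Definition pathl (a : W) (x : B) : B := foldr (fun e y => ce e ** y) x a.
Definition pathr (a : W) (x : B) : B := foldr (fun e y => y ** cs e) x a.

Lemma pathlM a x y : pathl a (x ** y) = pathl a x ** y.
Proof. by elim: a => //= e a ->; rewrite amulA. Qed.

Lemma pathrM a x y : pathr a (x ** y) = x ** pathr a y.
Proof. by elim: a => //= e a ->; rewrite amulA. Qed.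

Lemma pathlr a b x : pathl a (pathr b x) = pathr b (pathl a x).
Proof. by elim: b => //= e b <-; rewrite pathlM. Qed.

Lemma pathl_cat a b x : pathl (a ++ b) x = pathl a (pathl b x).
Proof. by rewrite /pathl foldr_cat. Qed.

Lemma pathr_cat a b x : pathr (a ++ b) x = pathr a (pathr b x).
Proof. by rewrite /pathr foldr_cat. Qed.

Lemma pathl_linear a : linear (pathl a).
Proof.
by elim: a => // e a IH k x y; rewrite -[LHS]/(ce e ** pathl a _) IH amulDr amulZr.
Qed.

Lemma pathr_linear a : linear (pathr a).
Proof.
by elim: a => // e a IH k x y; rewrite -[LHS]/(pathr a _ ** cs e) IH amulDl amulZl.
Qed.

Definition monomial (x : W * W * vertex E) : B := pathl x.1.1 (pathr x.1.2 (cv x.2)).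

Lemma monomial_image (B' : assocAlgType R) (f : alg_hom B B') x :
  f (monomial x) =
  foldr (fun e y => f (ce e) ** y) (foldr (fun e y => y ** f (cs e)) (f (cv x.2)) x.1.2) x.1.1.
Proof.
case: x => [[a b] m]; rewrite /monomial /=.
elim: a => [|e a IH] /=; last by rewrite alg_homM IH.
by elim: b => [|e b IH] //=; rewrite alg_homM IH.
Qed.

Hypothesis fam : cohn_family cv ce cs.

Lemma cohn_vertex_path a n m : walk a n ->
  cv m ** pathl a (cv n) = if first_vertex a n == m then pathl a (cv n) else 0.
Proof.
case: a => [|e a] /= _.
  by rewrite (cohn_vv fam) eq_sym; case: eqP => [->|].
rewrite -[X in X ** pathl _ _](cohn_se fam) -amulA amulA (cohn_vv fam) eq_sym.
by case: eqP => [->|]; rewrite ?amul0l // amulA (cohn_se fam).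
Qed.

Lemma cohn_path_vertex a n m : walk a n ->
  pathr a (cv n) ** cv m = if first_vertex a n == m then pathr a (cv n) else 0.
Proof.
case: a => [|e a] /= _.
  by rewrite (cohn_vv fam).
rewrite -[X in pathr _ _ ** X](cohn_gs fam) -!amulA (cohn_vv fam).
by case: eqP => [->|]; rewrite ?amul0r // (cohn_gs fam).
Qed.

(** The first letters of [b] and [c] face each other in the middle, and cancelling [cs e ** ce f]
    repeats the recursion of [meet]. *)
Lemma cohn_meet m n b c : walk b m -> walk c n ->
  pathr b (cv m) ** pathl c (cv n) =
  if meet m n b c is Some (y, z, k) then pathl y (pathr z (cv k)) else 0.
Proof.
elim: b c => [|e b IH] [|f c].
- by move=> _ wc; rewrite [LHS](cohn_vertex_path _ wc) /=; case: eqP.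
- by move=> _ wc; rewrite [LHS](cohn_vertex_path _ wc) /=; case: eqP.
- by move=> wb _; rewrite [LHS](cohn_path_vertex _ wb) /=; case: eqP => // ->.
- move=> /= /andP[/eqP eb wb] /andP[/eqP fc wc].
  rewrite amulA -(amulA _ (cs e)) (cohn_ck1 fam); case: eqP => [ef|_].
    by rewrite (cohn_path_vertex _ wb) eb eqxx; apply: IH.
  by rewrite amul0r amul0l.
Qed.

Lemma monomial_mul (x y : gs_psg E) : walks x -> walks y ->
  monomial x ** monomial y = oapp monomial 0 (psg_mul x y).
Proof.
case: x y => [[a b] m] [[c d] n] /andP[/= wa wb] /andP[/= wc wd].
rewrite /monomial /= -pathlM pathlr -pathrM cohn_meet // /gs_op /=.
case: (meet _ _ _ _) => [[[y z] k]|] /=.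
  by rewrite pathl_cat pathr_cat (pathlr y d).
by rewrite (lin0 (pathr_linear d)) (lin0 (pathl_linear a)).
Qed.

End Monomials.

(** The monomials [a b^*] form a basis by construction; the presentation is recovered as the
    universal property, [cohn_lift] with [cohn_hom_ext]. *)
Definition cohn : assocAlgType R := convAlg (path_psg E) (ground R).

Definition path_elt (x : gs_psg E) : cohn := sub_elt R (@walks_mul E) x.

Lemma path_elt_basis (g : path_psg E) : @basis R (path_psg E) g = path_elt (val g).
Proof. exact: sub_elt_basis. Qed.

Lemma path_elt_mul (x y : gs_psg E) : walks x -> walks y ->
  path_elt x ** path_elt y = oapp path_elt 0 (psg_mul x y).
Proof. exact: sub_elt_mul. Qed.

Definition cohn_v (v : vertex E) : cohn := path_elt ([::], [::], v).
Definition cohn_e (e : edge E) : cohn := path_elt ([:: e], [::], rng e).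
Definition cohn_s (e : edge E) : cohn := path_elt ([::], [:: e], rng e).

Lemma walks_v v : @walks E ([::], [::], v).
Proof. by []. Qed.

Lemma walks_e e : @walks E ([:: e], [::], rng e).
Proof. by rewrite /walks /= eqxx. Qed.

Lemma walks_s e : @walks E ([::], [:: e], rng e).
Proof. by rewrite /walks /= eqxx. Qed.

Lemma cohn_family_cohn : cohn_family cohn_v cohn_e cohn_s.
Proof.
split=> [v w|e|e|e|e|e f]; rewrite path_elt_mul ?walks_v ?walks_e ?walks_s //=
  /gs_op /= ?eqxx //.
- by rewrite eq_sym; case: eqP => [->|].
- by case: (e =P f) => [->|]; rewrite /= ?eqxx.
Qed.

Lemma monomial_cohn (x : gs_psg E) : walks x ->
  monomial cohn_v cohn_e cohn_s x = path_elt x.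
Proof.
case: x => [[a b] m] /andP[/= wa wb]; rewrite /monomial /=.
elim: a wa => [_|e a IH] /=.
  elim: b wb => [_|e b IH] //= /andP[/eqP re wb].
  have wx : @walks E ([::], b, m) by [].
  rewrite IH // (path_elt_mul wx (walks_s e)) /= /gs_op /=.
  by case: b {IH wb wx} re => [|f b] /= re; rewrite re eqxx.
move=> /andP[/eqP re wa]; have wx : @walks E (a, b, m) by rewrite /walks /= wa.
rewrite IH // (path_elt_mul (walks_e e) wx) /= /gs_op /=.
by rewrite re eqxx /= cats0.
Qed.

Section UniversalProperty.
Variables (B : assocAlgType R) (cv : vertex E -> B) (ce cs : edge E -> B).
Hypothesis fam : cohn_family cv ce cs.

Definition cohn_lift : alg_hom cohn B := sub_lift (@walks_mul E) (monomial_mul fam).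

Lemma cohn_lift_path x : walks x -> cohn_lift (path_elt x) = monomial cv ce cs x.
Proof. exact: sub_lift_elt. Qed.

Lemma cohn_lift_v v : cohn_lift (cohn_v v) = cv v.
Proof. exact: cohn_lift_path. Qed.

Lemma cohn_lift_e e : cohn_lift (cohn_e e) = ce e.
Proof. by rewrite cohn_lift_path ?walks_e // /monomial /= (cohn_er fam). Qed.

Lemma cohn_lift_s e : cohn_lift (cohn_s e) = cs e.
Proof. by rewrite cohn_lift_path ?walks_s // /monomial /= (cohn_rg fam). Qed.

End UniversalProperty.

Lemma cohn_hom_ext (B : assocAlgType R) (f g : alg_hom cohn B) :
  (forall v, f (cohn_v v) = g (cohn_v v)) ->
  (forall e, f (cohn_e e) = g (cohn_e e)) ->
  (forall e, f (cohn_s e) = g (cohn_s e)) -> f = g.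
Proof.
move=> fv fe fs; apply: basis_hom_ext => x.
rewrite path_elt_basis -monomial_cohn; last exact: valP.
rewrite !monomial_image; case: (val x) => [[a b] m] /=.
elim: a => [|e a IH] /=; last by rewrite fe IH.
by elim: b => [|e b IH] /=; [exact: fv|rewrite fs IH].
Qed.

End CohnFamilies.

(** * The kernel of the projection to the Leavitt path algebra *)

Section TensorPsemigroup.
Variables (T : choiceType) (B : psemigroup).

Definition tensor_op (x y : T * T * B) : option (T * T * B) :=
  if x.1.2 == y.1.1 then omap (fun b => (x.1.1, y.1.2, b)) (psg_mul x.2 y.2) else None.

Lemma tensor_opA x y z :
  obind (fun u => tensor_op u z) (tensor_op x y) =
  obind (fun u => tensor_op x u) (tensor_op y z).
Proof.
case: x y z => [[x1 x2] x3] [[y1 y2] y3] [[z1 z2] z3]; rewrite /tensor_op /=.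
have [<-|/eqP/negPf nxy] := x2 =P y1; have [<-|/eqP/negPf nyz] := y2 =P z1.
- have := psg_mulA x3 y3 z3.
  case: (psg_mul x3 y3) => [u|]; case: (psg_mul y3 z3) => [v|] //=; rewrite ?eqxx //.
  + by move=> ->.
  + by move=> ->.
  + by move=> <-.
- by case: (psg_mul x3 y3) => [u|] //=; rewrite nyz.
- by case: (psg_mul y3 z3) => [u|] //=; rewrite nxy.
- by [].
Qed.

(** Its convolution algebra over [ground R] consists of the [T]-indexed matrices over the
    convolution algebra of [B]. *)
Definition tensor_psg : psemigroup := PSemigroup tensor_opA.

End TensorPsemigroup.

Section DiagonalPsemigroup.
Variable V : choiceType.

Definition diag_op (v w : V) : option V := if v == w then Some v else None.

Lemma diag_opA u v w :
  obind (fun x => diag_op x w) (diag_op u v) = obind (fun x => diag_op u x) (diag_op v w).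
Proof.
rewrite /diag_op; case: (u =P v) (v =P w) => [->|/eqP/negPf nuv] [<-|/eqP/negPf nvw] /=.
- by rewrite eqxx.
- by rewrite nvw.
- by rewrite nuv.
- by [].
Qed.

Definition diag_psg : psemigroup := PSemigroup diag_opA.

End DiagonalPsemigroup.

Section BlockPsemigroup.
Variables (T V : choiceType) (ok : T -> V -> bool).

Definition block_mem (x : tensor_psg T (diag_psg V)) : bool :=
  ok x.1.1 x.2 && ok x.1.2 x.2.

Lemma block_mem_mul x y z : block_mem x -> block_mem y -> psg_mul x y = Some z -> block_mem z.
Proof.
case: x y => [[a b] m] [[c d] n]; rewrite /block_mem /= => /andP[xa xb] /andP[yc yd].
rewrite /tensor_op /=; case: (b == c) => //; rewrite /diag_op.
case: ifP => //= /eqP mn [<-] /=.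
by rewrite xa mn.
Qed.

(* The direct sum over [v] of the matrix units indexed by [ok ^~ v]. *)
Definition block_psg : psemigroup := sub_psg block_mem_mul.

End BlockPsemigroup.

Section KernelExtension.
Variables (R : comPzRingType) (E : digraph).
Local Notation W := (seq (edge E)).
Local Notation C := (cohn R E).
Local Notation cv := (@cohn_v R E).
Local Notation ce := (@cohn_e R E).
Local Notation cs := (@cohn_s R E).
Local Notation pathl := (@pathl R E C ce).
Local Notation pathr := (@pathr R E C cs).
Let fam := @cohn_family_cohn R E.

(** [fset_set] lists the edges only when they are finite in number, hence the regularity hypotheses
    below. *)
Definition outs (v : vertex E) : seq (edge E) := fset_set (out_edges v).

Lemma mem_outs v e : regular v -> (e \in outs v) = (src e == v).
Proof.
move=> [fv _]; rewrite /outs in_fset_set //.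
by apply/idP/eqP => [|ev]; rewrite ?in_setE // => /set_mem.
Qed.

Definition gap (v : vertex E) : C := cv v - \sum_(e <- outs v) ce e ** cs e.

(** For an edge [e] out of [v] the summand [e e^* e] equals [v e]; for any other edge both terms
    vanish. *)
Lemma gap_edge v e : regular v -> gap v ** ce e = 0.
Proof.
move=> rv; rewrite /gap amulDl amulNl amul_suml.
under eq_bigr => f _ do rewrite -amulA (cohn_ck1 fam) (fun_if (amul (ce f))) amul0r.
rewrite -big_mkcond /=; rewrite -[X in cv v ** X](cohn_se fam) amulA (cohn_vv fam).
have [ev|nev] := boolP (e \in outs v).
  rewrite -big_filter filter_pred1_uniq ?fset_uniq // big_seq1 (cohn_er fam).
  by move: ev; rewrite mem_outs // eq_sym => /eqP ->; rewrite eqxx (cohn_se fam) subrr.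
rewrite big1_seq ?subr0 => [|f /andP[/eqP ->]]; last by rewrite (negPf nev).
by move: nev; rewrite mem_outs // eq_sym => /negPf ->; rewrite amul0l.
Qed.

Lemma ghost_gap v e : regular v -> cs e ** gap v = 0.
Proof.
move=> rv; rewrite /gap amulDr amulNr amul_sumr.
under eq_bigr => f _ do rewrite amulA (cohn_ck1 fam) (fun_if (amul^~ (cs f))) amul0l.
under eq_bigr => f _ do rewrite eq_sym.
rewrite -big_mkcond /=; rewrite -[X in X ** cv v](cohn_gs fam) -amulA (cohn_vv fam).
have [ev|nev] := boolP (e \in outs v).
  rewrite -big_filter filter_pred1_uniq ?fset_uniq // big_seq1 (cohn_rg fam).
  by move: ev; rewrite mem_outs // => /eqP <-; rewrite eqxx (cohn_gs fam) subrr.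
rewrite big1_seq ?subr0 => [|f /andP[/eqP ->]]; last by rewrite (negPf nev).
by move: nev; rewrite mem_outs // => /negPf ->; rewrite amul0r.
Qed.

Lemma gap_vertex v u : regular v -> gap v ** cv u = if v == u then gap v else 0.
Proof.
move=> rv; rewrite {1}/gap amulDl amulNl amul_suml (cohn_vv fam).
case: eqP => [<-|nvu].
  congr (_ - _); apply: eq_big_seq => e; rewrite mem_outs // => /eqP <-.
  by rewrite -amulA (cohn_gs fam).
rewrite big1_seq ?subr0 // => e /=; rewrite mem_outs // => /eqP ev.
rewrite -amulA -(cohn_gs fam) -amulA (cohn_vv fam) ev.
by move/eqP/negPf: nvu => ->; rewrite !amul0r.
Qed.

Lemma vertex_gap v u : regular v -> cv u ** gap v = if u == v then gap v else 0.
Proof.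
move=> rv; rewrite {1}/gap amulDr amulNr amul_sumr (cohn_vv fam).
case: eqP => [->|nvu].
  congr (_ - _); apply: eq_big_seq => e; rewrite mem_outs // => /eqP <-.
  by rewrite amulA (cohn_se fam).
rewrite big1_seq ?subr0 // => e /=; rewrite mem_outs // => /eqP ev.
rewrite amulA -(cohn_se fam) amulA (cohn_vv fam) ev.
by move/eqP/negPf: nvu => ->; rewrite !amul0l.
Qed.

Lemma gap_gap v w : regular v -> regular w -> gap v ** gap w = if v == w then gap v else 0.
Proof.
move=> rv rw; rewrite {2}/gap amulDr amulNr amul_sumr gap_vertex //.
rewrite big1 ?subr0 // => e _; by rewrite amulA gap_edge ?amul0l.
Qed.

Lemma vertex_path_gap a v u : regular v -> walk a v ->
  cv u ** pathl a (gap v) = if u == first_vertex a v then pathl a (gap v) else 0.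
Proof.
move=> rv; case: a => [|e a] /= _; first exact: vertex_gap.
rewrite -[X in X ** pathl _ _](cohn_se fam) -amulA amulA (cohn_vv fam).
by case: eqP => [->|]; rewrite ?amul0l // amulA (cohn_se fam).
Qed.

Lemma path_gap_vertex a v u : regular v -> walk a v ->
  pathr a (gap v) ** cv u = if first_vertex a v == u then pathr a (gap v) else 0.
Proof.
move=> rv; case: a => [|e a] /= _; first exact: gap_vertex.
rewrite -[X in pathr _ _ ** X](cohn_gs fam) -!amulA (cohn_vv fam).
by case: eqP => _; rewrite ?amul0r // (cohn_gs fam).
Qed.

(** An edge on its right or a ghost edge on its left kills a gap, so only the complete cancellation
    in [b^* c] survives. Hence the elements [a gap b^*] multiply like matrix units. *)
Lemma gap_meet b c v w : regular v -> regular w -> walk b v -> walk c w ->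
  pathr b (gap v) ** pathl c (gap w) = if (b == c) && (v == w) then gap v else 0.
Proof.
move=> rv rw; elim: b c => [|e b IH] [|f c].
- by move=> _ _; apply: gap_gap.
- by move=> _ _ /=; rewrite amulA gap_edge ?amul0l.
- by move=> _ _ /=; rewrite -amulA ghost_gap ?amul0r.
- move=> /= /andP[/eqP eb wb] /andP[/eqP fc wc].
  rewrite amulA -(amulA _ (cs e)) (cohn_ck1 fam) eqseq_cons; case: eqP => [ef|_].
    by rewrite path_gap_vertex // eb eqxx IH.
  by rewrite amul0r amul0l.
Qed.

Definition ker_ok (a : W) (v : vertex E) : bool := walk a v && `[< regular v >].

Definition ker_psg : psemigroup := block_psg ker_ok.
Definition kerAlg : assocAlgType R := convAlg ker_psg (ground R).

Definition gap_mon (x : tensor_psg W (diag_psg (vertex E))) : C :=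
  pathl x.1.1 (pathr x.1.2 (gap x.2)).

Lemma gap_mon_mul x y : block_mem ker_ok x -> block_mem ker_ok y ->
  gap_mon x ** gap_mon y = oapp gap_mon 0 (psg_mul x y).
Proof.
case: x y => [[a b] v] [[c d] w] /andP[/= /andP[wa /asboolP rv] /andP[wb _]].
move=> /andP[/= /andP[wc /asboolP rw] /andP[wd _]].
rewrite /gap_mon /= /tensor_op /= /diag_op -pathlM pathlr -pathrM gap_meet //.
case: (b == c) => /=; last by rewrite (lin0 (pathr_linear _ d)) (lin0 (pathl_linear _ a)).
case: (v == w) => //=; by rewrite (lin0 (pathr_linear _ d)) (lin0 (pathl_linear _ a)).
Qed.

Definition ker_inj : alg_hom kerAlg C := sub_lift (@block_mem_mul _ _ ker_ok) gap_mon_mul.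

Definition ker_elt x : kerAlg := @sub_elt R _ _ (@block_mem_mul _ _ ker_ok) x.

Lemma ker_inj_elt x : block_mem ker_ok x -> ker_inj (ker_elt x) = gap_mon x.
Proof. exact: sub_lift_elt. Qed.

(* For regular [v] the first edge [e] out of [v] is special; the linear retraction
   eliminates [e e^*] by means of [e e^* = v - gap v - (the other f f^* )]. *)
Definition special (e : edge E) : bool :=
  `[< regular (src e) >] && (ohead (outs (src e)) == Some e).

(** The kernel part of [a b^*], on reversed words because the reduction acts on last letters.
    Removing a common special [e] leaves the shorter monomial minus its gap; the other edges out of
    [src e] are not special and contribute nothing. *)
Fixpoint strip (ra rb : W) : kerAlg :=
  match ra, rb with
  | e :: ra', f :: rb' =>
    if (e == f) && special e then strip ra' rb' - ker_elt (rev ra', rev rb', src e)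
    else 0
  | _, _ => 0
  end.

Definition ker_retr : C -> kerAlg :=
  blift (fun g : path_psg E => strip (rev (val g).1.1) (rev (val g).1.2)).

Lemma ker_retr_path x : walks x ->
  ker_retr (path_elt R x) = strip (rev x.1.1) (rev x.1.2).
Proof. by move=> wx; rewrite /path_elt /sub_elt insubT /= /ker_retr blift_basis. Qed.

Lemma gap_monE a b v : walk a v -> walk b v -> regular v ->
  gap_mon (a, b, v) = path_elt R (a, b, v) -
    \sum_(e <- outs v) path_elt R (rcons a e, rcons b e, rng e).
Proof.
move=> wa wb rv; rewrite /gap_mon /gap /=.
rewrite (linB (pathr_linear _ b)) (linB (pathl_linear _ a)); congr (_ - _).
  by rewrite -monomial_cohn // /walks /= wa wb.
rewrite (lin_sum (pathr_linear _ b)) (lin_sum (pathl_linear _ a)).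
apply: eq_big_seq => e; rewrite mem_outs // => /eqP ev.
rewrite -monomial_cohn; last first.
  by rewrite /walks /= -!cats1 !walk_cat /= !eqxx ev wa wb.
rewrite /monomial /= -!cats1 pathl_cat pathr_cat /= (cohn_rg fam).
by rewrite pathrM.
Qed.

Lemma ker_injK : cancel ker_inj ker_retr.
Proof.
have retl := blift_linear (fun g : path_psg E => strip (rev (val g).1.1) (rev (val g).1.2)).
apply: basis_ext => [||x].
- by move=> k u v; rewrite (alg_homL ker_inj) [LHS]retl.
- by [].
rewrite sub_elt_basis -/(ker_elt _) ker_inj_elt; last exact: valP.
case: x => [[[a b] v] /= bx]; have /andP[/= /andP[wa /asboolP rv] /andP[wb _]] := bx.
rewrite gap_monE // [LHS](linB retl) (lin_sum retl) [X in X - _]ker_retr_path; last first.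
  by rewrite /walks /= wa wb.
under eq_big_seq => e.
  rewrite mem_outs // => /eqP ev.
  rewrite -/ker_retr ker_retr_path; last first.
    by rewrite /walks /= -!cats1 !walk_cat /= !eqxx ev wa wb.
  rewrite /= !rev_rcons /= eqxx /= !revK /special ev.
  over.
(* Among the terms of the sum only that of the special edge is nonzero, and its [strip] part cancels
   the leading term. Regularity provides this edge. *)
rewrite /= (asboolT rv) /=; have uo : uniq (outs v) by apply: fset_uniq.
have := mem_outs _ rv; case: (outs v) uo => [_|e0 r /= /andP[e0r _]] mo.
  by have [_ [e ev]] := rv; have := mo e; rewrite in_nil ev eqxx.
rewrite big_cons eqxx big1_seq ?addr0 => [|e /= er]; last first.
  by case: eqP => // -[e0e]; rewrite e0e er in e0r.
by rewrite opprB addrC subrK.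
Qed.

End KernelExtension.

(** * The Cohn extension *)

Section FreeAlgebra.
Variables (R : comPzRingType) (X : choiceType) (B : assocAlgType R) (v : X -> B).

Fixpoint word_mon (x : X) (s : seq X) : B :=
  if s is y :: s' then v x ** word_mon y s' else v x.

Lemma word_mon_cat x s y t : word_mon x (s ++ y :: t) = word_mon x s ** word_mon y t.
Proof. by elim: s x => //= z s IH x; rewrite IH amulA. Qed.

Lemma word_mon_mul (g h : word_psg X) :
  word_mon g.1 g.2 ** word_mon h.1 h.2 =
  oapp (fun k : word_psg X => word_mon k.1 k.2) 0 (psg_mul g h).
Proof. by rewrite /= word_mon_cat. Qed.

Definition free_lift : alg_hom (freeAlg R X) B := blift_hom word_mon_mul.

Lemma free_lift_gen x : free_lift (free_gen R x) = v x.
Proof. exact: blift_basis. Qed.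

End FreeAlgebra.

Lemma free_hom_ext (R : comPzRingType) (X : choiceType) (B : assocAlgType R)
    (f g : alg_hom (freeAlg R X) B) :
  (forall x, f (free_gen R x) = g (free_gen R x)) -> f = g.
Proof.
move=> fg; apply: basis_hom_ext => -[x s]; elim: s x => [|y s IH] x; first exact: fg.
have -> : @basis R (word_psg X) (x, y :: s) =
    free_gen R x ** @basis R (word_psg X) (y, s) by rewrite basis_mul.
by rewrite !alg_homM fg IH.
Qed.

Section QuotientHom.
Variables (R : pzRingType) (A : assocAlgType R) (D : set A).

Lemma quot_pi_linear : linear (@quot_pi R A D).
Proof. by move=> a x y; rewrite quot_piD quot_piZ. Qed.

Lemma quot_pi_mul : {morph @quot_pi R A D : x y / x ** y}.
Proof. exact: quot_piM. Qed.

Definition quot_hom : alg_hom A (quotAlg D) := AlgHom quot_pi_linear quot_pi_mul.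

End QuotientHom.

Section CohnExtension.
Variables (R : comPzRingType) (E : digraph).
Local Notation C := (cohn R E).
Local Notation L := (leavitt R E).
Local Notation cv := (@cohn_v R E).
Local Notation ce := (@cohn_e R E).
Local Notation cs := (@cohn_s R E).
Let fam := @cohn_family_cohn R E.

Lemma cohn_ind (P : C -> Prop) :
  (forall a x y, P x -> P y -> P (a *: x + y)) -> P 0 ->
  (forall x y, P x -> P y -> P (x ** y)) ->
  (forall v, P (cv v)) -> (forall e, P (ce e)) -> (forall e, P (cs e)) ->
  forall x, P x.
Proof.
move=> PL P0 PM Pv Pe Ps; apply: conv_ind => // [x y Px Py|g a].
  by rewrite -[x]scale1r; apply: PL.
rewrite singleE -[_ *: _]addr0; apply: PL => //.
rewrite path_elt_basis -monomial_cohn; last exact: valP.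
case: (val g) => [[b c] m]; rewrite /monomial /=.
elim: b => [|e b IH] /=; last exact: PM.
by elim: c => [|e c IH] //=; apply: PM.
Qed.

Lemma leavitt_relE x y : leavitt_rel x y ->
  quot_hom _ x = quot_hom _ y :> L.
Proof.
move=> xy; apply/quot_piP => I _; apply.
by exists (x, y).
Qed.

Local Notation lv v := (quot_hom _ (gvertex R v) : L).
Local Notation le e := (quot_hom _ (gedge R e) : L).
Local Notation ls e := (quot_hom _ (gghost R e) : L).

Lemma cohn_family_leavitt :
  cohn_family (fun v => lv v) (fun e => le e) (fun e => ls e).
Proof.
split=> [v w|e|e|e|e|e f]; rewrite -alg_homM.
- by rewrite (leavitt_relE (lrel_vv R v w)); case: ifP => //; rewrite linear0.
- exact: leavitt_relE (lrel_se R e).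
- exact: leavitt_relE (lrel_er R e).
- exact: leavitt_relE (lrel_rg R e).
- exact: leavitt_relE (lrel_gs R e).
- by rewrite (leavitt_relE (lrel_ck1 R e f)); case: ifP => //; rewrite linear0.
Qed.

Definition cohn_proj : alg_hom C L := cohn_lift cohn_family_leavitt.

Definition free_to_cohn : alg_hom (freeAlg R (leavitt_gen E)) C :=
  free_lift (fun x : leavitt_gen E => match x with
    | inl v => cv v | inr (inl e) => ce e | inr (inr e) => cs e end).

Lemma free_to_cohn_v v : free_to_cohn (gvertex R v) = cv v.
Proof. exact: free_lift_gen. Qed.
Lemma free_to_cohn_e e : free_to_cohn (gedge R e) = ce e.
Proof. exact: free_lift_gen. Qed.
Lemma free_to_cohn_s e : free_to_cohn (gghost R e) = cs e.
Proof. exact: free_lift_gen. Qed.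

Lemma cohn_proj_free x : cohn_proj (free_to_cohn x) = quot_pi _ x.
Proof.
have -> : cohn_proj (free_to_cohn x) = alg_comp cohn_proj free_to_cohn x by [].
rewrite -[RHS]/(quot_hom _ x); congr (alg_fun _ x).
apply: free_hom_ext => -[v|[e|e]].
- by change (cohn_proj (free_to_cohn (gvertex R v)) = quot_hom _ (gvertex R v));
  rewrite free_to_cohn_v cohn_lift_v.
- by change (cohn_proj (free_to_cohn (gedge R e)) = quot_hom _ (gedge R e));
  rewrite free_to_cohn_e cohn_lift_e.
- by change (cohn_proj (free_to_cohn (gghost R e)) = quot_hom _ (gghost R e));
  rewrite free_to_cohn_s cohn_lift_s.
Qed.

Lemma free_to_cohn_surj x : exists y, free_to_cohn y = x.
Proof.
elim/cohn_ind: x => [a x y [x' <-] [y' <-]||x y [x' <-] [y' <-]|v|e|e].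
- by exists (a *: x' + y'); rewrite (alg_homL free_to_cohn).
- by exists 0; rewrite linear0.
- by exists (x' ** y'); rewrite alg_homM.
- by exists (gvertex R v); rewrite free_to_cohn_v.
- by exists (gedge R e); rewrite free_to_cohn_e.
- by exists (gghost R e); rewrite free_to_cohn_s.
Qed.

Lemma ker_basis_ind (P : kerAlg R E -> Prop) :
  (forall a x y, P x -> P y -> P (a *: x + y)) -> P 0 ->
  (forall a b v, walk a v -> walk b v -> regular v -> P (ker_elt R (a, b, v))) ->
  forall x, P x.
Proof.
move=> PL P0 Pb; apply: conv_ind => // [x y Px Py|g a].
  by rewrite -[x]scale1r; apply: PL.
rewrite singleE -[_ *: _]addr0; apply: PL => //; rewrite sub_elt_basis.
case: g => [[[b c] v] bx] /=; have /andP[/= /andP[wb /asboolP rv] /andP[wc _]] := bx.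
exact: Pb.
Qed.

Lemma block_ok a b (v : vertex E) : walk a v -> walk b v -> regular v ->
  block_mem (@ker_ok E) (a, b, v).
Proof. by move=> wa wb rv; rewrite /block_mem /ker_ok /= wa wb asboolT. Qed.

(** Checked on generators: a vertex keeps [a gap b^*] or kills it, an edge prolongs [a] or kills it,
    a ghost edge removes the first letter of [a] or kills it. *)
Lemma ker_left_ideal (c : C) (k : kerAlg R E) : exists k', c ** ker_inj R E k = ker_inj R E k'.
Proof.
elim/cohn_ind: c k => [a x y Px Py k||x y Px Py k|u k|e k|e k].
- have [k1 e1] := Px k; have [k2 e2] := Py k; exists (a *: k1 + k2).
  by rewrite amulDl amulZl e1 e2 (alg_homL (ker_inj R E)).
- by exists 0; rewrite amul0l linear0.
- by have [k1 e1] := Py k; have [k2 e2] := Px k1; exists k2; rewrite -amulA e1 e2.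
all: elim/ker_basis_ind: k => [a x y [x' Px] [y' Py]||a b v wa wb rv];
  [by exists (a *: x' + y'); rewrite !(alg_homL (ker_inj R E)) amulDr amulZr Px Py
  |by exists 0; rewrite linear0 amul0r|rewrite ker_inj_elt ?block_ok //].
- rewrite /gap_mon /= pathlr -pathrM vertex_path_gap //; case: eqP => _.
    by exists (ker_elt R (a, b, v)); rewrite ker_inj_elt ?block_ok // /gap_mon pathlr.
  by exists 0; rewrite linear0 (lin0 (pathr_linear _ b)).
- have [re|re] := eqVneq (rng e) (first_vertex a v).
    exists (ker_elt R (e :: a, b, v)); rewrite ker_inj_elt ?block_ok //=.
    by rewrite wa re eqxx.
  exists 0; rewrite linear0 /gap_mon /= pathlr -pathrM -(cohn_er fam) -amulA.
  by rewrite vertex_path_gap // (negPf re) amul0r (lin0 (pathr_linear _ b)).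
- rewrite /gap_mon /= pathlr -pathrM; case: a wa => [|f a] /=.
    by exists 0; rewrite linear0 ghost_gap // (lin0 (pathr_linear _ b)).
  move=> /andP[/eqP rf wa]; rewrite amulA (cohn_ck1 fam); case: eqP => [ef|_].
    exists (ker_elt R (a, b, v)); rewrite ker_inj_elt ?block_ok // /gap_mon /= pathlr.
    by rewrite vertex_path_gap // ef rf eqxx.
  by exists 0; rewrite linear0 amul0l (lin0 (pathr_linear _ b)).
Qed.

Lemma ker_right_ideal (c : C) (k : kerAlg R E) : exists k', ker_inj R E k ** c = ker_inj R E k'.
Proof.
elim/cohn_ind: c k => [a x y Px Py k||x y Px Py k|u k|e k|e k].
- have [k1 e1] := Px k; have [k2 e2] := Py k; exists (a *: k1 + k2).
  by rewrite amulDr amulZr e1 e2 (alg_homL (ker_inj R E)).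
- by exists 0; rewrite amul0r linear0.
- by have [k1 e1] := Px k; have [k2 e2] := Py k1; exists k2; rewrite amulA e1 e2.
all: elim/ker_basis_ind: k => [a x y [x' Px] [y' Py]||a b v wa wb rv];
  [by exists (a *: x' + y'); rewrite !(alg_homL (ker_inj R E)) amulDl amulZl Px Py
  |by exists 0; rewrite linear0 amul0l|rewrite ker_inj_elt ?block_ok //].
- rewrite /gap_mon /= -pathlM path_gap_vertex //; case: eqP => _.
    by exists (ker_elt R (a, b, v)); rewrite ker_inj_elt ?block_ok.
  by exists 0; rewrite linear0 (lin0 (pathl_linear _ a)).
- rewrite /gap_mon /= -pathlM; case: b wb => [|f b] /=.
    by exists 0; rewrite linear0 gap_edge // (lin0 (pathl_linear _ a)).
  move=> /andP[/eqP rf wb]; rewrite -amulA (cohn_ck1 fam); case: eqP => [ef|_].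
    exists (ker_elt R (a, b, v)); rewrite ker_inj_elt ?block_ok // /gap_mon /=.
    by rewrite path_gap_vertex // rf eqxx.
  by exists 0; rewrite linear0 amul0r (lin0 (pathl_linear _ a)).
- have [re|re] := eqVneq (rng e) (first_vertex b v).
    exists (ker_elt R (a, e :: b, v)); rewrite ker_inj_elt ?block_ok //=.
      by rewrite /gap_mon /= pathlM.
    by rewrite wb re eqxx.
  exists 0; rewrite linear0 /gap_mon /= -pathlM -(cohn_rg fam) amulA.
  by rewrite path_gap_vertex // eq_sym (negPf re) amul0l (lin0 (pathl_linear _ a)).
Qed.

Lemma free_relation_ker (x y : freeAlg R (leavitt_gen E)) : leavitt_rel x y ->
  exists k, free_to_cohn (x - y) = ker_inj R E k.
Proof.
move=> xy; rewrite (linB (alg_homL free_to_cohn)).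
case: xy => [v w|e|e|e|e|e f|v rv]; rewrite ?alg_homM; last first.
  exists (ker_elt R ([::], [::], v)); rewrite ker_inj_elt ?block_ok // /gap_mon /= /gap.
  rewrite free_to_cohn_v fsbig_finite ?rv.1 //=; last by case: rv.
  rewrite (lin_sum (alg_homL free_to_cohn)); congr (_ - _); apply: eq_bigr => e _.
  by rewrite alg_homM free_to_cohn_e free_to_cohn_s.
all: exists 0; rewrite linear0 ?(fun_if free_to_cohn) ?linear0
  !(free_to_cohn_v, free_to_cohn_e, free_to_cohn_s).
- by rewrite (cohn_ck1 fam) subrr.
- by rewrite (cohn_gs fam) subrr.
- by rewrite (cohn_rg fam) subrr.
- by rewrite (cohn_er fam) subrr.
- by rewrite (cohn_se fam) subrr.
- by rewrite (cohn_vv fam) subrr.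
Qed.

Lemma cohn_proj_gap v : regular v -> cohn_proj (gap R v) = 0.
Proof.
move=> rv; have := leavitt_relE (lrel_ck2 R rv).
rewrite fsbig_finite //=; last by case: rv.
rewrite (lin_sum (alg_homL (quot_hom _))) => e2.
rewrite /gap (linB (alg_homL cohn_proj)) (lin_sum (alg_homL cohn_proj)) cohn_lift_v.
rewrite [X in X - _]e2; apply/eqP; rewrite subr_eq0; apply/eqP.
apply: eq_bigr => e _.
by rewrite alg_homM [RHS]alg_homM cohn_lift_e cohn_lift_s.
Qed.

(** Elements of the free algebra whose image lies in the range of [ker_inj] form a two-sided ideal
    containing the relations, hence the whole ideal they generate. *)
Lemma cohn_exact (y : C) : cohn_proj y = 0 <-> exists x, ker_inj R E x = y.
Proof.
split=> [|[x <-]]; last first.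
  elim/ker_basis_ind: x => [a k k' Px Py||a b v wa wb rv].
  - by rewrite (alg_homL (ker_inj R E)) (alg_homL cohn_proj) Px Py scaler0 addr0.
  - by rewrite !linear0.
  rewrite ker_inj_elt ?block_ok // /gap_mon /=.
  elim: a {wa} => [|e a IH] /=; last by rewrite alg_homM IH amul0r.
  elim: b {wb} => [|e b IH] /=; last by rewrite alg_homM IH amul0l.
  exact: cohn_proj_gap.
have [x <-] := free_to_cohn_surj y; rewrite cohn_proj_free.
rewrite -(lin0 (quot_pi_linear _)) => /quot_piP; rewrite subr0 => xI.
pose I : set (freeAlg R (leavitt_gen E)) := [set z | exists k, ker_inj R E k = free_to_cohn z].
apply: (xI I) => [|_ [p rp ->]]; last first.
  by have [k ek] := free_relation_ker rp; exists k; rewrite ek.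
split=> [|a z w [k1 e1] [k2 e2]|z w [k ek]|z w [k ek]].
- by exists 0; rewrite !linear0.
- by exists (a *: k1 + k2); rewrite (alg_homL (ker_inj R E)) (alg_homL free_to_cohn) e1 e2.
- have [k' ek'] := ker_left_ideal (free_to_cohn z) k.
  by exists k'; rewrite alg_homM -ek ek'.
- have [k' ek'] := ker_right_ideal (free_to_cohn w) k.
  by exists k'; rewrite alg_homM -ek ek'.
Qed.

(** Subtracting the kernel part makes [t] vanish on the range of [ker_inj]. So [t (r l)] is linear
    in [l], although [r] is a mere choice of lifts. *)
Lemma cohn_split : exists2 s : L -> C, linear s & cancel s cohn_proj.
Proof.
pose t (x : C) := x - ker_inj R E (ker_retr x).
have retl : linear (@ker_retr R E) by exact: blift_linear.
have tl : linear t.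
  move=> a x y; rewrite /t retl (alg_homL (ker_inj R E)) opprD addrACA.
  by rewrite scalerBr.
have tk k : t (ker_inj R E k) = 0 by rewrite /t ker_injK subrr.
have kp x : cohn_proj (ker_inj R E x) = 0 by apply/cohn_exact; exists x.
have tp x y : cohn_proj x = cohn_proj y -> t x = t y.
  move=> xy; have [k kxy] : exists k, ker_inj R E k = x - y.
    by apply/cohn_exact; rewrite (linB (alg_homL cohn_proj)) xy subrr.
  by apply/eqP; rewrite -subr_eq0 -(linB tl) -kxy tk.
pose r (l : L) := free_to_cohn (quot_repr l).
have pr l : cohn_proj (r l) = l by rewrite cohn_proj_free quot_piK.
exists (fun l => t (r l)) => [a x y|l].
  by rewrite -tl; apply: tp; rewrite (alg_homL cohn_proj) !pr.
by rewrite /t (linB (alg_homL cohn_proj)) kp subr0 pr.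
Qed.

Definition cohn_extension : @extension R (kerAlg R E) C L :=
  Extension (can_inj (@ker_injK R E)) cohn_exact cohn_split.

End CohnExtension.

(** * Semidirect products *)

Section SemidirectPsemigroup.
Variables (G B : psemigroup) (T : choiceType).
Variables (la ra : G -> T -> option T).
Hypothesis laP : forall g s t, la g s = Some t <-> ra g t = Some s.
Hypothesis laM : forall g h t,
  obind (fun k => la k t) (psg_mul g h) = obind (la g) (la h t).

Lemma option_eqP (S : Type) (o o' : option S) :
  (forall s, o = Some s <-> o' = Some s) -> o = o'.
Proof.
move=> oo'; case e : o => [s|]; first by apply/esym/oo'.
by case e' : o' => [s|] //; have := (oo' s).2 e'; rewrite e.
Qed.

Lemma raM g h t : obind (fun k => ra k t) (psg_mul g h) = obind (ra h) (ra g t).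
Proof.
apply: option_eqP => s; have := laM g h s.
have obindP (o : option T) f r : obind f o = Some r <-> exists2 u, o = Some u & f u = Some r.
  by case: o => [u|] /=; split=> [e|]; [exists u|case=> _ [<-]| |case].
case: (psg_mul g h) => [k|] /= e; rewrite obindP.
  by rewrite -laP e obindP; split=> -[u /laP hu /laP gu]; exists u.
split=> // -[u gu hu]; suff : obind (la g) (la h s) = Some t by rewrite -e.
by apply/obindP; exists u; apply/laP.
Qed.

(** [G] acts on [T] by partial injections [la g] with converses [ra g], and is joined to the matrix
    units with coefficients in [B], which it multiplies from both sides. Its algebra becomes a split
    quotient with the matrices as kernel. *)
Definition sd_op (x y : G + tensor_psg T B) : option (G + tensor_psg T B) :=
  match x, y with
  | inl g, inl h => omap inl (psg_mul g h)
  | inl g, inr p => omap (fun s => inr (s, p.1.2, p.2)) (la g p.1.1)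
  | inr p, inl g => omap (fun t => inr (p.1.1, t, p.2)) (ra g p.1.2)
  | inr p, inr q => omap inr (tensor_op p q)
  end.

(** An element of [G] between two matrix units is the case where [ra g] must be the converse of
    [la g]. *)
Lemma sd_opA x y z :
  obind (fun u => sd_op u z) (sd_op x y) = obind (fun u => sd_op x u) (sd_op y z).
Proof.
case: x y z => [g|[[s t] b]] [h|[[s' t'] b']] [k|[[s'' t''] b'']] /=.
- have := psg_mulA g h k.
  by case: (psg_mul g h) => [u|]; case: (psg_mul h k) => [v|] //= => e; first [by rewrite e | by rewrite -e].
- have := laM g h s''.
  by case: (psg_mul g h) => [u|] /=; case: (la h s'') => [v|] //= => e; first [by rewrite e | by rewrite -e].
- by case e : (la g s') => [u|] /=; case: (ra k t') => [v|] //=; rewrite e.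
- rewrite /tensor_op /=; case e : (la g s') => [u|]; rewrite /= /tensor_op /=;
  by case: (t' == s'') => //=; case: (psg_mul b' b'') => //= c; rewrite e.
- have := raM h k t.
  by case: (psg_mul h k) => [u|] /=; case: (ra h t) => [v|] //= => e; first [by rewrite e | by rewrite -e].
- have := laP h s'' t; rewrite /tensor_op.
  case: (ra h t) => [u|]; case: (la h s'') => [v|] //= H; rewrite /tensor_op /=.
  + case: (t =P v) => [tv|ntv]; case: (u =P s'') => [us|nus] //.
    * by case: nus; have [] := H.1 (congr1 Some (esym tv)).
    * by case: ntv; have [] := H.2 (congr1 Some us).
  + by case: eqP => // us; have := H.2 (congr1 Some us).
  + by case: eqP => // tv; have := H.1 (congr1 Some (esym tv)).
- rewrite /tensor_op /=; case e : (ra k t') => [u|]; rewrite /= /tensor_op /=;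
  by case: (t == s') => //=; case: (psg_mul b b') => //= c; rewrite e.
- have := tensor_opA (s, t, b) (s', t', b') (s'', t'', b'').
  by case: (tensor_op (s, t, b) _) => [u|]; case: (tensor_op (s', t', b') _) => [v|] //= => e; first [by rewrite e | by rewrite -e].
Qed.

Definition sd_psg : psemigroup := PSemigroup sd_opA.

Variable R : comPzRingType.
Local Notation CG := (convAlg G (ground R)).
Local Notation CB := (convAlg B (ground R)).
Local Notation CN := (convAlg (tensor_psg T B) (ground R)).
Local Notation CS := (convAlg sd_psg (ground R)).

Lemma sd_inj_mul (p q : tensor_psg T B) :
  @basis R sd_psg (inr p) ** @basis R sd_psg (inr q) =
  oapp (fun r => @basis R sd_psg (inr r)) 0 (psg_mul p q).
Proof. by rewrite basis_mul /=; case: (tensor_op p q). Qed.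

Definition sd_inj : alg_hom CN CS := blift_hom sd_inj_mul.

Lemma sd_sec_mul (g h : G) :
  @basis R sd_psg (inl g) ** @basis R sd_psg (inl h) =
  oapp (fun r => @basis R sd_psg (inl r)) 0 (psg_mul g h).
Proof. by rewrite basis_mul /=; case: (psg_mul g h). Qed.

Definition sd_sec : alg_hom CG CS := blift_hom sd_sec_mul.

Definition sd_proj_fun (x : sd_psg) : CG := if x is inl g then basis R g else 0.

Lemma sd_proj_mul x y :
  sd_proj_fun x ** sd_proj_fun y = oapp sd_proj_fun 0 (psg_mul x y).
Proof.
case: x y => [g|p] [h|q] /=; rewrite ?amul0l ?amul0r ?basis_mul.
- by case: (psg_mul g h).
- by case: (la _ _).
- by case: (ra _ _).
- by case: (tensor_op _ _).
Qed.

Definition sd_proj : alg_hom CS CG := blift_hom sd_proj_mul.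

Lemma sd_projK x : sd_proj (sd_sec x) = x.
Proof.
have -> : sd_proj (sd_sec x) = alg_comp sd_proj sd_sec x by [].
rewrite -[RHS]/(alg_id CG x); congr (alg_fun _ x); apply: basis_hom_ext => g.
change (sd_proj (sd_sec (basis R g)) = basis R g).
by rewrite [sd_sec _]blift_basis [LHS]blift_basis.
Qed.

Definition sd_retr : CS -> CN := blift (fun x : sd_psg => if x is inr p then basis R p else 0).

Lemma sd_injK : cancel sd_inj sd_retr.
Proof.
apply: basis_ext => [||p].
- by move=> a x y; rewrite (alg_homL sd_inj) [LHS]blift_linear.
- by [].
by rewrite [sd_inj _]blift_basis [LHS]blift_basis.
Qed.

Lemma sd_decomp x : x = sd_sec (sd_proj x) + sd_inj (sd_retr x).
Proof.
apply: (@basis_ext R sd_psg CS id (fun x => sd_sec (sd_proj x) + sd_inj (sd_retr x))).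
- by [].
- move=> a u v; rewrite (alg_homL sd_proj) (alg_homL sd_sec).
  rewrite [sd_retr _](blift_linear _) (alg_homL sd_inj).
  by rewrite scalerDr addrACA.
move=> [g|p]; rewrite [sd_proj _]blift_basis [sd_retr _]blift_basis.
  by rewrite [sd_sec _]blift_basis linear0 addr0.
by rewrite [sd_inj _]blift_basis linear0 add0r.
Qed.

Lemma sd_exact y : sd_proj y = 0 <-> exists x, sd_inj x = y.
Proof.
split=> [y0|[x <-]].
  by exists (sd_retr y); rewrite [RHS]sd_decomp y0 linear0 add0r.
have -> : sd_proj (sd_inj x) = alg_comp sd_proj sd_inj x by [].
rewrite -[RHS]/(zero_hom CN CG x); congr (alg_fun _ x); apply: basis_hom_ext => p.
change (sd_proj (sd_inj (basis R p)) = 0).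
by rewrite [sd_inj _]blift_basis [LHS]blift_basis.
Qed.

Definition sd_extension : @extension R CN CS CG.
Proof.
refine (@Extension R CN CS CG sd_inj sd_proj (can_inj sd_injK) sd_exact _).
by exists sd_sec; [exact: alg_homL|exact: sd_projK].
Defined.

Definition unit_elt (s t : T) : CB -> CN := blift (fun b => @basis R (tensor_psg T B) (s, t, b)).

Lemma unit_elt_linear s t : linear (unit_elt s t).
Proof. exact: blift_linear. Qed.

Lemma unit_elt_mul s t s' t' x y :
  unit_elt s t x ** unit_elt s' t' y = if t == s' then unit_elt s t' (x ** y) else 0.
Proof.
elim/conv_ind: x => [|x x' ex ex'|b a].
- by rewrite (lin0 (unit_elt_linear _ _)) !amul0l (lin0 (unit_elt_linear _ _)) if_same.
- rewrite (linD (unit_elt_linear _ _)) !amulDl ex ex' (linD (unit_elt_linear _ _)).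
  by case: ifP; rewrite ?addr0.
elim/conv_ind: y => [|y y' ey ey'|b' a'].
- by rewrite (lin0 (unit_elt_linear _ _)) !amul0r (lin0 (unit_elt_linear _ _)) if_same.
- rewrite (linD (unit_elt_linear _ _)) !amulDr ey ey' (linD (unit_elt_linear _ _)).
  by case: ifP; rewrite ?addr0.
rewrite !singleE amulZl amulZr !(linZ (unit_elt_linear _ _)) amulZl amulZr.
rewrite basis_mul [unit_elt s t _]blift_basis [unit_elt s' t' _]blift_basis basis_mul.
rewrite /= /tensor_op /=; case: (t == s') => /=; last by rewrite !scaler0.
case: (psg_mul b b') => [c|] /=; last by rewrite (lin0 (unit_elt_linear _ _)).
by rewrite [unit_elt s t' _]blift_basis.
Qed.

Definition corner_elt (s t : T) (x : CB) : CS := sd_inj (unit_elt s t x).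

Lemma corner_elt_linear s t : linear (corner_elt s t).
Proof. by move=> a x y; rewrite /corner_elt unit_elt_linear (alg_homL sd_inj). Qed.

Lemma corner_elt_mul s t s' t' x y :
  corner_elt s t x ** corner_elt s' t' y = if t == s' then corner_elt s t' (x ** y) else 0.
Proof.
by rewrite /corner_elt -alg_homM unit_elt_mul; case: ifP => //; rewrite linear0.
Qed.

Lemma sec_corner g s t x :
  sd_sec (basis R g) ** corner_elt s t x = oapp (fun s' => corner_elt s' t x) 0 (la g s).
Proof.
elim/conv_ind: x => [|x x' ex ex'|b a].
- rewrite (lin0 (corner_elt_linear _ _)) amul0r.
  by case: (la g s) => //= s'; rewrite (lin0 (corner_elt_linear _ _)).
- rewrite (linD (corner_elt_linear _ _)) amulDr ex ex'.
  by case: (la g s) => //= [s'|]; rewrite ?(linD (corner_elt_linear _ _)) ?addr0.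
have cb s1 t1 : corner_elt s1 t1 (basis R b) = @basis R sd_psg (inr (s1, t1, b)).
  by rewrite /corner_elt [unit_elt _ _ _]blift_basis [LHS]blift_basis.
rewrite singleE (linZ (corner_elt_linear _ _)) amulZr cb [sd_sec _]blift_basis basis_mul /=.
case: (la g s) => [s'|] /=; last by rewrite scaler0.
by rewrite (linZ (corner_elt_linear _ _)) cb.
Qed.

Lemma corner_sec g s t x :
  corner_elt s t x ** sd_sec (basis R g) = oapp (fun t' => corner_elt s t' x) 0 (ra g t).
Proof.
elim/conv_ind: x => [|x x' ex ex'|b a].
- rewrite (lin0 (corner_elt_linear _ _)) amul0l.
  by case: (ra g t) => //= t'; rewrite (lin0 (corner_elt_linear _ _)).
- rewrite (linD (corner_elt_linear _ _)) amulDl ex ex'.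
  by case: (ra g t) => //= [s'|]; rewrite ?(linD (corner_elt_linear _ _)) ?addr0.
have cb s1 t1 : corner_elt s1 t1 (basis R b) = @basis R sd_psg (inr (s1, t1, b)).
  by rewrite /corner_elt [unit_elt _ _ _]blift_basis [LHS]blift_basis.
rewrite singleE (linZ (corner_elt_linear _ _)) amulZl cb [sd_sec _]blift_basis basis_mul /=.
case: (ra g t) => [s'|] /=; last by rewrite scaler0.
by rewrite (linZ (corner_elt_linear _ _)) cb.
Qed.

Lemma sec_corner0 s t x : (forall g, la g s = None) -> forall y, sd_sec y ** corner_elt s t x = 0.
Proof.
move=> ls; apply: conv_ind => [|y y' ey ey'|g a].
- by rewrite linear0 amul0l.
- by rewrite (linD (alg_homL sd_sec)) amulDl ey ey' addr0.
by rewrite singleE (linZ (alg_homL sd_sec)) amulZl sec_corner ls scaler0.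
Qed.

Lemma corner_sec0 s t x : (forall g, ra g t = None) -> forall y, corner_elt s t x ** sd_sec y = 0.
Proof.
move=> ls; apply: conv_ind => [|y y' ey ey'|g a].
- by rewrite linear0 amul0r.
- by rewrite (linD (alg_homL sd_sec)) amulDr ey ey' addr0.
by rewrite singleE (linZ (alg_homL sd_sec)) amulZr corner_sec ls scaler0.
Qed.

End SemidirectPsemigroup.

(** * Rotation of Cohn families *)

Section PathAction.
Variable E : digraph.
Local Notation W := (seq (edge E)).

Definition path_act (x : W * W * vertex E) (u : vertex E) (w : W) : option W :=
  if (take (size x.1.2) w == x.1.2) && (first_vertex (drop (size x.1.2) w) u == x.2)
  then Some (x.1.1 ++ drop (size x.1.2) w) else None.

Lemma path_actP x u w w' : path_act x u w = Some w' <-> gs_rel (Some x) u w w'.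
Proof.
case: x => [[a b] m]; rewrite /path_act /=; split.
  case: ifP => // /andP[/eqP tb /eqP dm] [<-].
  by exists (drop (size b) w); split=> //; rewrite -[LHS](cat_take_drop (size b)) tb.
by move=> [y [-> -> ym]]; rewrite take_size_cat // drop_size_cat // ym !eqxx.
Qed.

(* Index set of the nontrivial words, the last letter split off, and one point
   [None] for the empty word, which nothing acts on. *)
Definition idx : choiceType := option (W * edge E).

(** The last letter [e] is out of reach, so a ghost edge annihilates a one-letter word: this is the
    action on all words, compressed to the nonempty ones. *)
Definition idx_act (x : W * W * vertex E) (t : idx) : option idx :=
  if t is Some (w, e) then omap (fun w' => Some (w', e)) (path_act x (src e) w) else None.

Definition path_la (g : path_psg E) (t : idx) : option idx := idx_act (val g) t.
Definition path_ra (g : path_psg E) (t : idx) : option idx :=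
  idx_act ((val g).1.2, (val g).1.1, (val g).2) t.

Lemma path_laP g s t : path_la g s = Some t <-> path_ra g t = Some s.
Proof.
rewrite /path_la /path_ra; case: (val g) => [[a b] m] /=.
have sym c d w w' u : path_act (c, d, m) u w = Some w' -> path_act (d, c, m) u w' = Some w.
  by move=> /path_actP[y [-> -> ym]]; apply/path_actP; exists y.
case: s t => [[w e]|] [[w' f]|] //=; split; try by case: path_act.
  by case h : path_act => [w''|] //= [<- <-]; rewrite (sym _ _ _ _ _ h).
by case h : path_act => [w''|] //= [<- <-]; rewrite (sym _ _ _ _ _ h).
Qed.

Lemma path_laM g h t :
  obind (fun k => path_la k t) (psg_mul g h) = obind (path_la g) (path_la h t).
Proof.
have -> : obind (fun k => path_la k t) (psg_mul g h) =
    obind (fun k => idx_act k t) (gs_op (val g) (val h)).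
  by rewrite -[gs_op _ _](sub_mulE (@walks_mul E) g h) /=; case: (sub_mul _ _).
rewrite /path_la; case: t => [[w e]|] /=; last by case: (gs_op _ _).
have key w' : (exists2 v, path_act (val h) (src e) w = Some v & path_act (val g) (src e) v = Some w')
    <-> exists2 k, gs_op (val g) (val h) = Some k & path_act k (src e) w = Some w'.
  have := gs_rel_op (val g) (val h) (src e) w w'.
  case o : (gs_op _ _) => [k|] H; split.
  - move=> [v /path_actP hv /path_actP gv]; exists k => //.
    by apply/path_actP/H; exists v.
  - move=> [_ [<-] /path_actP/H[v hv gv]]; exists v; exact/path_actP.
  - by move=> [v /path_actP hv /path_actP gv]; case: H.2; exists v.
  - by move=> [].
apply: option_eqP => s; split.
  case o : (gs_op _ _) => [k|] //=; case a : (path_act _ _ _) => [w'|] //= [<-].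
  have [|v hv gv] := (key w').2; first by exists k.
  by rewrite hv /= gv.
case hv : (path_act _ _ _) => [v|] //=; case gv : (path_act _ _ _) => [w'|] //= [<-].
have [|k ek ak] := (key w').1; first by exists v.
by rewrite ek /= ak.
Qed.

End PathAction.

Section CohnSplitting.
Variables (R : comPzRingType) (E : digraph).
Local Notation C := (cohn R E).
Local Notation cv := (@cohn_v R E).
Local Notation ce := (@cohn_e R E).
Local Notation cs := (@cohn_s R E).
Let fam := @cohn_family_cohn R E.

Section Families.
Variables (D : assocAlgType R) (sg : alg_hom C D) (q : vertex E -> D).

Record q_cond : Prop := QCond {
  qq : forall u v, q u ** q v = if u == v then q u else 0;
  sq : forall x v, sg x ** q v = 0;
  qs : forall x v, q v ** sg x = 0
}.

(** Each condition is linear in [z] or in [zs], so it persists along linear homotopies. The product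
    [zs e ** z f], which is bilinear, is treated separately. *)
Record side_cond (z zs : edge E -> D) : Prop := SideCond {
  side_se : forall e, (sg (cv (src e)) + q (src e)) ** z e = z e;
  side_er0 : forall e x, z e ** sg x = 0;
  side_er : forall e, z e ** q (rng e) = z e;
  side_s0 : forall e f, sg (cs e) ** z f = 0;
  side_rg0 : forall e x, sg x ** zs e = 0;
  side_rg : forall e, q (rng e) ** zs e = zs e;
  side_gs : forall e, zs e ** (sg (cv (src e)) + q (src e)) = zs e;
  side_0e : forall e f, zs e ** sg (ce f) = 0
}.

Lemma cohn_family_add z zs : q_cond -> side_cond z zs ->
  (forall e f, zs e ** z f = if e == f then q (rng e) else 0) ->
  cohn_family (fun v => sg (cv v) + q v) (fun e => sg (ce e) + z e)
    (fun e => sg (cs e) + zs e).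
Proof.
move=> Q S zz; split=> [v w|e|e|e|e|e f].
- rewrite amulDl !amulDr (sq Q) (qs Q) addr0 add0r -alg_homM (cohn_vv fam) (qq Q).
  by case: ifP => _; rewrite ?linear0 ?addr0.
- by rewrite amulDr (side_se S) amulDl (qs Q) addr0 -alg_homM (cohn_se fam).
- rewrite amulDl !amulDr (sq Q) (side_er0 S) addr0 add0r (side_er S).
  by rewrite -alg_homM (cohn_er fam).
- rewrite amulDl !amulDr (qs Q) (side_rg0 S) addr0 add0r (side_rg S).
  by rewrite -alg_homM (cohn_rg fam).
- by rewrite amulDl (side_gs S) amulDr (sq Q) addr0 -alg_homM (cohn_gs fam).
- rewrite amulDl !amulDr (side_s0 S) (side_0e S) addr0 add0r zz -alg_homM (cohn_ck1 fam).
  by case: ifP => _; rewrite ?linear0 ?addr0.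
Qed.

End Families.

(** On generators the homotopy adds [t y] and [t ys]; on longer monomials its degree grows, so it is
    built from the universal property over [polyAlg D]. The three product hypotheses are the
    coefficients of 1, [t] and [t^2] in the relation [cohn_ck1]. *)
Lemma fmap_family_homotopy (T : triangulated) (X : functor (Alg R) T)
    (hX : homotopy_invariant X) (D : assocAlgType R) (sg : alg_hom C D)
    (q : vertex E -> D) (z zs y ys : edge E -> D) (f g : alg_hom C D) :
  q_cond sg q -> side_cond sg q z zs -> side_cond sg q y ys ->
  (forall e f, zs e ** z f = if e == f then q (rng e) else 0) ->
  (forall e f, zs e ** y f + ys e ** z f = 0) ->
  (forall e f, ys e ** y f = 0) ->
  (forall v, f (cv v) = sg (cv v) + q v) ->
  (forall e, f (ce e) = sg (ce e) + z e) ->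
  (forall e, f (cs e) = sg (cs e) + zs e) ->
  (forall v, g (cv v) = sg (cv v) + q v) ->
  (forall e, g (ce e) = sg (ce e) + z e + y e) ->
  (forall e, g (cs e) = sg (cs e) + zs e + ys e) ->
  fmap X (f : mor (C : Alg R) D) = fmap X (g : mor (C : Alg R) D).
Proof.
move=> Q Sz Sy zz zy yy fv fe fs gv ge gs.
pose m n (x : D) : polyAlg D := @single R nat_psg D n x.
have mM n k x w : m n x ** m k w = m (n + k)%N (x ** w) by rewrite /m single_mul.
have mD n x w : m n (x + w) = m n x + m n w by apply: singleD.
have m0 n : m n 0 = 0 by apply: single0.
pose sg' := alg_comp (poly_incl D) sg.
have sgE x : sg' x = m 0%N (sg x) by [].
pose z' e := m 0%N (z e) + m 1%N (y e).
pose zs' e := m 0%N (zs e) + m 1%N (ys e).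
have Q' : q_cond sg' (fun v => m 0%N (q v)).
  split=> [u v|x v|x v]; rewrite ?sgE mM ?(qq Q) ?(sq Q) ?(qs Q) ?m0 //.
  by case: ifP.
have S' : side_cond sg' (fun v => m 0%N (q v)) z' zs'.
  split=> [e|e x|e|e h|e x|e|e|e h]; rewrite /z' /zs' ?sgE.
  - by rewrite -mD amulDr !mM (side_se Sz) (side_se Sy).
  - by rewrite amulDl !mM (side_er0 Sz) (side_er0 Sy) !m0 addr0.
  - by rewrite amulDl !mM (side_er Sz) (side_er Sy).
  - by rewrite amulDr !mM (side_s0 Sz) (side_s0 Sy) !m0 addr0.
  - by rewrite amulDr !mM (side_rg0 Sz) (side_rg0 Sy) !m0 addr0.
  - by rewrite amulDr !mM (side_rg Sz) (side_rg Sy).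
  - by rewrite -mD amulDl !mM (side_gs Sz) (side_gs Sy).
  - by rewrite amulDl !mM (side_0e Sz) (side_0e Sy) !m0 addr0.
have zz' e h : zs' e ** z' h = if e == h then m 0%N (q (rng e)) else 0.
  rewrite /zs' /z' amulDl !amulDr !mM zz yy m0 addr0 -addrA -mD zy m0 addr0.
  by case: ifP => _; rewrite ?m0.
pose F := cohn_lift (cohn_family_add Q' S' zz').
have e0m n x : ev0_hom D (m n x) = if n == 0%N then x else 0.
  by rewrite [LHS]clift_single // => k a u v; case: ifP; rewrite ?scaler0 ?addr0.
have e1m n x : ev1_hom D (m n x) = x by rewrite [LHS]clift_single.
have -> : f = alg_comp (ev0_hom D) F.
  apply: cohn_hom_ext => v; rewrite ?fv ?fe ?fs -[RHS]/(ev0_hom D (F _)).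
  - by rewrite cohn_lift_v (linD (alg_homL (ev0_hom D))) sgE !e0m.
  - by rewrite cohn_lift_e !(linD (alg_homL (ev0_hom D))) sgE !e0m addr0.
  - by rewrite cohn_lift_s !(linD (alg_homL (ev0_hom D))) sgE !e0m addr0.
have -> : g = alg_comp (ev1_hom D) F.
  apply: cohn_hom_ext => v; rewrite ?gv ?ge ?gs -[RHS]/(ev1_hom D (F _)).
  - by rewrite cohn_lift_v (linD (alg_homL (ev1_hom D))) sgE !e1m.
  - by rewrite cohn_lift_e !(linD (alg_homL (ev1_hom D))) sgE !e1m addrA.
  - by rewrite cohn_lift_s !(linD (alg_homL (ev1_hom D))) sgE !e1m addrA.
exact: fmap_ev.
Qed.

End CohnSplitting.

Section CornerFamilies.
Variables (R : comPzRingType) (E : digraph) (B : psemigroup).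
Local Notation C := (cohn R E).
Local Notation cv := (@cohn_v R E).
Local Notation ce := (@cohn_e R E).
Local Notation cs := (@cohn_s R E).
Local Notation CB := (convAlg B (ground R)).
Local Notation N := (convAlg (tensor_psg (idx E) B) (ground R)).

Definition path_sd : psemigroup := @sd_psg (path_psg E) B (idx E) _ _ (@path_laP E) (@path_laM E).
Definition path_sdAlg : assocAlgType R := convAlg path_sd (ground R).
Definition path_sec : alg_hom C path_sdAlg := @sd_sec _ B _ _ _ (@path_laP E) (@path_laM E) R.
Definition path_inj : alg_hom N path_sdAlg := @sd_inj _ B _ _ _ (@path_laP E) (@path_laM E) R.
Definition path_ext : @extension R N path_sdAlg C := @sd_extension _ B _ _ _ (@path_laP E) (@path_laM E) R.
Definition path_corner : idx E -> idx E -> CB -> path_sdAlg :=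
  @corner_elt _ B _ _ _ (@path_laP E) (@path_laM E) R.

Lemma path_corner_mul s t s' t' x y :
  path_corner s t x ** path_corner s' t' y = if t == s' then path_corner s t' (x ** y) else 0.
Proof. exact: corner_elt_mul. Qed.

Lemma path_corner_linear s t : linear (path_corner s t).
Proof. exact: corner_elt_linear. Qed.

Lemma path_sec_corner g s t x : walks g ->
  path_sec (path_elt R g) ** path_corner s t x =
  oapp (fun s' => path_corner s' t x) 0 (idx_act g s).
Proof.
move=> wg; rewrite /path_elt /sub_elt insubT /=.
exact: (@sec_corner _ B _ _ _ (@path_laP E) (@path_laM E) R (exist _ g wg)).
Qed.

Lemma path_corner_sec g s t x : walks g ->
  path_corner s t x ** path_sec (path_elt R g) =
  oapp (fun t' => path_corner s t' x) 0 (idx_act (g.1.2, g.1.1, g.2) t).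
Proof.
move=> wg; rewrite /path_elt /sub_elt insubT /=.
exact: (@corner_sec _ B _ _ _ (@path_laP E) (@path_laM E) R (exist _ g wg)).
Qed.

Lemma sec_corner_none t x y : path_sec y ** path_corner None t x = 0.
Proof. exact: sec_corner0. Qed.

Lemma corner_sec_none s x y : path_corner s None x ** path_sec y = 0.
Proof. exact: corner_sec0. Qed.

Variable kv : vertex E -> CB.
Hypothesis kvM : forall u v, kv u ** kv v = if u == v then kv u else 0.

Definition cq v := path_corner None None (kv v).
(** Sends the empty word, on which [path_sec] is zero, to the word [e]; adding it to [path_sec]
    completes the compressed action to the one on all words. The coefficient [kv] remembers the
    vertex of the empty word. *)
Definition cp e := path_corner (Some ([::], e)) None (kv (rng e)).
Definition cps e := path_corner None (Some ([::], e)) (kv (rng e)).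

Lemma q_cond_corner : q_cond path_sec cq.
Proof.
split=> [u v|x v|x v].
- rewrite path_corner_mul eqxx kvM; case: ifP => // _.
  exact: (lin0 (path_corner_linear _ _)).
- exact: sec_corner_none.
- exact: corner_sec_none.
Qed.

Lemma side_cond_p : side_cond path_sec cq cp cps.
Proof.
split=> [e|e x|e|e f|e x|e|e|e f].
- rewrite amulDl path_sec_corner // path_corner_mul addr0 /=.
  by rewrite /path_act /= eqxx.
- exact: corner_sec_none.
- by rewrite path_corner_mul eqxx kvM eqxx.
- by rewrite path_sec_corner ?walks_s.
- exact: sec_corner_none.
- by rewrite path_corner_mul eqxx kvM eqxx.
- rewrite amulDr path_corner_sec // path_corner_mul addr0 /=.
  by rewrite /path_act /= eqxx.
- by rewrite path_corner_sec ?walks_e.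
Qed.

Lemma cps_cp e f : cps e ** cp f = if e == f then cq (rng e) else 0.
Proof.
rewrite path_corner_mul kvM; have [->|nef] := eqVneq e f; first by rewrite !eqxx.
by case: eqP => // -[ef]; rewrite ef eqxx in nef.
Qed.

Definition psi_p : alg_hom C path_sdAlg :=
  cohn_lift (cohn_family_add q_cond_corner side_cond_p cps_cp).

End CornerFamilies.

Section Rotation.
Variables (R : comPzRingType) (E : digraph).
Local Notation C := (cohn R E).
Local Notation cv := (@cohn_v R E).
Local Notation ce := (@cohn_e R E).
Local Notation cs := (@cohn_s R E).
Let fam := @cohn_family_cohn R E.
Local Notation Q := (@path_sdAlg R E (path_psg E)).
Local Notation sg := (@path_sec R E (path_psg E)).
Local Notation q := (@cq R E (path_psg E) cv).
Local Notation p := (@cp R E (path_psg E) cv).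
Local Notation ps := (@cps R E (path_psg E) cv).
Local Notation corner := (@path_corner R E (path_psg E)).

Definition ct (e : edge E) : Q := corner None None (ce e).
Definition cts (e : edge E) : Q := corner None None (cs e).

Let Qc := @q_cond_corner R E (path_psg E) cv (cohn_vv fam).
Let Pc := @side_cond_p R E (path_psg E) cv (cohn_vv fam).

Lemma side_cond_t : side_cond sg q ct cts.
Proof.
split=> [e|e x|e|e f|e x|e|e|e f].
- by rewrite amulDl sec_corner_none path_corner_mul eqxx (cohn_se fam) add0r.
- exact: corner_sec_none.
- by rewrite path_corner_mul eqxx (cohn_er fam).
- exact: sec_corner_none.
- exact: sec_corner_none.
- by rewrite path_corner_mul eqxx (cohn_rg fam).
- by rewrite amulDr corner_sec_none path_corner_mul eqxx (cohn_gs fam) add0r.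
- exact: corner_sec_none.
Qed.

Lemma cts_ct e f : cts e ** ct f = if e == f then q (rng e) else 0.
Proof.
rewrite path_corner_mul eqxx (cohn_ck1 fam); case: ifP => // _.
exact: (lin0 (path_corner_linear _ _)).
Qed.

Lemma cps_ct e f : ps e ** ct f = 0.
Proof. exact: path_corner_mul. Qed.

Lemma cts_cp e f : cts e ** p f = 0.
Proof. exact: path_corner_mul. Qed.

Definition zc (a b : R) e := a *: p e + b *: ct e.
Definition zsc (a b : R) e := a *: ps e + b *: cts e.

Lemma side_cond_comb a b c d : side_cond sg q (zc a b) (zsc c d).
Proof.
have [p1 p2 p3 p4 p5 p6 p7 p8] := Pc; have [t1 t2 t3 t4 t5 t6 t7 t8] := side_cond_t.
split=> *; rewrite /zc /zsc ?(amulDr _ (_ *: _)) ?(amulDl (_ *: _)) ?amulZl ?amulZr.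
- by rewrite p1 t1.
- by rewrite p2 t2 !scaler0 addr0.
- by rewrite p3 t3.
- by rewrite p4 t4 !scaler0 addr0.
- by rewrite p5 t5 !scaler0 addr0.
- by rewrite p6 t6.
- by rewrite p7 t7.
- by rewrite p8 t8 !scaler0 addr0.
Qed.

(** The families [p] and [ct] are orthonormal with respect to their ghosts, so coefficients pair by
    the scalar product. *)
Lemma zsc_zc a b c d e f :
  zsc c d e ** zc a b f = (c * a + d * b) *: (if e == f then q (rng e) else 0).
Proof.
rewrite amulDl !amulDr !amulZl !amulZr cps_ct cts_cp cts_ct (cps_cp (cohn_vv fam)).
by rewrite !scaler0 addr0 add0r !scalerA scalerDl.
Qed.

Definition is_psi a b c d (f : alg_hom C Q) : Prop :=
  [/\ forall v, f (cv v) = sg (cv v) + q v,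
      forall e, f (ce e) = sg (ce e) + zc a b e
    & forall e, f (cs e) = sg (cs e) + zsc c d e].

Lemma ex_psi a b c d : c * a + d * b = 1 -> exists f, is_psi a b c d f.
Proof.
move=> abcd; have zz e f : zsc c d e ** zc a b f = if e == f then q (rng e) else 0.
  by rewrite zsc_zc abcd scale1r.
exists (cohn_lift (cohn_family_add Qc (side_cond_comb a b c d) zz)).
by split=> [v|e|e]; [rewrite cohn_lift_v|rewrite cohn_lift_e|rewrite cohn_lift_s].
Qed.

(** The three numerical hypotheses say that the scalar product of edge and ghost coefficients stays
    1 along the segment. *)
Lemma fmap_psi_step (T : triangulated) (X : functor (Alg R) T)
    (hX : homotopy_invariant X) a b c d a' b' c' d' f g :
  is_psi a b c d f -> is_psi a' b' c' d' g -> c * a + d * b = 1 ->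
  c * (a' - a) + d * (b' - b) + ((c' - c) * a + (d' - d) * b) = 0 ->
  (c' - c) * (a' - a) + (d' - d) * (b' - b) = 0 ->
  fmap X (f : mor (C : Alg R) Q) = fmap X (g : mor (C : Alg R) Q).
Proof.
move=> [fv fe fs] [gv ge gs] h1 h2 h3.
apply: (fmap_family_homotopy hX (sg := sg) (q := q) (z := zc a b) (zs := zsc c d)
  (y := zc (a' - a) (b' - b)) (ys := zsc (c' - c) (d' - d))) => //.
- exact: side_cond_comb.
- exact: side_cond_comb.
- by move=> e e'; rewrite zsc_zc h1 scale1r.
- by move=> e e'; rewrite !zsc_zc -scalerDl h2 scale0r.
- by move=> e e'; rewrite !zsc_zc h3 scale0r.
- move=> e; rewrite ge -addrA; congr (_ + _); rewrite /zc addrACA -!scalerDl.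
  by rewrite ![_ + (_ - _)]addrC !subrK.
- move=> e; rewrite gs -addrA; congr (_ + _); rewrite /zsc addrACA -!scalerDl.
  by rewrite ![_ + (_ - _)]addrC !subrK.
Qed.

Lemma fmap_psi_rotate (T : triangulated) (X : functor (Alg R) T)
    (hX : homotopy_invariant X) f g :
  is_psi 1 0 1 0 f -> is_psi 0 1 0 1 g ->
  fmap X (f : mor (C : Alg R) Q) = fmap X (g : mor (C : Alg R) Q).
Proof.
move=> pf pg.
(* Each of the three moves changes only the edge or only the ghost coefficients, which makes the
   quadratic term zero. *)
have [|f1 pf1] := @ex_psi 1 1 1 0; first by rewrite !mulr1 addr0.
have [|f2 pf2] := @ex_psi 1 1 0 1; first by rewrite !mulr1 add0r.
have e := (subrr, subr0, mulr0, mul0r, mulr1, mul1r, addr0, add0r, addNr).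
rewrite (fmap_psi_step hX pf pf1); try by rewrite !e.
rewrite (fmap_psi_step hX pf1 pf2); try by rewrite !e.
by rewrite (fmap_psi_step hX pf2 pg); rewrite ?e.
Qed.

End Rotation.

(** * Factorization of the corner embedding of the Cohn algebra *)

Section CohnRetract.
Variables (R : comPzRingType) (E : digraph).
Local Notation C := (cohn R E).
Local Notation cv := (@cohn_v R E).
Local Notation ce := (@cohn_e R E).
Local Notation cs := (@cohn_s R E).
Let fam := @cohn_family_cohn R E.
Local Notation V := (diag_psg (vertex E)).
Local Notation T0 := (@path_sdAlg R E V).
Local Notation Q := (@path_sdAlg R E (path_psg E)).

Definition vertexAlg : assocAlgType R := convAlg (tensor_psg (idx E) V) (ground R).
Definition mxcohnAlg : assocAlgType R := convAlg (tensor_psg (idx E) (path_psg E)) (ground R).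

Local Notation unit0 := (@unit_elt (path_psg E) (idx E) R).

Lemma vertex_to_mxcohn_mul (x y : tensor_psg (idx E) V) :
  unit0 x.1.1 x.1.2 (cv x.2) ** unit0 y.1.1 y.1.2 (cv y.2) =
  oapp (fun z : tensor_psg (idx E) V => unit0 z.1.1 z.1.2 (cv z.2)) 0 (psg_mul x y).
Proof.
rewrite unit_elt_mul (cohn_vv fam) /= /tensor_op; case: (x.1.2 == y.1.1) => //=.
rewrite /diag_op; case: ifP => //= _.
exact: (lin0 (unit_elt_linear _ _)).
Qed.

Definition vertex_to_mxcohn : alg_hom vertexAlg mxcohnAlg := blift_hom vertex_to_mxcohn_mul.

Lemma iota_mul : {morph (unit0 None None : C -> mxcohnAlg) : x y / x ** y}.
Proof. by move=> x y; rewrite unit_elt_mul eqxx. Qed.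

Definition iota_hom : alg_hom C mxcohnAlg :=
  AlgHom (@unit_elt_linear (path_psg E) (idx E) R None None) iota_mul.

Definition sd_map_fun (x : path_sd E V) : Q :=
  match x with
  | inl g => path_sec R E (path_psg E) (@basis R (path_psg E) g)
  | inr y => path_corner y.1.1 y.1.2 (cv y.2)
  end.

Lemma sd_map_mul x y : sd_map_fun x ** sd_map_fun y = oapp sd_map_fun 0 (psg_mul x y).
Proof.
case: x y => [g|[[s t] v]] [h|[[s' t'] w]] /=.
- rewrite -alg_homM basis_mul /=; case: (sub_mul g h) => //=; exact: linear0.
- by rewrite [LHS]sec_corner; case: (path_la _ _).
- by rewrite [LHS]corner_sec; case: (path_ra _ _).
- rewrite path_corner_mul (cohn_vv fam) /tensor_op /=; case: (t == s') => //=.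
  rewrite /diag_op; case: ifP => //= _; exact: (lin0 (path_corner_linear _ _)).
Qed.

Definition sd_map : alg_hom T0 Q := blift_hom sd_map_mul.

Lemma sd_map_sec x : sd_map (path_sec R E V x) = path_sec R E (path_psg E) x.
Proof.
have -> : sd_map (path_sec R E V x) = alg_comp sd_map (path_sec R E V) x by [].
congr (alg_fun _ x); apply: basis_hom_ext => g.
change (sd_map (path_sec R E V (basis R g)) = path_sec R E (path_psg E) (basis R g)).
by rewrite [path_sec R E V _]blift_basis [LHS]blift_basis.
Qed.

Lemma sd_map_inj x : sd_map (path_inj R E V x) = path_inj R E (path_psg E) (vertex_to_mxcohn x).
Proof.
have -> : sd_map (path_inj R E V x) = alg_comp sd_map (path_inj R E V) x by [].
rewrite -[RHS]/(alg_comp (path_inj R E (path_psg E)) vertex_to_mxcohn x); congr (alg_fun _ x).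
apply: basis_hom_ext => p.
change (sd_map (path_inj R E V (basis R p)) = path_inj R E (path_psg E) (vertex_to_mxcohn (basis R p))).
by rewrite [path_inj R E V _]blift_basis [LHS]blift_basis [vertex_to_mxcohn _]blift_basis.
Qed.

Lemma sd_map_corner s t v :
  sd_map (path_corner s t (@basis R V v)) = path_corner s t (cv v).
Proof.
rewrite [LHS](sd_map_inj (@unit_elt V (idx E) R s t (@basis R V v))).
by rewrite [unit_elt _ _ (basis R v)]blift_basis [vertex_to_mxcohn _]blift_basis.
Qed.

Lemma basis_vM (u v : V) :
  @basis R V u ** @basis R V v = if u == v then @basis R V u else 0.
Proof. by rewrite basis_mul /= /diag_op; case: ifP. Qed.

(** [k] is the difference between the actions on all words and on nonempty words, with vertex
    coefficients at the empty word. With coefficients in the Cohn algebra, the action on all words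
    rotates to the sum of the other one and [iota_hom], so the difference becomes [iota_hom]. *)
Lemma cohn_factor (T : triangulated) (X : functor (Alg R) T) (dX : excision X)
    (hX : homotopy_invariant X) :
  exists k : mor (X C) (X vertexAlg),
    fmap X (vertex_to_mxcohn : mor (vertexAlg : Alg R) mxcohnAlg) ∘ k =
    fmap X (iota_hom : mor (C : Alg R) mxcohnAlg).
Proof.
pose i0 := psi_p basis_vM.
have i0p x : ext_proj (path_ext R E V) (i0 x) = x.
  have -> : ext_proj (path_ext R E V) (i0 x) = alg_comp (ext_proj (path_ext R E V)) i0 x by [].
  rewrite -[RHS]/(alg_id C x); congr (alg_fun _ x).
  have pk y : ext_proj (path_ext R E V) (path_sec R E V y) = y by apply: sd_projK.
  have pi y : ext_proj (path_ext R E V) (path_inj R E V y) = 0.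
    by apply/(ext_exact (path_ext R E V)); exists y.
  apply: cohn_hom_ext => v; rewrite -[LHS]/(ext_proj (path_ext R E V) (i0 _));
    [rewrite cohn_lift_v|rewrite cohn_lift_e|rewrite cohn_lift_s];
    by rewrite (linD (alg_homL (ext_proj (path_ext R E V)))) pk pi addr0.
have [k ek] := split_ext_difference dX (e := path_ext R E V) (s := path_sec R E V)
  (@sd_projK _ _ _ _ _ _ _ R) i0p.
exists k; apply: (split_ext_monic dX (e := path_ext R E (path_psg E))
  (s := path_sec R E (path_psg E)) (@sd_projK _ _ _ _ _ _ _ R)).
pose jQ : alg_hom mxcohnAlg Q := path_inj R E (path_psg E).
pose jT : alg_hom vertexAlg T0 := path_inj R E V.
have psiM : {morph (fun x => path_sec R E (path_psg E) x + jQ (iota_hom x)) : x y / x ** y}.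
  move=> x y; rewrite amulDl !amulDr !alg_homM.
  by rewrite [path_sec _ _ _ _ ** jQ _]sec_corner_none [jQ _ ** path_sec _ _ _ _]corner_sec_none addr0 add0r.
have psiL : linear (fun x => path_sec R E (path_psg E) x + jQ (iota_hom x)).
  move=> a x y; rewrite (alg_homL (path_sec _ _ _)) (alg_homL iota_hom) (alg_homL jQ).
  by rewrite scalerDr addrACA.
pose psi' := AlgHom psiL psiM.
have psi'E : fmap X (psi' : mor (C : Alg R) Q) =
    fmap X (path_sec R E (path_psg E) : mor (C : Alg R) Q) +
    fmap X (alg_comp jQ iota_hom : mor (C : Alg R) Q).
  apply: (fmap_orthogonal_sum dX) => [x y|x y|x]; last by [].
    exact: sec_corner_none.
  exact: corner_sec_none.
pose psi0 := alg_comp sd_map i0.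
(* The edge part of [psi0] is [cp], that is (1,0), and the edge part of [psi'] is [ct], that is
   (0,1). *)
have rot : fmap X (psi0 : mor (C : Alg R) Q) = fmap X (psi' : mor (C : Alg R) Q).
  apply: (fmap_psi_rotate hX); split=> v.
  - rewrite -[LHS]/(sd_map (i0 _)) cohn_lift_v (linD (alg_homL sd_map)).
    by rewrite sd_map_sec sd_map_corner.
  - rewrite -[LHS]/(sd_map (i0 _)) cohn_lift_e (linD (alg_homL sd_map)).
    by rewrite sd_map_sec sd_map_corner /zc scale1r scale0r addr0.
  - rewrite -[LHS]/(sd_map (i0 _)) cohn_lift_s (linD (alg_homL sd_map)).
    by rewrite sd_map_sec sd_map_corner /zsc scale1r scale0r addr0.
  - by [].
  - by rewrite /zc scale1r scale0r add0r.
  - by rewrite /zsc scale1r scale0r add0r.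
rewrite -[ext_inj _]/jQ compmA -fmap_alg_comp.
have -> : alg_comp jQ vertex_to_mxcohn = alg_comp sd_map jT.
  by apply: alg_hom_eq => x; rewrite -[RHS]/(sd_map (path_inj R E V x)) sd_map_inj.
rewrite fmap_alg_comp -compmA [X in _ ∘ X]ek compBr -!fmap_alg_comp.
have -> : alg_comp sd_map (path_sec R E V) = path_sec R E (path_psg E).
  by apply: alg_hom_eq => x; apply: sd_map_sec.
by rewrite [X in X - _]rot psi'E addrC addKr.
Qed.

End CohnRetract.

(** * Matrix stability *)

Lemma basis_bilinear (R : comPzRingType) (G : psemigroup) (B : assocAlgType R)
    (f g h : convAlg G (ground R) -> B) :
  linear f -> linear g -> linear h ->
  (forall x y, f (basis R x) ** g (basis R y) = h (basis R x ** basis R y)) ->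
  forall x y, f x ** g y = h (x ** y).
Proof.
move=> fl gl hl H x y; elim/conv_ind: x => [|x x' ex ex'|b a].
- by rewrite amul0l (lin0 fl) (lin0 hl) amul0l.
- by rewrite amulDl (linD fl) (linD hl) amulDl ex ex'.
elim/conv_ind: y => [|y y' ey ey'|b' a'].
- by rewrite amul0r (lin0 gl) (lin0 hl) amul0r.
- by rewrite amulDr (linD gl) (linD hl) amulDr ey ey'.
by rewrite !singleE amulZl amulZr (linZ fl) (linZ gl) amulZl amulZr H !(linZ hl).
Qed.

Section MatrixStability.
Variables (R : comPzRingType) (T : triangulated) (X : functor (Alg R) T).
Variables (dX : excision X) (hX : homotopy_invariant X).
Variables (S : choiceType) (sX : matrix_stable S X).
Local Notation Xm f := (fmap X (f : mor (_ : Alg R) (_ : Alg R))).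

Section CohnRetraction.
Variables (E : digraph) (f : idx E -> S) (f_inj : injective f).
Local Notation C := (cohn R E).

Definition mxcohn_val (x : tensor_psg (idx E) (path_psg E)) : mxAlg S C :=
  @single R (mx_psg S) C (f x.1.1, f x.1.2) (@basis R (path_psg E) x.2).

Lemma mxcohn_val_mul x y :
  mxcohn_val x ** mxcohn_val y = oapp mxcohn_val 0 (psg_mul x y).
Proof.
rewrite /mxcohn_val single_mul basis_mul /= /mx_op /tensor_op /= (inj_eq f_inj).
case: (x.1.2 == y.1.1) => //=; case: (sub_mul _ _) => //=; exact: single0.
Qed.

(** Extending matrices along [f] turns [iota_hom] into a corner embedding over [S], which stability
    inverts. *)
Lemma cohn_retract : exists (k : mor (X C) (X (vertexAlg R E)))
  (l : mor (X (vertexAlg R E)) (X C)), l ∘ k = idm (X C).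
Proof.
have [k ek] := cohn_factor E dX hX.
pose m : alg_hom (mxcohnAlg R E) (mxAlg S C) := blift_hom mxcohn_val_mul.
have mi : alg_comp m (iota_hom R E) = mx_incl C (f None).
  apply: basis_hom_ext => g.
  by rewrite -[LHS]/(m (unit_elt None None (basis R g))) [unit_elt _ _ _]blift_basis [LHS]blift_basis.
have [u [ui iu]] := sX C (f None).
exists k, (u ∘ Xm m ∘ Xm (vertex_to_mxcohn R E)).
by rewrite -!compmA ek -[X in u ∘ X]fmap_alg_comp mi.
Qed.

End CohnRetraction.

Section BlockAlgebra.
Variables (I V : choiceType) (ok : I -> V -> bool).
Variables (f : I -> S) (f_inj : injective f) (s0 : S) (fs0 : forall t, f t != s0).
Variables (t0 : I) (r : seq V) (r_uniq : uniq r).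
Hypothesis okr : forall t v, ok t v -> v \in r.
Hypothesis rok : forall v, v \in r -> ok t0 v.
Local Notation N := (convAlg (block_psg ok) (ground R)).
Local Notation elt := (@sub_elt R _ _ (@block_mem_mul _ _ ok)).
Local Notation bm := (@block_mem _ _ ok).

Lemma elt_mul t u v t' u' v' : ok t v -> ok u v -> ok t' v' -> ok u' v' ->
  elt (t, u, v) ** elt (t', u', v') =
  if (u == t') && (v == v') then elt (t, u', v) else 0.
Proof.
move=> ? ? ? ?; rewrite sub_elt_mul /block_mem /=; try exact/andP.
by rewrite /tensor_op /=; case: (u == t') => //=; rewrite /diag_op; case: (v == v').
Qed.

Definition trunc_val (s : seq V) (x : tensor_psg I (diag_psg V)) : N :=
  if x.2 \in s then elt x else 0.

Lemma trunc_mul s x y : bm x -> bm y ->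
  trunc_val s x ** trunc_val s y = oapp (trunc_val s) 0 (psg_mul x y).
Proof.
case: x y => [[t u] v] [[t' u'] v'] /andP[/= a b] /andP[/= c d].
have -> : oapp (trunc_val s) 0 (@psg_mul (tensor_psg I (diag_psg V)) (t, u, v) (t', u', v')) =
    if (u == t') && (v == v') then trunc_val s (t, u', v) else 0.
  by rewrite /= /tensor_op /=; case: (u == t') => //=; rewrite /diag_op; case: (v == v').
rewrite /trunc_val /=; case: (boolP (v \in s)) => vs; last by rewrite amul0l if_same.
case: (boolP (v' \in s)) => vs'; first exact: elt_mul.
by rewrite amul0r andbC; case: eqP => // vv; rewrite -vv vs in vs'.
Qed.

Definition trunc s : alg_hom N N := sub_lift (@block_mem_mul _ _ ok) (trunc_mul s).

Lemma trunc_elt s x : bm x -> trunc s (elt x) = if x.2 \in s then elt x else 0.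
Proof. exact: sub_lift_elt. Qed.

Lemma block_basis (x : block_psg ok) : @basis R (block_psg ok) x = elt (val x).
Proof. exact: sub_elt_basis. Qed.

Lemma trunc_id : trunc r = alg_id N.
Proof.
apply: basis_hom_ext => x; rewrite -[RHS]/(basis R x) block_basis trunc_elt; last exact: valP.
by case: x => [[[t u] v] /= /andP[/= /okr ->]].
Qed.

Lemma fmap_trunc_cons v s : v \notin s ->
  Xm (trunc (v :: s)) = Xm (trunc [:: v]) + Xm (trunc s).
Proof.
move=> vs; have orth s1 s2 : (forall w, w \in s1 -> w \in s2 -> false) ->
    forall x y, trunc s1 x ** trunc s2 y = 0.
  move=> s12; apply: (basis_bilinear (h := fun=> 0)); try exact: alg_homL.
    by move=> a x y; rewrite scaler0 addr0.
  move=> x y; rewrite !block_basis !trunc_elt; try exact: valP.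
  case: ifP => xs; last by rewrite amul0l.
  case: ifP => ys; last by rewrite amul0r.
  case: x y xs ys => [[[t u] w] /= /andP[/= a b]] [[[t' u'] w'] /= /andP[/= c d]] ws ws'.
  by rewrite elt_mul // andbC; case: eqP => // ww; have := s12 _ ws; rewrite ww ws' => /(_ isT).
apply: (fmap_orthogonal_sum dX).
- by apply: orth => w; rewrite inE => /eqP ->; rewrite (negPf vs).
- by apply: orth => w ws; rewrite inE => /eqP wv; rewrite -wv ws in vs.
apply: basis_ext => [||x]; first exact: alg_homL.
  by move=> a x y; rewrite !(alg_homL (trunc _)) scalerDr addrACA.
rewrite block_basis !trunc_elt ?(valP x) // !inE.
by case: eqP => [->|_] /=; rewrite ?(negPf vs) ?addr0 ?add0r.
Qed.

Lemma trunc_sum s : uniq s -> Xm (trunc s) = \sum_(v <- s) Xm (trunc [:: v]).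
Proof.
elim: s => [_|v s IH /= /andP[vs us]]; last by rewrite big_cons fmap_trunc_cons // IH.
rewrite big_nil -(fmap_zero dX N N); congr fmap.
apply: basis_hom_ext => x; rewrite block_basis trunc_elt //; exact: valP.
Qed.

Section Factor.
Variables (v : V) (vr : v \in r).

(** The pairs [(pos i t, lab i t)] embed [I] twice into the product of [S] and [I], as [(f t, t0)]
    and as [(s0, t)]. The images are disjoint because [s0] is not a value of [f], and this yields
    the matrix units required by [fmap_corners]. *)
Definition pos (i : bool) (t : I) : S := if i then s0 else f t.
Definition lab (i : bool) (t : I) : I := if i then t else t0.

Definition corner_val (i j : bool) (x : tensor_psg I (diag_psg V)) : mxAlg S N :=
  if x.2 == v then @single R (mx_psg S) N (pos i x.1.1, pos j x.1.2)
    (elt (lab i x.1.1, lab j x.1.2, v)) else 0.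

Definition corner_map (i j : bool) : N -> mxAlg S N :=
  blift (fun x : block_psg ok => corner_val i j (val x)).

Lemma corner_map_linear i j : linear (corner_map i j).
Proof. exact: blift_linear. Qed.

Lemma pos_lab i j t u : (pos i t == pos j u) && (lab i t == lab j u) = (i == j) && (t == u).
Proof.
case: i j => [] [] /=; rewrite ?eqxx //.
- by rewrite eq_sym (negPf (fs0 u)).
- by rewrite (negPf (fs0 t)).
- by rewrite (inj_eq f_inj) andbT.
Qed.

Lemma lab_ok i t : ok t v -> ok (lab i t) v.
Proof. by case: i => //= _; apply: rok. Qed.

Lemma corner_val_mul i j k l x y : bm x -> bm y ->
  corner_val i j x ** corner_val k l y =
  if j == k then oapp (corner_val i l) 0 (psg_mul x y) else 0.
Proof.
case: x y => [[t u] w] [[t' u'] w'] /andP[/= a b] /andP[/= c d].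
have -> : oapp (corner_val i l) 0 (@psg_mul (tensor_psg I (diag_psg V)) (t, u, w) (t', u', w')) =
    if (u == t') && (w == w') then corner_val i l (t, u', w) else 0.
  by rewrite /= /tensor_op /=; case: (u == t') => //=; rewrite /diag_op; case: (w == w').
rewrite /corner_val /=; case: eqP => [wv|nwv]; last by rewrite amul0l !if_same.
case: eqP => [wv'|nwv']; last first.
  have [vw|/negPf nvw] := eqVneq (v : V) w'; first by case: nwv'.
  by rewrite amul0r wv nvw andbF if_same.
move: a b c d; rewrite wv wv' eqxx andbT => a b c d.
rewrite single_mul elt_mul ?lab_ok // eqxx andbT /= /mx_op /=.
have := pos_lab j k u t'; case: (pos j u == pos k t') => /= [->|].
  by case: (j == k) => //=; case: (u == t') => //; apply: single0.
by case: (j == k) => //= <-.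
Qed.

Lemma corner_map_mul i j k l x y :
  corner_map i j x ** corner_map k l y = if j == k then corner_map i l (x ** y) else 0.
Proof.
apply: (basis_bilinear (h := fun z => if j == k then corner_map i l z else 0));
  try exact: corner_map_linear.
  move=> a z w; case: ifP => _; first exact: corner_map_linear.
  by rewrite scaler0 addr0.
move=> z w; rewrite /corner_map !blift_basis corner_val_mul ?(valP z) ?(valP w) //.
rewrite basis_mul -[psg_mul (val z) (val w)](sub_mulE (@block_mem_mul _ _ ok) z w) /=.
case: (sub_mul _ _) => [c|] /=; first by rewrite blift_basis.
by rewrite (lin0 (blift_linear _)).
Qed.

Definition to_mx_val (x : tensor_psg I (diag_psg V)) : mxAlg S (ground R) :=
  if x.2 == v then @basis R (mx_psg S) (f x.1.1, f x.1.2) else 0.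

Lemma to_mx_mul x y : bm x -> bm y ->
  to_mx_val x ** to_mx_val y = oapp to_mx_val 0 (psg_mul x y).
Proof.
case: x y => [[t u] w] [[t' u'] w'] _ _.
have -> : oapp to_mx_val 0 (@psg_mul (tensor_psg I (diag_psg V)) (t, u, w) (t', u', w')) =
    if (u == t') && (w == w') then to_mx_val (t, u', w) else 0.
  by rewrite /= /tensor_op /=; case: (u == t') => //=; rewrite /diag_op; case: (w == w').
rewrite /to_mx_val /=; case: eqP => [->|nwv]; last by rewrite amul0l if_same.
rewrite [v == w']eq_sym; case: eqP => [_|nwv']; last by rewrite amul0r andbF.
rewrite basis_mul /= /mx_op /= (inj_eq f_inj) andbT.
by case: (u == t').
Qed.

Definition to_mx : alg_hom N (mxAlg S (ground R)) :=
  sub_lift (@block_mem_mul _ _ ok) to_mx_mul.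

Definition of_mx_val (x : mx_psg S) : mxAlg S N :=
  @single R (mx_psg S) N x (elt (t0, t0, v)).

Lemma of_mx_mul x y : of_mx_val x ** of_mx_val y = oapp of_mx_val 0 (psg_mul x y).
Proof.
rewrite /of_mx_val single_mul elt_mul ?rok // !eqxx /=.
by case: (mx_op x y).
Qed.

Definition of_mx : alg_hom (mxAlg S (ground R)) (mxAlg S N) := blift_hom of_mx_mul.

(** The two sides are the diagonal corners of one system of matrix units. So the projection to block
    [v] factors in [kk] through matrices over the ground ring. *)
Lemma fmap_trunc1 :
  Xm (mx_incl N s0) ∘ Xm (trunc [:: v]) = Xm of_mx ∘ Xm to_mx.
Proof.
rewrite -!fmap_alg_comp; apply/esym.
apply: (fmap_corners hX corner_map_linear corner_map_mul).
  apply: basis_ext => [||x]; first exact: (alg_homL (alg_comp _ _)).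
    exact: corner_map_linear.
  rewrite [RHS]blift_basis -[LHS]/(of_mx (to_mx (basis R x))) block_basis.
  rewrite [to_mx _]sub_lift_elt; last exact: valP.
  rewrite /to_mx_val /corner_val; case: eqP => _; last exact: linear0.
  by rewrite [LHS]blift_basis.
apply: basis_ext => [||x]; first exact: (alg_homL (alg_comp _ _)).
  exact: corner_map_linear.
rewrite [RHS]blift_basis -[LHS]/(mx_incl N s0 (trunc _ (basis R x))) block_basis.
rewrite trunc_elt; last exact: valP.
rewrite /corner_val inE; case: eqP => [<-|_]; last exact: linear0.
by case: (val x) => [[t u] w].
Qed.

End Factor.

Lemma block_local_iso (y y' : T) (theta : mor y y') :
  local_iso theta (X (ground R : Alg R)) -> local_iso theta (X (N : Alg R)).
Proof.
move=> Pg; have Pm : local_iso theta (X (mxAlg S (ground R) : Alg R)).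
  have [u [ui iu]] := sX (ground R) s0; exact: local_iso_retract1 Pg iu.
have [u [ui iu]] := sX N s0.
(* [of_mx] depends on a proof of [v \in r]; the values outside [r] do not enter the sum. *)
pose p v : mor (X N) (X (mxAlg S (ground R))) := if (v \in r) =P true is ReflectT vr then Xm (to_mx v) else 0.
pose q v : mor (X (mxAlg S (ground R))) (X N) :=
  if (v \in r) =P true is ReflectT vr then u ∘ Xm (of_mx vr) else 0.
apply: (@local_iso_retract _ _ _ theta (X N) V r (fun=> X (mxAlg S (ground R))) p q) => //.
rewrite -fmap_alg_id -trunc_id trunc_sum //; apply: eq_big_seq => v vr.
rewrite /p /q; case: eqP => // vr'.
by rewrite -compmA -fmap_trunc1 compmA ui compm_idl.
Qed.

End BlockAlgebra.

End MatrixStability.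

(** * The five lemma for Leavitt path algebras *)

(** The inner option adds the empty word and the outer one the spare index. The codes have length 0,
    1 and at least 2; in the last the entry [i 0] only lengthens the code. *)
Lemma word_injection (S X : choiceType) (i : nat -> S) (h : X -> S) :
  injective i -> injective h ->
  exists g : option (option (seq X * X)) -> S, injective g.
Proof.
move=> iinj hinj; have [g gI] := seq_injection iinj.
pose c (o : option (option (seq X * X))) : seq S := match o with
  | None => [::]
  | Some None => [:: i 0%N]
  | Some (Some (w, e)) => i 0%N :: h e :: map h w end.
exists (g \o c); apply: inj_comp gI _.
move=> [[[w e]|]|] [[[w' e']|]|] //= [] /hinj -> /(inj_map hinj) -> //.
Qed.

Section GraphTheory.
Variables (R : comPzRingType) (T : triangulated) (X : functor (Alg R) T).
Variables (dX : excision X) (hX : homotopy_invariant X).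
Variables (S : choiceType) (sX : matrix_stable S X).
Variables (G : digraph) (finG : finite_set [set: vertex G]).
Variables (i : nat -> S) (h : edge G -> S) (i_inj : injective i) (h_inj : injective h).
Variables (y y' : T) (theta : mor y y').
Hypothesis loc : local_iso theta (X (ground R : Alg R)).

Let vs : seq (vertex G) := fset_set [set: vertex G].

Let mem_vs v : v \in vs.
Proof. by rewrite /vs in_fset_set // in_setT. Qed.

Let vs_uniq : uniq vs.
Proof. exact: fset_uniq. Qed.

(** The blocks are the finitely many regular vertices; the empty word ends at each of them and
    serves as the common index [t0]. *)
Lemma ker_local_iso : local_iso theta (X (kerAlg R G : Alg R)).
Proof.
have [g gI] := word_injection i_inj h_inj.
pose f (w : seq (edge G)) : S :=
  g (if w is e :: w' then Some (Some (w', e)) else Some None).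
have fI : injective f by move=> [|e w] [|e' w'] /gI // [-> ->].
pose r := [seq v <- vs | `[< regular v >]].
apply: (@block_local_iso R T X dX hX S sX (seq (edge G)) (vertex G) (@ker_ok G)
  f fI (g None) _ [::] r) => //.
- by move=> w; apply/eqP => /gI; case: w.
- exact: filter_uniq.
- by move=> w v /andP[_ rv]; rewrite mem_filter rv mem_vs.
- by move=> v; rewrite mem_filter /ker_ok => /andP[-> _].
Qed.

(** A block algebra with all indices in every block: [ok] is constantly true, and [a] and [b] pass
    to and from the resulting subtype. *)
Lemma vertex_local_iso : local_iso theta (X (vertexAlg R G : Alg R)).
Proof.
have [g gI] := word_injection i_inj h_inj.
pose ok (t : idx G) (v : vertex G) := true.
have Pb : local_iso theta (X (convAlg (block_psg ok) (ground R) : Alg R)).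
  apply: (@block_local_iso R T X dX hX S sX (idx G) (vertex G) ok
    (g \o Some) _ (g None) _ None vs) => //.
  - by apply: inj_comp => // u v [].
  - by move=> t; apply/eqP => /gI.
have okM (x z : tensor_psg (idx G) (diag_psg (vertex G))) :
    sub_elt R (@block_mem_mul _ _ ok) x ** sub_elt R (@block_mem_mul _ _ ok) z =
    oapp (sub_elt R (@block_mem_mul _ _ ok)) 0 (psg_mul x z).
  exact: sub_elt_mul.
pose a : alg_hom (vertexAlg R G) (convAlg (block_psg ok) (ground R)) := blift_hom okM.
pose b : alg_hom (convAlg (block_psg ok) (ground R)) (vertexAlg R G) :=
  sub_lift (@block_mem_mul _ _ ok) (fun x z _ _ => basis_mul R x z).
apply: (local_iso_retract1 (p := fmap X (a : mor (vertexAlg R G : Alg R) _))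
  (q := fmap X (b : mor (_ : Alg R) (vertexAlg R G))) Pb).
rewrite -fmap_comp -fmap_id; congr fmap; apply: basis_hom_ext => x.
by rewrite -[LHS]/(b (a (basis R x))) [a _]blift_basis [LHS]sub_lift_elt.
Qed.

Lemma cohn_local_iso : local_iso theta (X (cohn R G : Alg R)).
Proof.
have [g gI] := word_injection i_inj h_inj.
have fI : injective (g \o Some) by apply: inj_comp => // u v [].
have [k [l lk]] := cohn_retract dX hX sX fI.
exact: local_iso_retract1 vertex_local_iso lk.
Qed.

Lemma leavitt_bijective : bijective (fun f : mor (X (leavitt R G : Alg R)) y => theta ∘ f).
Proof.
exact: local_iso_cone (bd_dist dX (cohn_extension R G)) ker_local_iso cohn_local_iso.
Qed.

End GraphTheory.

Lemma KH_act_bijective (R : comPzRingType) (T : triangulated)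
    (j : functor (Alg R) T) (KH : graded_functor R)
    (iota : kk_identification j KH) (A B : Alg R) (theta : kk j A B) (n : int) :
  bijective (KH_act iota theta n) <->
  bijective (fun x : mor (j (ground R : Alg R)) (Omegaz T n (j A)) =>
    fmap (Omegaz T n) (theta : mor (j A) (j B)) ∘ x).
Proof.
have iA : bijective (@kh_iso _ _ _ _ iota n A).
  by exists (@kh_iso_inv _ _ _ _ iota n A); [exact: kh_isoK|exact: kh_iso_invK].
have iB : bijective (@kh_iso _ _ _ _ iota n B).
  by exists (@kh_iso_inv _ _ _ _ iota n B); [exact: kh_isoK|exact: kh_iso_invK].
have vA : bijective (@kh_iso_inv _ _ _ _ iota n A).
  by exists (@kh_iso _ _ _ _ iota n A); [exact: kh_iso_invK|exact: kh_isoK].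
have vB : bijective (@kh_iso_inv _ _ _ _ iota n B).
  by exists (@kh_iso _ _ _ _ iota n B); [exact: kh_iso_invK|exact: kh_isoK].
split=> [b|b]; last exact: bij_comp iB (bij_comp b vA).
apply: (eq_bij (bij_comp vB (bij_comp b iA))) => x.
by rewrite /= /KH_act !kh_isoK.
Qed.

Theorem proposition5p10 (R : comPzRingType) (E F : digraph)
  (finE : finite_set [set: vertex E]) (finF : finite_set [set: vertex F])
  (KK : triangulated) (j : functor (Alg R) KK) (dj : excision j)
  (univ : universal_theory (disjoint_union E F) dj)
  (KH : graded_functor R) (iota : kk_identification j KH)
  (theta : kk j (leavitt R E) (leavitt R F))
  (iso0 : bijective (KH_act iota theta 0))
  (iso1 : bijective (KH_act iota theta 1)) :
  is_iso (theta : mor (j (leavitt R E)) (j (leavitt R F))) /\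
  forall n : int, bijective (KH_act iota theta n).
Proof.
have [[hj sj] _] := univ.
pose t : mor (j (leavitt R E)) (j (leavitt R F)) := theta.
(* [Omegaz KK 1] unfolds to [Omega], so degrees 0 and 1 are exactly the two halves of
   [local_iso]. *)
have loc : local_iso t (j (ground R : Alg R)).
  by split; [exact: (KH_act_bijective _ _ _).1 iso0|exact: (KH_act_bijective _ _ _).1 iso1].
(* The index set contains the natural numbers and the edges of both graphs, which is what the
   injections of words are built from. *)
have iI : injective (inr : nat -> graph_index (disjoint_union E F)) by move=> ? ? [].
have bE : bijective (fun f : mor (j (leavitt R E)) _ => t ∘ f).
  apply: (leavitt_bijective dj hj sj finE iI (h := fun e => inl (inr (inl e))) _ loc).
  by move=> ? ? [].
have bF : bijective (fun f : mor (j (leavitt R F)) _ => t ∘ f).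
  apply: (leavitt_bijective dj hj sj finF iI (h := fun e => inl (inr (inr e))) _ loc).
  by move=> ? ? [].
have tI : is_iso t.
  (* Surjectivity over [L(F)] gives a right inverse, and injectivity over [L(E)] makes it a left
     inverse. *)
  have [u _ tu] := bF; exists (u (idm _)); split; last exact: tu.
  by apply: (bij_inj bE); rewrite compmA tu compm_idl compm_idr.
split=> // n; apply/KH_act_bijective/is_iso_bijective/fmap_is_iso.
exact: tI.
Qed.
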